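(* Let $(X,\mathcal{X},\mu)$ be a probability space, let $T_1,\ldots,T_\ell\colon X\to X$ be commuting, invertible measure preserving transformations, and let $f_1,\ldots,f_\ell\in L^\infty(\mu)$. Let $p_1,\ldots,p_\ell\in\mathbb{Z}[t]$ be polynomials with distinct degrees and maximum degree $d$. Then there exists $k=k(d,\ell)\in\mathbb{N}$, depending only on $d$ and $\ell$, such that: if $f_i\perp\mathcal{Z}_{k,T_i}$ for some $i\in\{1,\ldots,\ell\}$, then $$\lim_{N-M\to\infty}\frac{1}{N-M}\sum_{n=M}^{N-1} f_1(T_1^{p_1(n)}x)\cdot\ldots\cdot f_\ell(T_\ell^{p_\ell(n)}x)=0$$ in $L^2(\mu)$.
   Context: All functions are real valued. $\lim_{N-M\to\infty}\frac{1}{N-M}\sum_{n=M}^{N-1}a_n=L$ means that the averages of $(a_n)_{n\in\mathbb{N}}$ over any sequence of intervals whose lengths tend to infinity converge to $L$. Seminorms: for an invertible measure preserving (not necessarily ergodic) transformation $T$ of $(X,\mathcal{X},\mu)$, let $\mathcal{I}(T)$ be the $\sigma$-algebra of $T$-invariant sets, write $Tf=f\circ T$, and for $f\in L^\infty(\mu)$ define inductively $$|||f|||_{1,T}=\|\mathbb{E}(f|\mathcal{I}(T))\|_{L^2(\mu)},\qquad |||f|||_{k+1,T}^{2^{k+1}}=\lim_{N-M\to\infty}\frac{1}{N-M}\sum_{n=M}^{N-1}|||f\cdot T^nf|||_{k,T}^{2^k}$$ (the limits exist and these are the Host–Kra seminorms). Factors: for $k\ge 1$, $\mathcal{Z}_{k-1,T}$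 is the $T$-invariant sub-$\sigma$-algebra of $\mathcal{X}$ (unique up to null sets) characterized by: for $f\in L^\infty(\mu)$, $\mathbb{E}(f|\mathcal{Z}_{k-1,T})=0$ if and only if $|||f|||_{k,T}=0$. For a sub-$\sigma$-algebra $\mathcal{Y}$, $f\perp\mathcal{Y}$ means $\mathbb{E}(f|\mathcal{Y})=0$.
   Formalization: The polynomial p_i attached to the index i with f_i ⊥ Z_{k,T_i} is assumed non-constant; otherwise the claim fails, e.g. ℓ=1, p_1=0, T_1 mixing and f_1≠0 with zero integral, where all averages equal f_1. *)

(* Defs.v *)
From HB Require Import structures.
From mathcomp Require Import all_boot all_order all_algebra.
From mathcomp Require Import all_classical all_reals all_analysis.

Set Implicit Arguments.
Unset Strict Implicit.
Unset Printing Implicit Defensive.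

Import Order.TTheory GRing.Theory Num.Theory.
Import numFieldNormedType.Exports.

Local Open Scope classical_set_scope.
Local Open Scope ring_scope.

Section transformations.
Context d (X : measurableType d) (R : realType) (mu : probability X R).

Record inv_mpt := InvMpt {
  mpt_fun :> X -> X;
  mpt_inv : X -> X;
  mpt_funK : cancel mpt_fun mpt_inv;
  mpt_invK : cancel mpt_inv mpt_fun;
  measurable_mpt_fun : measurable_fun setT mpt_fun;
  measurable_mpt_inv : measurable_fun setT mpt_inv;
  mpt_preserving : forall A, measurable A -> mu (mpt_fun @^-1` A) = mu A }.

Definition mpt_iter (T : inv_mpt) (n : int) : X -> X :=
  match n with
  | Posz m => iter m (mpt_fun T)
  | Negz m => iter m.+1 (mpt_inv T)
  end.

Definition invariant_sets (T : inv_mpt) : set (set X) :=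
  [set A | measurable A /\ T @^-1` A = A].

End transformations.

Section uniform_averages.
Context {R : realType}.

Definition interval_avg (a : nat -> R) (M N : nat) : R :=
  (N - M)%:R^-1 * \sum_(M <= n < N) a n.

(* The truncated subtraction is harmless: the condition forces M j < N j for
   all large j. *)
Definition growing_intervals (M N : nat -> nat) : Prop :=
  (N j - M j)%N @[j --> \oo] --> \oo.

Definition uavg_cvg (a : nat -> R) (L : R) : Prop :=
  forall M N : nat -> nat, growing_intervals M N ->
    interval_avg a (M j) (N j) @[j --> \oo] --> L.

(* 0 if the uniform averages do not converge *)
Definition uavg_lim (a : nat -> R) : R := xget 0 [set L | uavg_cvg a L].

Definition uavg_cvg_L2 d (X : measurableType d) (mu : probability X R)
    (a : nat -> X -> R) (g : X -> R) : Prop :=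
  forall M N : nat -> nat, growing_intervals M N ->
    'N[mu]_2%:E[EFin \o (fun x => interval_avg (a ^~ x) (M j) (N j) - g x)%R]%E
      @[j --> \oo] --> 0%E.

End uniform_averages.

Section conditional_expectation.
Context d (X : measurableType d) (R : realType) (mu : probability X R).

Definition sub_sigma_algebra (Y : set (set X)) : Prop :=
  sigma_algebra setT Y /\ Y `<=` measurable.

Definition is_cond_exp (Y : set (set X)) (f g : X -> R) : Prop :=
  [/\ forall B : set R, measurable B -> Y (g @^-1` B),
      mu.-integrable setT (EFin \o g) &
      forall A, Y A -> (\int[mu]_(x in A) (g x)%:E = \int[mu]_(x in A) (f x)%:E)%E].

(* A version of E(f | Y), which exists for f integrable and Y a
   sub-sigma-algebra, and is then unique up to a null set. *)
Definition cond_exp (Y : set (set X)) (f : X -> R) : X -> R :=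
  xget (cst 0) [set g | is_cond_exp Y f g].

Definition orth (f : X -> R) (Y : set (set X)) : Prop :=
  {ae mu, forall x, cond_exp Y f x = 0}.

End conditional_expectation.

Section host_kra.
Context d (X : measurableType d) (R : realType) (mu : probability X R).

(* |||f|||_{k,T} for k >= 1; the value at k = 0 is a dummy. *)
Fixpoint hk_seminorm (T : inv_mpt mu) (k : nat) (f : X -> R) : R :=
  match k with
  | 0 => 0
  | 1 => fine 'N[mu]_2%:E[EFin \o cond_exp mu (invariant_sets T) f]%E
  | (_.+1 as j).+1 =>
      uavg_lim (fun n : nat =>
        hk_seminorm T j (f \* (f \o mpt_iter T n%:Z)) ^+ (2 ^ j))
      `^ ((2 ^ j.+1)%:R^-1)
  end.

(* Z is a version of the factor Z_{k,T}, which is determined up to null sets;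
   its characteristic property involves the seminorm of order k + 1. *)
Record is_hk_factor (T : inv_mpt mu) (k : nat) (Z : set (set X)) : Prop := {
  hk_factor_sub : sub_sigma_algebra Z;
  hk_factor_inv : forall A, measurable A -> (Z (T @^-1` A) <-> Z A);
  hk_factorP : forall f, f \in Lfun mu +oo%E ->
    (orth mu f Z <-> hk_seminorm T k.+1 f = 0) }.

End host_kra.

(* Main.v *)
(** Limits are taken along an ultrafilter containing the given sequence of intervals, so
    that averaging becomes a shift invariant mean on bounded sequences, and the system
    extended by cube parameters ranging over such means is again a system, with a finitely
    additive expectation. By a weight trick it suffices to show that the averages tend to
    0 against arbitrary bounded weights.

    When [p_i] has the highest degree, its differences with the other iterates have leading
    coefficients along [T_i] alone, and van der Corput's inequality with PET induction bounds
    the average by a seminorm of [f_i] along [T_i]. In general, the functions of higher degree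
    are first replaced by dual functions, one at a time from the top. Suppose the limit Th is
    nonzero, let F be the Riesz representative of [G |-> Th(.., G, ..)] in the slot of highest
    degree not yet treated. Then Th(.., F, ..) = ||F||^2 <> 0, so F has nonzero seminorm by
    control of that slot, that is, F correlates with its own dual function D, and
    Th(.., D, ..) = <F, D> <> 0.

    In an extended system the iterates of a dual function are products of translates in the
    cube parameters only. Finitely many applications of van der Corput's inequality remove
    them, at the cost of replacing the product of the remaining functions by its Gowers norm
    in the time variable, and this norm is controlled by PET induction again. *)

(* Every order and every number of steps is fixed before the system, the functions and the
   coefficients are given. This is why lengths of families are tracked throughout and why the
   inductions run on bounds for weights, never on the families themselves.

   Distinct degrees enter because each seminorm concerns a single [T_i], whereas differencing mixes
   all the transformations: a leading coefficient along [T_i] survives only if no other iterate has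
   the same or a higher degree. Functions of higher degree therefore have to be traded for something
   that no longer moves the point of X.

   Dual functions depend on the mean, hence on the ultrafilter. This is harmless, since they occur
   only in an argument by contradiction under one fixed ultrafilter. Only the seminorms have to be
   compared across means, and the mean ergodic theorem shows that they agree.

   Exponent vectors are encoded as integer polynomials, with [T_j] acting as the monomial of degree
   j. The acting group is then the additive group of an integral domain, and PET induction handles
   polynomials with coefficients in that domain. *)
Require Import Defs.
From HB Require Import structures.
From mathcomp Require Import all_boot all_order all_algebra.
From mathcomp Require Import all_classical all_reals all_analysis.
From mathcomp Require Import measurable_realfun ess_sup_inf.
From mathcomp Require Import ring lra zify.

Set Implicit Arguments.
Unset Strict Implicit.
Unset Printing Implicit Defensive.

Import Order.TTheory GRing.Theory Num.Theory.
Import numFieldNormedType.Exports.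

Local Open Scope classical_set_scope.
Local Open Scope ring_scope.

(** * Positive functionals and invariant means *)

(* Expectations are only finitely additive: those of the systems extended by cube
   parameters integrate over an invariant mean on [int]. *)
Record fnl (R : realType) (Y : Type) := Fnl {
  dom : (Y -> R) -> Prop;
  ev : (Y -> R) -> R;
  dom_bd : forall f, dom f -> exists B, forall y, `|f y| <= B;
  dom_cst : forall c, dom (fun=> c);
  domD : forall f g, dom f -> dom g -> dom (fun y => f y + g y);
  domM : forall f g, dom f -> dom g -> dom (fun y => f y * g y);
  evD : forall f g, dom f -> dom g ->
    ev (fun y => f y + g y) = ev f + ev g;
  evZ : forall c f, dom f -> ev (fun y => c * f y) = c * ev f;
  ev1 : ev (fun=> 1) = 1;
  ev_ge0 : forall f, dom f -> (forall y, 0 <= f y) -> 0 <= ev f }.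

Section functional.
Context {R : realType} {Y : Type} (S : fnl R Y).
Implicit Types f g : Y -> R.

Lemma eq_ev f g : f =1 g -> ev S f = ev S g.
Proof. by move=> /funext ->. Qed.

Lemma eq_dom f g : f =1 g -> dom S f -> dom S g.
Proof. by move=> /funext ->. Qed.

Lemma domZ c f : dom S f -> dom S (fun y => c * f y).
Proof. by move=> df; apply: domM => //; exact: dom_cst. Qed.

Lemma domN f : dom S f -> dom S (fun y => - f y).
Proof.
by move=> df; apply: (eq_dom (f := fun y => -1 * f y)) => [y|];
  [rewrite mulN1r|exact: domZ].
Qed.

Lemma domB f g : dom S f -> dom S g -> dom S (fun y => f y - g y).
Proof. by move=> df dg; apply: domD => //; exact: domN. Qed.

Lemma domX f n : dom S f -> dom S (fun y => f y ^+ n).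
Proof.
move=> df; elim: n => [|n IH]; first exact: dom_cst.
by apply: (eq_dom (f := fun y => f y * f y ^+ n)) => [y|];
  [rewrite exprS|exact: domM].
Qed.

Lemma dom_sum (I : Type) (s : seq I) (F : I -> Y -> R) :
  (forall i, dom S (F i)) -> dom S (fun y => \sum_(i <- s) F i y).
Proof.
move=> dF; elim: s => [|i s IH].
  by apply: (eq_dom (f := fun=> 0)) => [y|];
    [rewrite big_nil|exact: dom_cst].
by apply: (eq_dom (f := fun y => F i y + \sum_(i <- s) F i y)) => [y|];
  [rewrite big_cons|exact: domD].
Qed.

Lemma dom_prod (I : Type) (s : seq I) (F : I -> Y -> R) :
  (forall i, dom S (F i)) -> dom S (fun y => \prod_(i <- s) F i y).
Proof.
move=> dF; elim: s => [|i s IH].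
  by apply: (eq_dom (f := fun=> 1)) => [y|];
    [rewrite big_nil|exact: dom_cst].
by apply: (eq_dom (f := fun y => F i y * \prod_(i <- s) F i y)) => [y|];
  [rewrite big_cons|exact: domM].
Qed.

Lemma ev_cst c : ev S (fun=> c) = c.
Proof.
rewrite (eq_ev (g := fun y => c * (fun=> 1) y)) => [|y]; last by rewrite mulr1.
by rewrite evZ ?ev1 ?mulr1//; exact: dom_cst.
Qed.

Lemma evN f : dom S f -> ev S (fun y => - f y) = - ev S f.
Proof.
by move=> df; rewrite -mulN1r -evZ//; apply: eq_ev => y; rewrite mulN1r.
Qed.

Lemma evB f g : dom S f -> dom S g ->
  ev S (fun y => f y - g y) = ev S f - ev S g.
Proof. by move=> df dg; rewrite evD ?evN//; exact: domN. Qed.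

Lemma ev_sum (I : Type) (s : seq I) (F : I -> Y -> R) :
  (forall i, dom S (F i)) ->
  ev S (fun y => \sum_(i <- s) F i y) = \sum_(i <- s) ev S (F i).
Proof.
move=> dF; elim: s => [|i s IH].
  by rewrite big_nil -[RHS](ev_cst 0); apply: eq_ev => y; rewrite big_nil.
rewrite big_cons -IH -evD//; last exact: dom_sum.
by apply: eq_ev => y; rewrite big_cons.
Qed.

Lemma ev_le f g : dom S f -> dom S g -> (forall y, f y <= g y) ->
  ev S f <= ev S g.
Proof.
move=> df dg fg; rewrite -subr_ge0 -evB//; apply: ev_ge0; first exact: domB.
by move=> y; rewrite subr_ge0.
Qed.

Lemma ev_norm_le f B : dom S f -> (forall y, `|f y| <= B) -> `|ev S f| <= B.
Proof.
move=> df fB; rewrite ler_norml -[X in X <= _ <= _]ev_cst -[X in _ <= _ <= X]ev_cst.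
by apply/andP; split; apply: ev_le => //; try exact: dom_cst;
  move=> y; have := fB y; rewrite ler_norml => /andP[].
Qed.

Lemma ev_sqr_ge0 f : dom S f -> 0 <= ev S (fun y => f y * f y).
Proof.
by move=> df; apply: ev_ge0 => [|y]; [exact: domM|rewrite -expr2 sqr_ge0].
Qed.

Lemma ev_CS f g : dom S f -> dom S g ->
  ev S (fun y => f y * g y) ^+ 2 <=
  ev S (fun y => f y * f y) * ev S (fun y => g y * g y).
Proof.
move=> df dg.
set a := ev S _; set c := ev S _; set e := ev S _.
have c0 : 0 <= c by exact: ev_sqr_ge0.
have e0 : 0 <= e by exact: ev_sqr_ge0.
have q t : 0 <= c + 2 * t * a + t ^+ 2 * e.
  have dfg : dom S (fun y => f y * g y) by exact: domM.
  have := ev_sqr_ge0 (domD df (domZ t dg)).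
  rewrite (eq_ev (g := fun y => (f y * f y + (2 * t) * (f y * g y)) +
    t ^+ 2 * (g y * g y))) => [|y]; last by ring.
  by rewrite !evD ?evZ//; do ?[apply: domD|apply: domZ|apply: domM].
have [e00|en0] := eqVneq e 0.
  have [->|an0] := eqVneq a 0; first by rewrite expr0n/= mulr_ge0.
  have := q (- (c + 1) / (2 * a)); rewrite e00 mulr0 addr0.
  have -> : 2 * (- (c + 1) / (2 * a)) * a = - (c + 1) by field.
  by move=> h; exfalso; lra.
have := q (- a / e).
have -> : c + 2 * (- a / e) * a + (- a / e) ^+ 2 * e = (c * e - a ^+ 2) / e.
  by field.
have ep : 0 < e by rewrite lt_neqAle eq_sym en0.
by rewrite pmulr_lge0 ?invr_gt0// subr_ge0.
Qed.

Lemma ev_sqr_le f : dom S f -> ev S f ^+ 2 <= ev S (fun y => f y ^+ 2).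
Proof.
move=> df; have := ev_CS (dom_cst S 1) df.
rewrite (ev_cst (1 * 1)) mulr1 mul1r.
rewrite (eq_ev (f := fun y => 1 * f y) (g := f)) => [h|y]; last by rewrite mul1r.
by apply: (le_trans h); rewrite le_eqVlt; apply/orP; left; apply/eqP.
Qed.

Lemma ev_pow2_le f s : dom S f -> (forall y, 0 <= f y) ->
  ev S f ^+ (2 ^ s) <= ev S (fun y => f y ^+ (2 ^ s)).
Proof.
move=> df f0; elim: s => [|s IH].
  by rewrite !expn0 expr1 le_eqVlt; apply/orP; left; apply/eqP; exact: eq_ev.
rewrite expnSr exprM.
apply: (@le_trans _ _ (ev S (fun y => f y ^+ (2 ^ s)) ^+ 2)).
  rewrite ler_pXn2r// ?nnegrE; last by apply: ev_ge0 => [|y]; [exact: domX|exact: exprn_ge0].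
  by rewrite exprn_ge0//; exact: ev_ge0.
apply: (le_trans (ev_sqr_le _)); first exact: domX.
by rewrite le_eqVlt; apply/orP; left; apply/eqP/eq_ev => y; rewrite -exprM.
Qed.

Lemma ev_abs_le f : dom S f -> dom S (fun y => `|f y|) ->
  `|ev S f| <= ev S (fun y => `|f y|).
Proof.
move=> df dnf; rewrite ler_norml -evN//.
by apply/andP; split; apply: ev_le => //; try exact: domN;
  move=> y; [rewrite lerNl -normrN|]; rewrite ler_norm.
Qed.

End functional.
Arguments eq_ev {R Y S f g}.
Arguments eq_dom {R Y S f g}.

Record mean (R : realType) := Mean {
  mfnl :> fnl R int;
  mdom : forall f, (exists B, forall n, `|f n| <= B) -> dom mfnl f;
  mshift : forall f m, dom mfnl f -> ev mfnl (fun n => f (n + m)) = ev mfnl f }.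

Lemma int_shift (A B : Type) (P : A -> Prop) (sh : int -> A -> A) (phi : A -> B) :
  (forall x, sh 0 x = x) -> (forall m n x, sh (m + n) x = sh m (sh n x)) ->
  (forall m x, P x -> P (sh m x)) -> (forall x, P x -> phi (sh 1 x) = phi x) ->
  forall m x, P x -> phi (sh m x) = phi x.
Proof.
move=> sh0 shD Psh h1.
have pos k x : P x -> phi (sh k%:Z x) = phi x.
  move=> Px; elim: k => [|k <-]; first by rewrite sh0.
  by rewrite -add1n PoszD shD h1//; exact: Psh.
case=> k x Px; first exact: pos.
rewrite -(pos k.+1 _ (Psh (Negz k) _ Px)) -shD.
by rewrite (_ : k.+1%:Z + Negz k = 0) ?sh0//; lia.
Qed.

Lemma shift_of_shift1 (R : realType) (phi : (int -> R) -> R) :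
  (forall x, (exists B, forall n, `|x n| <= B) -> phi (fun n => x (n + 1)) = phi x) ->
  forall x m, (exists B, forall n, `|x n| <= B) -> phi (fun n => x (n + m)) = phi x.
Proof.
move=> h1 x m; apply: (@int_shift _ _ _ (fun m x n => x (n + m)) phi) h1 m x.
- by move=> y; apply/funext => n; rewrite addr0.
- by move=> a b y; apply/funext => n; congr y; ring.
- by move=> a y [B yB]; exists B.
Qed.

Section means.
Context {R : realType} (L : mean R).
Implicit Types a : int -> R.

Lemma mdom1 a B : (forall n, `|a n| <= B) -> dom L a.
Proof. by move=> aB; apply: mdom; exists B. Qed.

Lemma mdom_shift a m : dom L a -> dom L (fun n => a (n + m)).
Proof. by move=> /dom_bd[B aB]; apply: (@mdom1 _ B) => n. Qed.

Lemma mdom_abs a : dom L a -> dom L (fun n => `|a n|).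
Proof. by move=> /dom_bd[B aB]; apply: (@mdom1 _ B) => n; rewrite normr_id. Qed.

(** The translates of a point are disjoint and have equal mass, so [N] times that mass is at most 1
    for every [N]. *)
Lemma ev_point (x : int) : ev L (fun n => (n == x)%:R) = 0.
Proof.
set c := ev L _.
have dc : dom L (fun n => (n == x)%:R).
  by apply: (@mdom1 _ 1) => n; case: eqP; rewrite ?normr1 ?normr0.
have c0 : 0 <= c by apply: ev_ge0.
have cN (N : nat) : c *+ N <= 1.
  have -> : c *+ N = ev L (fun n => \sum_(i < N) (n + i%:Z == x)%:R).
    transitivity (\sum_(i < N) c); first by rewrite sumr_const card_ord.
    rewrite (@ev_sum _ _ L _ _ (fun (i : 'I_N) n => (n + i%:Z == x)%:R)).
      by apply: eq_bigr => i _; rewrite (mshift (i%:Z) dc).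
    by move=> i; exact: (mdom_shift _ dc).
  rewrite -[leRHS](ev_cst L 1); apply: ev_le; last move=> n.
  - apply: dom_sum => i; exact: (mdom_shift _ dc).
  - exact: dom_cst.
  - rewrite -natr_sum -[1]/(1%:R) ler_nat.
    have [/existsP[i /eqP ni]|/existsPn ni] := boolP [exists i : 'I_N, n + i%:Z == x].
      rewrite (bigD1 i)//= ni eqxx big1// => j ji.
      apply/eqP; rewrite eqb0; apply: contra ji => /eqP nj.
      by apply/eqP/val_inj => /=; lia.
    by rewrite big1// => i _; rewrite (negbTE (ni i)).
apply/eqP; rewrite eq_le c0 andbT leNgt; apply/negP => cp.
have := archi_boundP (ltW (divr_gt0 (ltr01 : 0 < 1 :> R) cp)).
rewrite ltr_pdivrMr// mulrC mulr_natr.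
by rewrite ltNge cN.
Qed.

Lemma ev_cofinite a (bad : seq int) : dom L a ->
  (forall n, n \notin bad -> a n = 0) -> ev L a = 0.
Proof.
elim: bad a => [|x bad IH] a da ha.
  by rewrite -[RHS](ev_cst L 0); apply: eq_ev => n; exact: ha.
have dx : dom L (fun n => (n == x)%:R).
  by apply: (@mdom1 _ 1) => n; case: eqP; rewrite ?normr1 ?normr0.
have -> : a = (fun n => a n - a x * (n == x)%:R + a x * (n == x)%:R).
  by apply/funext => n; rewrite subrK.
have dz := domZ (a x) dx.
rewrite evD//; last exact: domB.
rewrite evZ// ev_point mulr0 addr0 IH//; first exact: domB.
move=> n nb; have [->|nx] := eqVneq n x; first by rewrite mulr1 subrr.
by rewrite mulr0 subr0 ha// in_cons negb_or nx.
Qed.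

End means.

Record is_act (R : realType) (G : zmodType) (Y : Type) (S : fnl R Y)
    (act : G -> Y -> Y) : Prop := IsAct {
  act0 : forall y, act 0 y = y;
  actD : forall a b y, act (a + b) y = act a (act b y);
  dom_act : forall a f, dom S f -> dom S (fun y => f (act a y));
  ev_act : forall a f, dom S f -> ev S (fun y => f (act a y)) = ev S f }.

(** * Van der Corput's inequality and the mean ergodic theorem *)

Section van_der_corput.
Context {R : realType} {Y : Type} (S : fnl R Y) (s : int -> Y -> Y).
Hypothesis hs : is_act S s.
Implicit Types f g : Y -> R.

(** Repeated halving with translates stands in for the projection onto invariant functions, which
    may not exist: the expectation is only finitely additive and its L2 space need not be
    complete. *)
Inductive orbit_average f : (Y -> R) -> Prop :=
| orbit_average0 : orbit_average f f
| orbit_averageS g m : orbit_average f g ->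
    orbit_average f (fun y => 2^-1 * (g y + g (s m y))).

Lemma orbit_average_dom f g : dom S f -> orbit_average f g -> dom S g.
Proof.
move=> df; elim=> // {}g m _ dg.
by apply/domZ/domD => //; exact: (dom_act hs).
Qed.

Lemma orbit_average_ind_val f g (X : (Y -> R) -> R) : dom S f ->
  (forall g m, dom S g -> X (fun y => 2^-1 * (g y + g (s m y))) = X g) ->
  orbit_average f g -> X g = X f.
Proof.
move=> df hX; elim=> // {}g m og IH; rewrite hX//; exact: orbit_average_dom og.
Qed.

(** Averaging a near-minimizer with one of its translates cannot bring the norm below the infimum;
    expanding the square, its correlation with that translate is almost its squared norm. *)
Lemma orbit_average_near_min f (eta : R) : dom S f -> 0 < eta ->
  exists g, orbit_average f g /\ forall m,
    ev S (fun y => g y * g y) - eta <= ev S (fun y => g y * g (s m y)).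
Proof.
move=> df eta0.
pose K := [set ev S (fun y => g y * g y) | g in orbit_average f].
have Ki : has_inf K.
  split; first by exists (ev S (fun y => f y * f y)); exists f => //; left.
  exists 0 => _ [g og <-]; apply: ev_sqr_ge0; exact: orbit_average_dom og.
have [_ [g og <-] gK] := inf_adherent (divr_gt0 eta0 (ltr0n R 2)) Ki.
exists g; split => // m.
have dg := orbit_average_dom df og.
have dgm := dom_act hs m dg.
have dgg : dom S (fun y => g y * g y) by exact: domM.
have : inf K <= ev S (fun y => (2^-1 * (g y + g (s m y))) * (2^-1 * (g y + g (s m y)))).
  apply: ge_inf; first by case: Ki.
  by exists (fun y => 2^-1 * (g y + g (s m y))) => //; right.
rewrite (eq_ev (g := fun y => 4^-1 * (g y * g y) +
   4^-1 * (g (s m y) * g (s m y)) + 2^-1 * (g y * g (s m y)))) => [|y]; last first.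
  by field.
rewrite !evD ?evZ//; do ?[apply: domD|apply: domZ|apply: domM] => //.
have := ev_act hs m dgg; move=> ->.
by move: gK; set i := inf K; set u := ev S _; set v := ev S _ => h1 h2; lra.
Qed.

Lemma dom_corr (L : mean R) f g : dom S f -> dom S g ->
  dom L (fun m => ev S (fun y => f y * g (s m y))).
Proof.
move=> df dg; have [A fA] := dom_bd df; have [B gB] := dom_bd dg.
apply: (@mdom1 _ _ _ (A * B)) => m; apply: ev_norm_le => [|y].
  by apply: domM => //; exact: (dom_act hs).
by rewrite normrM ler_pM.
Qed.

Lemma corr_shift (L : mean R) f g m : dom S f -> dom S g ->
  ev L (fun l => ev S (fun y => f (s m y) * g (s l y))) =
  ev L (fun l => ev S (fun y => f y * g (s l y))).
Proof.
move=> df dg; rewrite -[RHS](mshift (- m) (dom_corr L df dg)).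
apply: eq_ev => l; rewrite -[RHS](ev_act hs m); last first.
  by apply: domM => //; exact: (dom_act hs).
by apply: eq_ev => y; rewrite -(actD hs) addrNK.
Qed.

Lemma corr_shift_r (L : mean R) f g m : dom S f -> dom S g ->
  ev L (fun l => ev S (fun y => f y * g (s m (s l y)))) =
  ev L (fun l => ev S (fun y => f y * g (s l y))).
Proof.
move=> df dg; rewrite -[RHS](mshift m (dom_corr L df dg)).
by apply: eq_ev => l; apply: eq_ev => y; rewrite -(actD hs) addrC.
Qed.

Lemma corr_half_l (L : mean R) f g m : dom S f -> dom S g ->
  ev L (fun l => ev S (fun y => (2^-1 * (f y + f (s m y))) * g (s l y))) =
  ev L (fun l => ev S (fun y => f y * g (s l y))).
Proof.
move=> df dg; have dfm := dom_act hs m df.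
rewrite (eq_ev (g := fun l => 2^-1 * (ev S (fun y => f y * g (s l y)) +
   ev S (fun y => f (s m y) * g (s l y))))) => [|l]; last first.
  have dgl := dom_act hs l dg.
  have d1 := domM df dgl; have d2 := domM dfm dgl.
  rewrite -(evD d1 d2) -(evZ _ (domD d1 d2)).
  by apply: eq_ev => y; rewrite -mulrA mulrDl.
have c1 := dom_corr L df dg; have c2 := dom_corr L dfm dg.
by rewrite (evZ _ (domD c1 c2)) (evD c1 c2) corr_shift//; field.
Qed.

Lemma corr_half_r (L : mean R) f g m : dom S f -> dom S g ->
  ev L (fun l => ev S (fun y => f y * (2^-1 * (g (s l y) + g (s m (s l y)))))) =
  ev L (fun l => ev S (fun y => f y * g (s l y))).
Proof.
move=> df dg; have dgm := dom_act hs m dg.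
rewrite (eq_ev (g := fun l => 2^-1 * (ev S (fun y => f y * g (s l y)) +
   ev S (fun y => f y * g (s m (s l y)))))) => [|l]; last first.
  have dgl := dom_act hs l dg.
  have dgml := dom_act hs l dgm.
  have d1 := domM df dgl; have d2 := domM df dgml.
  rewrite -(evD d1 d2) -(evZ _ (domD d1 d2)).
  by apply: eq_ev => y; ring.
have c1 := dom_corr L df dg; have c2 := dom_corr L df dgm.
by rewrite (evZ _ (domD c1 c2)) (evD c1 c2) corr_shift_r//; field.
Qed.

Lemma orbit_average_corr (L : mean R) f g : dom S f -> orbit_average f g ->
  ev L (fun m => ev S (fun y => g y * g (s m y))) =
  ev L (fun m => ev S (fun y => f y * f (s m y))).
Proof.
move=> df; apply: (orbit_average_ind_val (X := fun g =>
  ev L (fun m => ev S (fun y => g y * g (s m y))))) => // {}g m dg.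
have dgm := dom_act hs m dg.
rewrite (@corr_half_l L g (fun y => 2^-1 * (g y + g (s m y))) m)//; last first.
  by apply/domZ/domD.
exact: corr_half_r.
Qed.

(* An orbit average of almost minimal norm is almost invariant, so its
   self-correlations all dominate its norm; [X] does not distinguish it from [f]. *)
Lemma vdc (L : mean R) f (X : (Y -> R) -> R) : dom S f ->
  (forall g m, dom S g -> X (fun y => 2^-1 * (g y + g (s m y))) = X g) ->
  (forall g, dom S g -> X g ^+ 2 <= ev S (fun y => g y * g y)) ->
  X f ^+ 2 <= ev L (fun m => ev S (fun y => f y * f (s m y))).
Proof.
move=> df hX hX2; apply/ler_addgt0Pr => eta eta0.
have [g [og hg]] := orbit_average_near_min df eta0.
have dg := orbit_average_dom df og.
rewrite -(orbit_average_ind_val df hX og) -(orbit_average_corr L df og).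
apply: (le_trans (hX2 _ dg)); rewrite -lerBlDr.
rewrite -[leLHS](ev_cst L); apply: ev_le => //; first exact: dom_cst.
exact: dom_corr.
Qed.

Lemma vdc_inv (L : mean R) f g : dom S f -> dom S g ->
  (forall y, `|g y| <= 1) -> (forall m y, g (s m y) = g y) ->
  ev S (fun y => g y * f y) ^+ 2 <= ev L (fun m => ev S (fun y => f y * f (s m y))).
Proof.
move=> df dg g1 gs.
apply: (vdc L (X := fun h => ev S (fun y => g y * h y))) => // h => [m dh|dh].
  have dhm := dom_act hs m dh.
  rewrite (eq_ev (g := fun y => 2^-1 * (g y * h y + g y * h (s m y)))); last first.
    by move=> y; ring.
  rewrite evZ ?evD; do ?[apply: domD|apply: domM] => //.
  have -> : ev S (fun y => g y * h (s m y)) = ev S (fun y => g y * h y).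
    rewrite -[RHS](ev_act hs m); last exact: domM.
    by apply: eq_ev => y; rewrite gs.
  by field.
apply: (le_trans (ev_CS dg dh)).
apply: ler_piMl; first exact: ev_sqr_ge0.
rewrite -[leRHS](ev_cst S); apply: ev_le; [exact: domM|exact: dom_cst|move=> y].
by rewrite -expr2 -real_normK ?num_real// exprn_ile1.
Qed.

(** An almost minimal orbit average [h] of [f] is almost invariant, so its correlations with the
    translates of [g] hardly vary with [m] and every mean gives them nearly the same value.
    Replacing [f] by [h] changes neither side. *)
Lemma mean_ergodic (L L' : mean R) f g : dom S f -> dom S g ->
  ev L (fun m => ev S (fun y => f y * g (s m y))) =
  ev L' (fun m => ev S (fun y => f y * g (s m y))).
Proof.
move=> df dg.
set c := ev S (fun y => g y * g y).
have c0 : 0 <= c by exact: ev_sqr_ge0.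
suff near (M : mean R) (eta : R) (h : Y -> R) : 0 < eta -> orbit_average f h ->
    (forall m, ev S (fun y => h y * h y) - eta <= ev S (fun y => h y * h (s m y))) ->
    (ev M (fun m => ev S (fun y => f y * g (s m y))) -
      ev S (fun y => h y * g y)) ^+ 2 <= 2 * eta * c.
  apply/eqP; rewrite -subr_eq0 -normr_eq0; apply/eqP/le_anti.
  rewrite normr_ge0 andbT; apply/ler_addgt0Pr => e e0; rewrite add0r.
  (* Cauchy-Schwarz leaves a squared error of [2 * eta * c]; dividing by [c + 1] instead of [c]
     covers [c = 0]. *)
  pose eta := (e / 2) ^+ 2 / (2 * (c + 1)).
  have eta0 : 0 < eta.
    by rewrite divr_gt0// ?exprn_gt0 ?divr_gt0// mulr_gt0// ltr_wpDl.
  have [h [oh hh]] := orbit_average_near_min df eta0.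
  have etac : 2 * eta * c <= (e / 2) ^+ 2.
    have -> : 2 * eta * c = (e / 2) ^+ 2 * (c / (c + 1)).
      by rewrite /eta; field; lra.
    rewrite ler_piMr ?sqr_ge0// ler_pdivrMr ?mul1r; lra.
  have close (M : mean R) : `|ev M (fun m => ev S (fun y => f y * g (s m y))) -
      ev S (fun y => h y * g y)| <= e / 2.
    rewrite -(@ler_pXn2r _ 2) ?nnegrE//; last by rewrite divr_ge0// ltW.
    rewrite real_normK ?num_real//; apply: (le_trans (near M _ _ eta0 oh hh) etac).
  have := ler_normD (ev L (fun m => ev S (fun y => f y * g (s m y))) -
    ev S (fun y => h y * g y)) (ev S (fun y => h y * g y) -
    ev L' (fun m => ev S (fun y => f y * g (s m y)))).
  rewrite addrA subrK => /le_trans; apply.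
  have := close L; have := close L'; rewrite distrC; lra.
move=> eta0 oh hh; have dh := orbit_average_dom df oh.
have <- : ev M (fun m => ev S (fun y => h y * g (s m y))) =
    ev M (fun m => ev S (fun y => f y * g (s m y))).
  apply: (orbit_average_ind_val (X := fun h =>
    ev M (fun m => ev S (fun y => h y * g (s m y))))) oh => // h' m dh'.
  exact: corr_half_l.
rewrite -[X in _ - X](ev_cst M) -evB; [|exact: dom_corr|exact: dom_cst].
apply: (le_trans (ev_sqr_le _)).
  by apply: domB; [exact: dom_corr|exact: dom_cst].
rewrite -[leRHS](ev_cst M); apply: ev_le; last move=> m.
- by apply: domX; apply: domB; [exact: dom_corr|exact: dom_cst].
- exact: dom_cst.
have dgm := dom_act hs m dg; have dhm := dom_act hs m dh.
have -> : ev S (fun y => h y * g y) = ev S (fun y => h (s m y) * g (s m y)).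
  by rewrite -(ev_act hs m (domM dh dg)).
rewrite -evB; try exact: domM.
rewrite (eq_ev (g := fun y => (h y - h (s m y)) * g (s m y))) => [|y]; last by ring.
apply: (le_trans (ev_CS (domB dh dhm) dgm)).
have -> : ev S (fun y => g (s m y) * g (s m y)) = c by exact: (ev_act hs m (domM dg dg)).
apply: ler_wpM2r => //.
rewrite (eq_ev (g := fun y => h y * h y + h (s m y) * h (s m y) -
  2 * (h y * h (s m y)))) => [|y]; last by ring.
rewrite evB ?evD ?evZ; do ?[apply: domD|apply: domZ|apply: domM] => //.
have := ev_act hs m (domM dh dh) => ->.
by have := hh m; set u := ev S _; set v := ev S _ => h1; lra.
Qed.

End van_der_corput.

(** * Extension of a system by a parameter ranging over a mean *)

Section extension.
Context {R : realType} (L : mean R) {Y : Type} (S : fnl R Y).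

Let edom (F : int * Y -> R) :=
  (exists B, forall z, `|F z| <= B) /\ forall n, dom S (fun y => F (n, y)).
Let eev (F : int * Y -> R) := ev L (fun n => ev S (fun y => F (n, y))).

Let edom_dom F : edom F -> dom L (fun n => ev S (fun y => F (n, y))).
Proof. by move=> [[B FB] dF]; apply: (@mdom1 _ _ _ B) => n; exact: ev_norm_le. Qed.

Fact ext_bd F : edom F -> exists B, forall z, `|F z| <= B.
Proof. by case. Qed.

Fact ext_cst c : edom (fun=> c).
Proof. by split=> [|n]; [exists (`|c|)|exact: dom_cst]. Qed.

Fact ext_D F F' : edom F -> edom F' -> edom (fun z => F z + F' z).
Proof.
move=> [[B FB] dF] [[B' FB'] dF']; split=> [|n]; last exact: domD.
by exists (B + B') => z; apply: (le_trans (ler_normD _ _)); exact: lerD.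
Qed.

Fact ext_M F F' : edom F -> edom F' -> edom (fun z => F z * F' z).
Proof.
move=> [[B FB] dF] [[B' FB'] dF']; split=> [|n]; last exact: domM.
by exists (B * B') => z; rewrite normrM ler_pM.
Qed.

Fact ext_evD F F' : edom F -> edom F' ->
  eev (fun z => F z + F' z) = eev F + eev F'.
Proof.
move=> dF dF'; rewrite /eev -evD; try exact: edom_dom.
by apply: eq_ev => n; rewrite evD; [|exact: dF.2|exact: dF'.2].
Qed.

Fact ext_evZ c F : edom F -> eev (fun z => c * F z) = c * eev F.
Proof.
move=> dF; rewrite /eev -evZ; last exact: edom_dom.
by apply: eq_ev => n; rewrite evZ//; exact: dF.2.
Qed.

Fact ext_ev1 : eev (fun=> 1) = 1.
Proof. by rewrite /eev !ev_cst. Qed.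

Fact ext_ge0 F : edom F -> (forall z, 0 <= F z) -> 0 <= eev F.
Proof.
move=> dF F0; apply: ev_ge0 => [|n]; first exact: edom_dom.
by apply: ev_ge0 => //; exact: dF.2.
Qed.

(** The domain asks only for a uniform bound and for slices in the domain of [S], because a mean
    accepts every bounded sequence. *)
Definition ext : fnl R (int * Y) := Fnl ext_bd ext_cst ext_D ext_M
  ext_evD ext_evZ ext_ev1 ext_ge0.

Lemma ext_shift_act : is_act ext (fun m (z : int * Y) => (z.1 + m, z.2)).
Proof.
split=> [[n y]|a b [n y]|a F|a F] /=.
- by rewrite addr0.
- by congr pair; ring.
- move=> [[B FB] dF]; split=> [|n]; last exact: dF.
  by exists B => z.
- move=> dF; exact: (mshift a (edom_dom dF)).
Qed.

End extension.

Record sys (R : realType) (G : zmodType) := Sys {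
  car :> Type;
  sfnl :> fnl R car;
  act : G -> car -> car;
  sysP : is_act sfnl act }.
Arguments sysP {R G} S : rename.
Arguments act {R G} S : rename.

Section system_extension.
Context {R : realType} {G : zmodType} (L : mean R).

(** The group moves the point and fixes the parameter; van der Corput's inequality in the parameter
    uses the other action, [ext_shift_act]. *)
Lemma ext_act (S : sys R G) :
  is_act (ext L S) (fun a (z : int * S) => (z.1, act S a z.2)).
Proof.
split=> [[n y]|a b [n y]|a F|a F] /=.
- by rewrite (act0 (sysP S)).
- by rewrite (actD (sysP S)).
- move=> [[B FB] dF]; split=> [|n]; first by exists B.
  exact: (dom_act (sysP S) a (dF n)).
- by move=> [_ dF]; apply: eq_ev => n; exact: (ev_act (sysP S) a (dF n)).
Qed.

Definition extsys (S : sys R G) : sys R G := Sys (ext_act S).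

Fixpoint isys (k : nat) (S : sys R G) : sys R G :=
  if k is j.+1 then extsys (isys j S) else S.

Fixpoint iproj (S : sys R G) (k : nat) : isys k S -> S :=
  if k is j.+1 then fun z : isys j.+1 S => @iproj S j (z.2 : isys j S) else id.

End system_extension.

Section unit_ball.
Context {R : realType} {Y : Type} (S : fnl R Y).

Definition u1 (f : Y -> R) := dom S f /\ forall y, `|f y| <= 1.

Lemma u1_cst1 : u1 (fun=> 1).
Proof. by split=> [|y]; [exact: dom_cst|rewrite normr1]. Qed.

Lemma u1M f g : u1 f -> u1 g -> u1 (fun y => f y * g y).
Proof.
move=> [df f1] [dg g1]; split=> [|y]; first exact: domM.
by rewrite normrM mulr_ile1.
Qed.

Lemma u1_prod (I : Type) (s : seq I) (F : I -> Y -> R) :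
  (forall i, u1 (F i)) -> u1 (fun y => \prod_(i <- s) F i y).
Proof.
move=> uF; split=> [|y]; first by apply: dom_prod => i; case: (uF i).
elim: s => [|i s IH]; first by rewrite big_nil normr1.
by rewrite big_cons normrM mulr_ile1//; case: (uF i).
Qed.

Lemma u1_ev f : u1 f -> `|ev S f| <= 1.
Proof. by move=> [df f1]; exact: ev_norm_le. Qed.

Lemma u1_act (G : zmodType) (a : G -> Y -> Y) g f :
  is_act S a -> u1 f -> u1 (fun y => f (a g y)).
Proof. by move=> ha [df f1]; split=> //; exact: (dom_act ha). Qed.

Lemma u1_dom f : u1 f -> dom S f. Proof. by case. Qed.

Lemma eq_u1 f g : f =1 g -> u1 f -> u1 g.
Proof. by move=> /funext ->. Qed.

End unit_ball.

(** * Gowers norms in the time variable *)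

Section gowers.
Context {R : realType} (L : mean R) {Y : Type} (S : fnl R Y).
Implicit Types b : int -> Y -> R.

(* The Gowers norms in the time variable: the parameters shift [n] only. *)
Fixpoint gow (s : nat) b : R :=
  if s is r.+1 then ev L (fun m => gow r (fun n y => b n y * b (n + m) y))
  else `|ev L (fun n => ev S (b n))|.

Definition ub b := forall n, u1 S (b n).

Lemma ub_step b m : ub b -> ub (fun n y => b n y * b (n + m) y).
Proof. by move=> hb n; exact: u1M. Qed.

Lemma ub_dom b : ub b -> dom L (fun n => ev S (b n)).
Proof. by move=> hb; apply: (@mdom1 _ _ _ 1) => n; exact: u1_ev. Qed.

Lemma ub_ext b : ub b -> dom (ext L S) (fun z => b z.1 z.2).
Proof. by move=> hb; split=> [|n]; [exists 1 => z|]; case: (hb z.1) || case: (hb n). Qed.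

Lemma gow_itv s b : ub b -> 0 <= gow s b <= 1.
Proof.
elim: s b => [|s IH] b hb /=.
  by rewrite normr_ge0/=; apply: ev_norm_le; [exact: ub_dom|move=> n; exact: u1_ev].
have hd : dom L (fun m => gow s (fun n y => b n y * b (n + m) y)).
  apply: (@mdom1 _ _ _ 1) => m.
  by have /andP[h0 h1] := IH _ (ub_step m hb); rewrite ger0_norm.
apply/andP; split.
  by apply: ev_ge0 => // m; have /andP[] := IH _ (ub_step m hb).
rewrite -[leRHS](ev_cst L); apply: ev_le => // [|m]; first exact: dom_cst.
by have /andP[] := IH _ (ub_step m hb).
Qed.

Lemma gow_ge0 s b : ub b -> 0 <= gow s b.
Proof. by move=> /(gow_itv s)/andP[]. Qed.

Lemma gow_dom s b : ub b ->
  dom L (fun m => gow s (fun n y => b n y * b (n + m) y)).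
Proof.
move=> hb; apply: (@mdom1 _ _ _ 1) => m.
by have /andP[h0 h1] := gow_itv s (ub_step m hb); rewrite ger0_norm.
Qed.

Lemma seq_corr_dom b : ub b ->
  dom L (fun m => ev L (fun n => ev S (fun y => b n y * b (n + m) y))).
Proof.
move=> hb; apply: (@mdom1 _ _ _ 1) => m; apply: ev_norm_le => [|n].
  exact: (ub_dom (ub_step m hb)).
exact: (u1_ev (ub_step m hb n)).
Qed.

(** The weight [g] does not depend on [n], so it is invariant under the time shift of the extended
    system and disappears. *)
Lemma vdc_seq g b : u1 S g -> ub b ->
  ev L (fun n => ev S (fun y => g y * b n y)) ^+ 2 <=
  ev L (fun m => ev L (fun n => ev S (fun y => b n y * b (n + m) y))).
Proof.
move=> [dg g1] hb.
apply: (vdc_inv (ext_shift_act L S) L (f := fun z => b z.1 z.2)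
  (g := fun z => g z.2)) => //; first exact: ub_ext.
by split=> [|n]; [exists 1|].
Qed.

Lemma vdc_gow0 g b : u1 S g -> ub b ->
  ev L (fun n => ev S (fun y => g y * b n y)) ^+ 2 <= gow 1 b.
Proof.
move=> ug hb; apply: (le_trans (vdc_seq ug hb)); rewrite /=.
by apply: ev_le => [||m]; [exact: seq_corr_dom|exact: (gow_dom 0)|exact: ler_norm].
Qed.

Lemma gow_sqr s b : ub b -> gow s b ^+ 2 <= gow s.+1 b.
Proof.
elim: s b => [|s IH] b hb.
  rewrite [gow 0 b]/= real_normK ?num_real//.
  apply: le_trans (vdc_gow0 (u1_cst1 S) hb).
  rewrite le_eqVlt; apply/orP; left; apply/eqP; congr (_ ^+ 2).
  by apply: eq_ev => n; apply: eq_ev => y; rewrite mul1r.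
have -> : gow s.+2 b = ev L (fun m => gow s.+1 (fun n y => b n y * b (n + m) y)) by [].
apply: (le_trans (ev_sqr_le (gow_dom s hb))).
by apply: ev_le => [||m]; [exact/domX/gow_dom|exact: gow_dom|exact/IH/ub_step].
Qed.

Lemma gow_pow s t b : ub b -> gow s b ^+ (2 ^ t) <= gow (s + t) b.
Proof.
move=> hb; elim: t => [|t IH]; first by rewrite expn0 expr1 addn0.
rewrite expnSr exprM addnS; apply: le_trans (gow_sqr _ hb).
by rewrite ler_pXn2r// nnegrE ?exprn_ge0// gow_ge0.
Qed.

End gowers.

Lemma gow_factor (R : realType) (L : mean R) (Y Z : Type) (S : fnl R Y)
    (S' : fnl R Z) (pi : Z -> Y) s (b : int -> Y -> R) :
  (forall f, ev S' (fun z => f (pi z)) = ev S f) ->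
  gow L S' s (fun n z => b n (pi z)) = gow L S s b.
Proof.
move=> hpi; elim: s b => [|s IH] b /=.
  by congr (`|_|); apply: eq_ev => n; rewrite hpi.
by apply: eq_ev => m; exact: (IH (fun n y => b n y * b (n + m) y)).
Qed.

(** * Seminorms along one direction, cubes and dual functions *)

Section seminorms.
Context {R : realType} {G : zmodType} (L : mean R).
Implicit Types S : sys R G.

Lemma line_act S (e : G) : is_act S (fun m : int => act S (e *~ m)).
Proof.
have hS := sysP S; split=> [y|a b y|a f df|a f df].
- by rewrite mulr0z (act0 hS).
- by rewrite mulrzDr (actD hS).
- exact: (dom_act hS).
- exact: (ev_act hS).
Qed.

Lemma actC S a b y : act S a (act S b y) = act S b (act S a y).
Proof. by rewrite -!(actD (sysP S)) addrC. Qed.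

Lemma u1a S a f : u1 S f -> u1 S (fun y => f (act S a y)).
Proof. exact: (u1_act _ (sysP S)). Qed.

Variable e : G.
Local Notation tau S m := (act S (e *~ m)).

(* [hku k f] is the [2^k]-th power of the seminorm of order [k] of [f] along [e];
   [dualf k g f] pairs [g] with the dual function of [f]. *)
Fixpoint hku S (k : nat) (f : S -> R) : R :=
  if k is j.+1 then ev L (fun m => hku j (fun y => f y * f (tau S m y)))
  else ev S f.

(** A box seminorm along [e] whose successive sides run over the multiples of the entries of [s]. *)
Fixpoint box S (s : seq int) (f : S -> R) : R :=
  if s is a :: s' then ev L (fun m => box s' (fun y => f y * f (tau S (a * m) y)))
  else ev S f.

Fixpoint dualf S (k : nat) (g f : S -> R) : R :=
  if k is j.+1 then ev L (fun h => dualf j (fun y => g y * f (tau S h y))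
                                           (fun y => f y * f (tau S h y)))
  else ev S g.

Lemma dualf_diag S k (f : S -> R) : dualf k f f = hku k f.
Proof. by elim: k f => [|k IH] f //=; apply: eq_ev => h; exact: IH. Qed.

Lemma u1_step S m (f : S -> R) : u1 S f -> u1 S (fun y => f y * f (tau S m y)).
Proof. by move=> uf; apply: u1M => //; exact: u1a. Qed.

Lemma hku_norm S k (f : S -> R) : u1 S f -> `|hku k f| <= 1.
Proof.
elim: k f => [|k IH] f uf /=; first exact: u1_ev.
by apply: ev_norm_le => [|m]; [apply: (@mdom1 _ _ _ 1) => m|]; exact/IH/u1_step.
Qed.

Lemma hku_dom S k (f : S -> R) : u1 S f ->
  dom L (fun m => hku k (fun y => f y * f (tau S m y))).
Proof. by move=> uf; apply: (@mdom1 _ _ _ 1) => m; exact/hku_norm/u1_step. Qed.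

Lemma box_norm S s (f : S -> R) : u1 S f -> `|box s f| <= 1.
Proof.
elim: s f => [|a s IH] f uf /=; first exact: u1_ev.
by apply: ev_norm_le => [|m]; [apply: (@mdom1 _ _ _ 1) => m|]; exact/IH/u1_step.
Qed.

Lemma box_dom S a s (f : S -> R) : u1 S f ->
  dom L (fun m => box s (fun y => f y * f (tau S (a * m) y))).
Proof. by move=> uf; apply: (@mdom1 _ _ _ 1) => m; exact/box_norm/u1_step. Qed.

Lemma hku1_sqr S (f : S -> R) : u1 S f -> hku 0 f ^+ 2 <= hku 1 f.
Proof.
move=> [df f1]; have := vdc_inv (line_act S e) L df (dom_cst S 1).
rewrite normr1 => /(_ (fun=> lexx _) (fun _ _ => erefl)).
by rewrite (eq_ev (f := fun y => 1 * f y) (g := f)) => // y; rewrite mul1r.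
Qed.

Lemma hku_ge0 S k (f : S -> R) : u1 S f -> 0 <= hku k.+1 f.
Proof.
elim: k f => [|k IH] f uf; first exact: (le_trans (sqr_ge0 _) (hku1_sqr uf)).
by apply: ev_ge0 => [|m]; [exact: (hku_dom k.+1 uf)|exact/IH/u1_step].
Qed.

Lemma hku_sqr S k (f : S -> R) : u1 S f -> hku k f ^+ 2 <= hku k.+1 f.
Proof.
elim: k f => [|k IH] f uf; first exact: hku1_sqr.
apply: (le_trans (ev_sqr_le (hku_dom k uf))).
by apply: ev_le => [||m];
  [exact: (domX 2 (hku_dom k uf))|exact: (hku_dom k.+1 uf)|exact/IH/u1_step].
Qed.

Lemma hku_eq0_le S j k (f : S -> R) : u1 S f -> (j <= k)%N ->
  hku k f = 0 -> hku j f = 0.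
Proof.
move=> uf jk; rewrite -(subnK jk); elim: (k - j)%N => // i IH h; apply: IH.
apply/eqP; rewrite -sqrf_eq0 eq_le sqr_ge0 andbT -h addSn; exact: hku_sqr.
Qed.

Lemma hku_act S k a (f : S -> R) : u1 S f ->
  hku k (fun y => f (act S a y)) = hku k f.
Proof.
elim: k f => [|k IH] f uf /=; first by case: uf => df _; exact: (ev_act (sysP S)).
apply: eq_ev => m; rewrite -[RHS]IH; last exact: u1_step.
by congr hku; apply/funext => y; rewrite actC.
Qed.

(* [cube f] multiplies the shifts of [f] over the vertices of the cube with sides the
   coordinates in [isys k]; [dcube f] leaves out the base vertex. *)
Fixpoint cube S (k : nat) (f : S -> R) : isys L k S -> R :=
  if k is j.+1 then fun z : isys L j.+1 S =>
    cube (fun y => f y * f (tau S z.1 y)) (z.2 : isys L j S)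
  else f.

Lemma cubeM S k (f g : S -> R) (z : isys L k S) :
  cube (fun y => f y * g y) z = cube f z * cube g z.
Proof.
elim: k f g z => [//|k IH] f g z /=; rewrite -IH.
by congr cube; apply/funext => y; ring.
Qed.

Lemma cube_act S k a (f : S -> R) (z : isys L k S) :
  cube (fun y => f (act S a y)) z = cube f (act (isys L k S) a z).
Proof.
elim: k f z => [//|k IH] f z /=; rewrite -IH.
by congr cube; apply/funext => y; rewrite actC.
Qed.

Lemma cube_u1 S k (f : S -> R) : u1 S f -> u1 (isys L k S) (@cube S k f).
Proof.
elim: k f => [//|k IH] f uf; split=> [|z]; last first.
  by have [_ ] := IH _ (u1_step z.1 uf); exact.
split=> [|n]; last by have [] := IH _ (u1_step n uf).
by exists 1 => z; have [_ ] := IH _ (u1_step z.1 uf); exact.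
Qed.

Lemma hku_cube S k (f : S -> R) : hku k f = ev (isys L k S) (@cube S k f).
Proof. by elim: k f => [//|k IH] f /=; apply: eq_ev => m; exact: IH. Qed.

Lemma hku_corr S k (f : S -> R) m : hku k (fun y => f y * f (tau S m y)) =
  ev (isys L k S) (fun z => cube f z * cube f (act (isys L k S) (e *~ m) z)).
Proof.
rewrite hku_cube; apply: eq_ev => z; rewrite cubeM; congr (_ * _).
exact: cube_act.
Qed.

(** By [hku_corr] the sequence consists of self-correlations of [cube f] in the cube system, to
    which the mean ergodic theorem applies. This independence of the outermost mean is what later
    identifies [hku] with the uniform limits defining the seminorms. *)
Lemma hku_mean S k (f : S -> R) (L1 L2 : mean R) : u1 S f ->
  ev L1 (fun m => hku k (fun y => f y * f (tau S m y))) =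
  ev L2 (fun m => hku k (fun y => f y * f (tau S m y))).
Proof.
move=> uf; have dc := u1_dom (cube_u1 k uf).
rewrite (eq_ev (hku_corr k f)) (eq_ev (S := L2) (hku_corr k f)).
exact: (mean_ergodic (line_act (isys L k S) e)).
Qed.

Fixpoint dcube S (k : nat) (f : S -> R) : isys L k S -> R :=
  if k is j.+1 then fun z : isys L j.+1 S =>
    cube f (act (isys L j S) (e *~ z.1) z.2) * dcube f (z.2 : isys L j S)
  else fun=> 1.

Lemma dcubeM S k (f g : S -> R) (z : isys L k S) :
  dcube (fun y => f y * g y) z = dcube f z * dcube g z.
Proof.
elim: k z => [z|k IH z] /=; first by rewrite mulr1.
by rewrite cubeM IH; ring.
Qed.

Lemma dcube_act S k a (f : S -> R) (z : isys L k S) :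
  dcube (fun y => f (act S a y)) z = dcube f (act (isys L k S) a z).
Proof.
by elim: k z => [//|k IH] z /=; rewrite IH cube_act actC.
Qed.

Lemma iproj_act S k a (z : isys L k S) :
  iproj (act (isys L k S) a z) = act S a (iproj z).
Proof. by elim: k z => [//|k IH] z /=; rewrite IH. Qed.

Lemma cube_dcube S k (f : S -> R) (z : isys L k S) :
  cube f z = f (iproj z) * dcube f z.
Proof.
elim: k f z => [|k IH] f z /=; first by rewrite mulr1.
by rewrite IH dcubeM dcube_act IH iproj_act; ring.
Qed.

Lemma dualf_dcube S k (g f : S -> R) :
  dualf k g f = ev (isys L k S) (fun z => g (iproj z) * dcube f z).
Proof.
elim: k g f => [|k IH] g f /=; first by apply: eq_ev => y; rewrite mulr1.
apply: eq_ev => h; rewrite IH; apply: eq_ev => z.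
by rewrite dcubeM dcube_act cube_dcube iproj_act; ring.
Qed.

Lemma dcube_u1 S k (f : S -> R) : u1 S f -> u1 (isys L k S) (@dcube S k f).
Proof.
move=> uf; elim: k => [|k [IHd IH1]]; first exact: u1_cst1.
have [dc c1] := cube_u1 k uf.
have nb z : `|@dcube S k.+1 f z| <= 1 by rewrite /= normrM mulr_ile1.
split=> //; split=> [|n]; first by exists 1.
by apply: domM => //; exact: (dom_act (sysP _)).
Qed.

End seminorms.

(** * Polynomial exhaustion *)

Section pet.
Context {G : idomainType}.
Implicit Types (u v : {poly G}) (L F : seq {poly G}).

Definition pshift (m : int) v : {poly G} := v \Po ('X + (m%:~R)%:P).

Lemma size_pshift m v : size (pshift m v) = size v.
Proof. by rewrite size_comp_poly2// size_XaddC. Qed.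

Lemma lead_pshift m v : lead_coef (pshift m v) = lead_coef v.
Proof. by rewrite lead_coef_comp ?size_XaddC// lead_coefXaddC expr1n mulr1. Qed.

Lemma horner_pshift m v x : (pshift m v).[x] = v.[x + m%:~R].
Proof. by rewrite horner_comp !hornerE. Qed.

Lemma pshiftB m u v : pshift m (u - v) = pshift m u - pshift m v.
Proof. exact: comp_polyB. Qed.

Lemma coef_pshift_sub m u k j : size u = k.+2 -> (k <= j)%N ->
  (pshift m u - u)`_j = if j == k then lead_coef u *+ k.+1 *~ m else 0.
Proof.
move=> su kj.
rewrite /pshift /comp_poly nderiv_taylor; last by rewrite /GRing.comm mulrC.
rewrite (size_map_inj_poly (@polyC_inj _) (polyC0 _)) su.
rewrite big_ord_recl/= nderivn0 expr0 mulr1.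
have E q : (map_poly polyC q).['X] = q :> {poly G} by exact: comp_polyXr.
rewrite E [_ + _ - _]addrC addKr coef_sum.
under eq_bigr => i _ do
  rewrite nderivn_map E -polyC_exp coefMC coef_nderivn.
rewrite big_ord_recl/= big1 ?addr0 => [|i _]; last first.
  by rewrite nth_default ?mul0rn ?mul0r// su /bump/=; lia.
rewrite bin1 expr1; case: eqP => [->|jk].
  by rewrite lead_coefE su /bump/= mulrzr.
by rewrite nth_default ?mul0rn ?mul0r// su /bump/=; lia.
Qed.

(** The weight of Bergelson's PET induction; the index [e] is the degree plus one. *)
Definition wt L (e : nat) := size (undup [seq lead_coef v | v <- L & size v == e]).

Lemma wt_le_size L e : (wt L e <= size L)%N.
Proof.
rewrite (leq_trans (size_undup _))// size_map size_filter; exact: count_size.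
Qed.

(* Subtracting a member [v0] of minimal size merges the class of its leading
   coefficient into lower sizes and creates no class at or above its size. *)
Lemma wt_drop L L' v0 : v0 \in L -> {in L, forall v, (size v0 <= size v)%N} ->
  (0 < size v0)%N ->
  {in L', forall x, exists2 w, x = w - v0 &
     exists2 v, v \in L & size w = size v /\ lead_coef w = lead_coef v} ->
  (wt L' (size v0) < wt L (size v0))%N /\
  (forall e, (size v0 < e)%N -> (wt L' e <= wt L e)%N).
Proof.
move=> v0L minv0 sv0 hL'; split=> [|e ve].
  set C := undup [seq lead_coef v | v <- L & size v == size v0].
  have l0C : lead_coef v0 \in C.
    by rewrite mem_undup; apply/map_f; rewrite mem_filter eqxx.
  apply: (@leq_ltn_trans (size [seq c - lead_coef v0 | c <- rem (lead_coef v0) C])).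
    apply: uniq_leq_size => [|c]; first exact: undup_uniq.
    rewrite mem_undup => /mapP[x]; rewrite mem_filter => /andP[/eqP sx xL'] ->.
    have [w xw [v vL [swv lwv]]] := hL' _ xL'.
    have sv : size v = size v0.
      apply/eqP; rewrite eqn_leq minv0// andbT leqNgt; apply/negP => lt.
      have := sx; rewrite xw size_polyDl ?size_polyN ?swv// => h.
      by rewrite h ltnn in lt.
    have lx : lead_coef x = lead_coef v - lead_coef v0.
      by rewrite [LHS]lead_coefE sx xw coefB -lwv !lead_coefE swv sv.
    rewrite lx; apply/map_f; rewrite mem_rem_uniq ?undup_uniq// inE; apply/andP; split.
      rewrite -subr_eq0 -lx lead_coef_eq0 -size_poly_eq0 sx.
      by rewrite -lt0n.
    by rewrite mem_undup; apply/map_f; rewrite mem_filter sv eqxx.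
  rewrite size_map size_rem// /wt -/C.
  by case: C l0C => //.
apply: uniq_leq_size => [|c]; first exact: undup_uniq.
rewrite !mem_undup => /mapP[x]; rewrite mem_filter => /andP[/eqP sx xL'] ->.
have [w xw [v vL [swv lwv]]] := hL' _ xL'.
have sw : size w = e.
  have [lt|ge] := ltnP (size v0) (size w).
    by move: sx; rewrite xw size_polyDl// size_polyN.
  have : (size x <= maxn (size w) (size v0))%N.
    by rewrite xw -(size_polyN v0); exact: size_polyD.
  by rewrite sx (maxn_idPr ge) leqNgt ve.
apply/mapP; exists v; first by rewrite mem_filter -swv sw eqxx.
by rewrite xw lead_coefDl// size_polyN sw.
Qed.

Definition nonc L := [seq v : {poly G} <- L | (1 < size v)%N].

Definition pstep v0 m L :=
  [seq v - v0 | v <- L] ++ [seq pshift m v - v0 | v <- L].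

(** Records that [s] van der Corput steps make the family constant. One translation must serve all
    shifts at once, so [v0] is chosen before [m]; constants are dropped because they can be absorbed
    into the weight. *)
Fixpoint elimin (s : nat) L : Prop :=
  all (fun v : {poly G} => (size v <= 1)%N) L \/
  if s is r.+1 then exists v0, forall m, elimin r (pstep v0 m (nonc L)) else False.

Lemma elimin_mono s t L : (s <= t)%N -> elimin s L -> elimin t L.
Proof.
elim: s t L => [|s IH] [|t] L //; first by move=> _ [] // ?; left.
by move=> st [?|[v0 hv0]]; [left|right; exists v0 => m; exact/IH/hv0].
Qed.

(** Induction for the lexicographic order in which the highest index counts most: [w'] is smaller at
    [e], no larger above [e], and arbitrary below. *)
Lemma lex_ind (D : nat) (P : (nat -> nat) -> Prop) :
  (forall w, (forall w' e, (e <= D)%N -> (w' e < w e)%N ->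
     (forall i, (e < i <= D)%N -> (w' i <= w i)%N) -> P w') -> P w) ->
  forall w, P w.
Proof.
elim: D P => [|D IH] P hP w.
  have [n] := ubnP (w 0%N); elim: n w => // n IHn w wn.
  apply: hP => w' [|e]// _ ww' _; apply: IHn; exact: leq_trans ww' _.
have [n] := ubnP (w D.+1); elim: n w => // n IHn w wn.
have {wn} : (w D.+1 <= n)%N by [].
move: w; apply: (IH (fun w => (w D.+1 <= n)%N -> P w)) => w IHw wn.
apply: hP => w' e; rewrite leq_eqVlt => /predU1P[->|eD] we hi.
  by apply: IHn; exact: leq_trans we wn.
apply: (IHw w' e) => // [i /andP[ei iD]|].
  by apply: hi; rewrite ei/= ltnW.
by apply: leq_trans wn; apply: hi; rewrite eD leqnn.
Qed.

Lemma uniform_bound (D : nat) (P : nat -> nat -> Prop) :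
  (forall e s t, (s <= t)%N -> P e s -> P e t) ->
  (forall e, (e <= D)%N -> exists s, P e s) ->
  exists s, forall e, (e <= D)%N -> P e s.
Proof.
move=> mono; elim: D => [|D IH] h.
  by have [s hs] := h 0%N (leqnn _); exists s => -[].
have [|s hs] := IH; first by move=> e eD; apply: h; exact: leqW.
have [t ht] := h D.+1 (leqnn _); exists (maxn s t) => e.
rewrite leq_eqVlt => /predU1P[->|eD]; first by apply: mono ht; exact: leq_maxr.
by apply: mono (hs _ eD); exact: leq_maxl.
Qed.

(** A majorant of the weight after a step at size [e]: below [e] only the length [r] of the new
    family bounds the number of classes. *)
Definition wt_below w e r := fun i : nat =>
  if (e < i)%N then w i else if i == e then (w e).-1 else r : nat.

Lemma min_size L : L != [::] ->
  exists2 v0, v0 \in L & {in L, forall v, (size v0 <= size v)%N}.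
Proof.
elim: L => // v L IH _; have [->|/IH[v0 v0L h]] := eqVneq L [::].
  by exists v; rewrite ?mem_head// => x; rewrite inE => /eqP ->.
have [le|lt] := leqP (size v) (size v0).
  exists v; rewrite ?mem_head// => x; rewrite inE => /predU1P[->//|/h].
  exact: leq_trans.
exists v0; first by rewrite inE v0L orbT.
by move=> x; rewrite inE => /predU1P[->|/h//]; exact: ltnW.
Qed.

Lemma nonc_P L v : v \in nonc L = (1 < size v)%N && (v \in L).
Proof. by rewrite mem_filter. Qed.

(** The induction runs on a majorant [w] of the weight, with the length [r] free, so the number of
    steps depends on [D] and [r] alone. The size of [v0] varies with the family, whence the maximum
    over all sizes taken by [uniform_bound]. *)
Lemma elimin_ex D r : exists s, forall L, (size L <= r)%N ->
  {in L, forall v, (size v <= D)%N} -> elimin s L.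
Proof.
suff H : forall w r, exists s, forall L, (size L <= r)%N ->
    {in L, forall v, (size v <= D)%N} ->
    (forall e, (1 < e <= D)%N -> (wt L e <= w e)%N) -> elimin s L.
  have [s hs] := H (fun=> r) r; exists s => L Lr LD; apply: hs => // e _.
  exact: leq_trans (wt_le_size _ _) _.
apply: (@lex_ind D) => w IH {}r.
have [| |S hS] := @uniform_bound D (fun e s => (0 < w e)%N -> forall L,
    (size L <= r + r)%N -> {in L, forall v, (size v <= D)%N} ->
    (forall i, (1 < i <= D)%N -> (wt L i <= wt_below w e (r + r) i)%N) ->
    elimin s L).
- by move=> e s t st h we L h1 h2 h3; apply: elimin_mono st _; exact: h.
- move=> e eD; have [we0|we] := posnP (w e); first by exists 0%N.
  have [| |s hs] := IH (wt_below w e (r + r)) e eD _ _ (r + r)%N.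
  + by rewrite /wt_below ltnn eqxx prednK.
  + by move=> i /andP[ei _]; rewrite /wt_below ei.
  by exists s => _; exact: hs.
exists S.+1 => L Lr LD Lw.
have [/eqP L0|/min_size[v0 v0L vmin]] := boolP (nonc L == [::]).
  left; apply/allP => v vL; rewrite leqNgt; apply/negP => v1.
  by have := nonc_P L v; rewrite L0 v1 vL.
right; exists v0 => m.
have [v01 v0L'] : (1 < size v0)%N /\ v0 \in L by apply/andP; rewrite -nonc_P.
have sN : (size (nonc L) <= r)%N.
  by apply: leq_trans Lr; rewrite size_filter; exact: count_size.
have [h1 h2] : (wt (pstep v0 m (nonc L)) (size v0) < wt (nonc L) (size v0))%N /\
  (forall e, (size v0 < e)%N -> (wt (pstep v0 m (nonc L)) e <= wt (nonc L) e)%N).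
  apply: wt_drop => //; first exact: ltnW.
  move=> x; rewrite mem_cat => /orP[] /mapP[v vL ->].
    by exists v => //; exists v.
  by exists (pshift m v) => //; exists v => //; rewrite size_pshift lead_pshift.
have wtn e : (1 < e)%N -> wt (nonc L) e = wt L e.
  move=> e1; rewrite /wt /nonc -filter_predI; congr (size (undup (map _ _))).
  by apply: eq_filter => v /=; case: eqP => // ->; rewrite e1.
have wv0 : (0 < w (size v0))%N.
  rewrite (leq_trans _ (Lw (size v0) _)) ?v01 ?LD// -wtn//; exact: leq_ltn_trans h1.
apply: (hS (size v0)) => //; first exact: LD.
- by rewrite size_cat !size_map leq_add.
- move=> x; rewrite mem_cat => /orP[] /mapP[v].
    rewrite nonc_P => /andP[_ vL] ->.
    by rewrite (leq_trans (size_polyD _ _))// size_polyN geq_max !LD.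
  rewrite nonc_P => /andP[_ vL] ->.
  by rewrite (leq_trans (size_polyD _ _))// size_polyN size_pshift geq_max !LD.
- move=> i /andP[i1 iD]; rewrite /wt_below; case: ltnP => [vi|iv].
    by apply: (leq_trans (h2 _ vi)); rewrite wtn// Lw// i1.
  case: eqP => [->|_].
    rewrite -ltnS prednK//; apply: leq_trans h1 _.
    by rewrite wtn// Lw// v01 LD.
  by rewrite (leq_trans (wt_le_size _ _))// size_cat !size_map leq_add.
Qed.

End pet.

(** * Eliminating the dual functions *)

Definition bfun (R : realType) (Y : Type) (S : fnl R Y) := {f : Y -> R | u1 S f}.

(** Jensen's inequality for a power that is even, since [p] is positive; the sign of [a] then does
    not matter. *)
Lemma gow_even_le (R : realType) (L : mean R) (a c : int -> R) p :
  (0 < p)%N -> dom L a -> dom L c ->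
  (forall m, a m ^+ (2 ^ p) <= c m) -> ev L a ^+ (2 ^ p) <= ev L c.
Proof.
move=> p0 da dc ac; have dna := mdom_abs da.
have even2 (x : R) : x ^+ (2 ^ p) = `|x| ^+ (2 ^ p).
  by rewrite -[p]prednK// expnS !exprM real_normK ?num_real.
rewrite even2; apply: (@le_trans _ _ (ev L (fun m => `|a m|) ^+ (2 ^ p))).
  by rewrite lerXn2r ?nnegrE ?ev_ge0//; exact: ev_abs_le.
apply: (le_trans (ev_pow2_le p dna _)) => //.
by apply: ev_le => // [|m]; [exact: domX|rewrite -even2].
Qed.

Section elimination.
Context {R : realType} {G : idomainType} (L : mean R) {Y : Type} (S : fnl R Y).
Variable s : G -> Y -> Y.
Hypothesis hs : is_act S s.
Implicit Types F : seq ({poly G} * bfun S).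

Definition wprod F (n : int) (y : Y) := \prod_(c <- F) sval c.2 (s c.1.[n%:~R] y).

Lemma wprod_u1 F n : u1 S (wprod F n).
Proof.
by apply: u1_prod => c; apply: (@u1_act _ _ _ _ s _ _ hs); exact: (svalP c.2).
Qed.

Definition shiftF v0 m F := [seq (c.1 - v0, c.2) | c <- F] ++
  [seq (pshift m c.1 - v0, c.2) | c <- F].

Lemma wprod_shiftF v0 m F n y : wprod (shiftF v0 m F) n y =
  wprod F n (s (- v0.[n%:~R]) y) * wprod F (n + m) (s (- v0.[n%:~R]) y).
Proof.
rewrite /wprod big_cat !big_map/=; congr (_ * _); apply: eq_bigr => c _.
  by rewrite -(actD hs) !hornerE.
by rewrite -(actD hs) hornerD hornerN horner_pshift intrD.
Qed.

Definition constF F := [seq c <- F | (size (c.1 : {poly G}) <= 1)%N].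
Definition noncF F := [seq c <- F | (1 < size (c.1 : {poly G}))%N].

Lemma wprod_split F n y : wprod F n y = wprod (constF F) 0 y * wprod (noncF F) n y.
Proof.
rewrite /wprod !big_filter (bigID (fun c => size (c.1 : {poly G}) <= 1)%N)/=.
congr (_ * _); last by apply: eq_bigl => c; rewrite ltnNge.
by apply: eq_bigr => c /size1_polyC ->; rewrite !hornerC.
Qed.

Lemma fst_noncF F : [seq c.1 | c <- noncF F] = nonc [seq c.1 | c <- F].
Proof. by rewrite /nonc filter_map. Qed.

Lemma absorb_const F (g : Y -> R) : u1 S g -> exists2 g', u1 S g' & forall b,
  ev L (fun n => ev S (fun y => g y * (b n y * wprod F n y))) =
  ev L (fun n => ev S (fun y => g' y * (b n y * wprod (noncF F) n y))).
Proof.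
move=> ug; exists (fun y => g y * wprod (constF F) 0 y).
  exact: u1M ug (wprod_u1 _ _).
by move=> c; apply: eq_ev => n; apply: eq_ev => y; rewrite wprod_split; ring.
Qed.

Lemma elim_const r F (b : int -> Y -> R) (g : Y -> R) :
  all (fun v : {poly G} => (size v <= 1)%N) [seq c.1 | c <- F] ->
  ub S b -> u1 S g ->
  ev L (fun n => ev S (fun y => g y * (b n y * wprod F n y))) ^+ (2 ^ r.+1) <=
  gow L S r.+1 b.
Proof.
move=> hF hb ug; have [g' ug' ->] := absorb_const F ug.
have -> : noncF F = [::].
  apply/nilP; rewrite /nilp size_filter -leqn0 leqNgt -has_count -all_predC.
  by move: hF; rewrite all_map; apply: sub_all => c /=; rewrite -leqNgt.
rewrite (eq_ev (g := fun n => ev S (fun y => g' y * b n y))); last first.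
  by move=> n; apply: eq_ev => y; rewrite /wprod big_nil mulr1.
rewrite expnS exprM; apply: le_trans (gow_pow L 1 r hb).
by rewrite lerXn2r ?nnegrE ?gow_ge0 ?sqr_ge0//; exact: vdc_gow0.
Qed.

(** As [b] is fixed by the action, a van der Corput step replaces it by [b] times its time shift,
    exactly the step in the definition of [gow], while [F] moves one step down in [elimin]. *)
Lemma elim_one r F (b : int -> Y -> R) (g : Y -> R) :
  elimin r [seq c.1 | c <- F] -> ub S b -> (forall n m y, b n (s m y) = b n y) ->
  u1 S g ->
  ev L (fun n => ev S (fun y => g y * (b n y * wprod F n y))) ^+ (2 ^ r.+1) <=
  gow L S r.+1 b.
Proof.
elim: r F b g => [|r IH] F b g hF hb bs ug.
  by apply: elim_const => //; case: hF.
case: hF => [hF|[v0 hv0]]; first exact: elim_const.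
have [g' ug' ->] := absorb_const F ug.
have hw : ub S (fun n y => b n y * wprod (noncF F) n y).
  by move=> n; apply: u1M (hb n) (wprod_u1 _ _).
rewrite expnS exprM.
have dc := seq_corr_dom L hw.
have vc := vdc_seq L ug' hw.
apply: (le_trans (lerXn2r _ _ _ vc)); rewrite ?nnegrE ?sqr_ge0//.
  exact: le_trans (sqr_ge0 _) vc.
apply: (gow_even_le _ dc (gow_dom L r.+1 hb)) => // m.
pose F' := shiftF v0 m (noncF F).
rewrite (eq_ev (g := fun n => ev S (fun y => 1 * ((b n y * b (n + m) y) *
  wprod F' n y)))) => [|n]; last first.
  (* Translating by the value of [- v0] at time [n] preserves the expectation and [b], and turns the
     two copies of [F] into [F']. *)
  rewrite -[LHS](ev_act hs (- v0.[n%:~R])); last exact: (u1_dom (ub_step m hw n)).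
  by apply: eq_ev => y; rewrite /F' wprod_shiftF !bs; ring.
apply: (IH F' (fun n y => b n y * b (n + m) y) (fun=> 1)) => //.
- by move: (hv0 m); rewrite /F' /shiftF map_cat -!map_comp -fst_noncF /pstep -!map_comp.
- exact: ub_step.
- by move=> n k y; rewrite !bs.
- exact: u1_cst1.
Qed.

End elimination.

(** Differencing affects the weight [w] only through [sh], so a bound for the plain mean of [b]
    times a weight passes to Gowers norms of order [t]. [P t] is the class of families that can
    still undergo [t] applications of [sh]. *)
Lemma gow_iter (R : realType) (L : mean R) (Y Z : Type) (S0 : fnl R Y) (S : fnl R Z)
    (pi : Z -> Y) (Fam : Type) (w : Fam -> int -> Z -> R)
    (sh : int -> Fam -> Fam) (P : nat -> Fam -> Prop) p :
  (0 < p)%N -> (forall f, u1 S0 f -> u1 S (fun z => f (pi z))) ->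
  (forall A n, u1 S (w A n)) ->
  (forall A m n z, w (sh m A) n z = w A n z * w A (n + m) z) ->
  (forall t A m, P t.+1 A -> P t (sh m A)) ->
  (forall b A, ub S0 b -> P 0%N A ->
    ev L (fun n => ev S (fun z => b n (pi z) * w A n z)) ^+ (2 ^ p) <= gow L S0 p b) ->
  forall t b A, ub S0 b -> P t A ->
    gow L S t (fun n z => b n (pi z) * w A n z) ^+ (2 ^ p) <= gow L S0 (t + p) b.
Proof.
move=> p0 hpi uw wsh Psh H; elim=> [|t IH] b A hb PA.
  rewrite [gow _ _ 0 _]/= -[p in (2 ^ p)%N]prednK// expnS !exprM.
  by rewrite real_normK ?num_real// -exprM -expnS prednK//; exact: H.
rewrite addSn [gow _ _ t.+1 _]/= [gow _ _ (t + p).+1 _]/=.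
have hbw : ub S (fun n z => b n (pi z) * w A n z).
  by move=> n; apply: u1M => //; exact: hpi (hb n).
apply: (gow_even_le _ (gow_dom L t hbw) (gow_dom L (t + p) hb)) => // m.
have := IH _ (sh m A) (ub_step m hb) (Psh _ _ m PA).
congr (_ ^+ _ <= _); congr gow; apply/funext => n; apply/funext => z.
by rewrite wsh; ring.
Qed.

Lemma gow_pad (R : realType) (L : mean R) (Y : Type) (S : fnl R Y) b (x : R) p q :
  ub S b -> (p <= q)%N -> (0 < p)%N -> x ^+ (2 ^ p) <= gow L S p b ->
  x ^+ (2 ^ q) <= gow L S q b.
Proof.
move=> hb pq p0 h; rewrite -(subnKC pq) expnD exprM.
apply: le_trans (gow_pow L p _ hb).
rewrite lerXn2r ?nnegrE ?gow_ge0//.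
by rewrite -[p]prednK// expnS exprM exprn_ge0 ?sqr_ge0.
Qed.

(** * Elimination of the cube parameters *)

Section dual_products.
Context {R : realType} {G : zmodType} (L : mean R) (S : sys R G) (e : G).
Implicit Types F : seq ({poly int} * bfun S).

Definition dprod k F n (z : isys L k S) :=
  \prod_(c <- F) dcube e (sval c.2) (act (isys L k S) (e *~ c.1.[n]) z).

Definition shF m F := F ++ [seq (pshift m c.1, c.2) | c <- F].

Lemma dprod_u1 k F n : u1 (isys L k S) (@dprod k F n).
Proof. by apply: u1_prod => c; apply: u1a; exact/dcube_u1/(svalP c.2). Qed.

Lemma dprod_shF k m F n (z : isys L k S) :
  dprod (shF m F) n z = dprod F n z * dprod F (n + m) z.
Proof.
rewrite /dprod big_cat big_map/=; congr (_ * _); apply: eq_bigr => c _.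
by rewrite horner_pshift intz.
Qed.

Lemma iproj_dom k (f : S -> R) : dom S f -> dom (isys L k S) (fun z => f (iproj z)).
Proof.
elim: k => [//|k IH] df; have dk := IH df.
by have [B fB] := dom_bd df; split=> [|n]; [exists B => z; exact: fB|exact: dk].
Qed.

Lemma iproj_u1 k (f : S -> R) : u1 S f -> u1 (isys L k S) (fun z => f (iproj z)).
Proof. by move=> [df f1]; split=> [|z]; [exact: iproj_dom|exact: f1]. Qed.

Lemma cube_shift_u1 k (f : S -> R) : u1 S f ->
  u1 (ext L (isys L k S)) (fun z => cube e f (act (isys L k S) (e *~ z.1) z.2)).
Proof.
move=> uf; have [dc c1] := cube_u1 L e k uf.
split=> [|z]; last exact: c1.
by split=> [|n]; [exists 1 => z; exact: c1|exact: (dom_act (sysP _) _ dc)].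
Qed.

Definition lift_top k (c : {poly int} * bfun S) :
    {poly int} * bfun (ext L (isys L k S)) :=
  (c.1, exist _ _ (cube_shift_u1 k (svalP c.2))).

(** In the factor of [dcube] carrying the last parameter, translation by [q(n)] along [e] is a shift
    of that parameter by [q(n)]. This factor is thus a product of polynomial iterates for the shift
    action, under which everything else is invariant. *)
Lemma dprodS k F n (z : isys L k.+1 S) : dprod F n z =
  dprod F n (z.2 : isys L k S) *
  wprod (fun m (z : int * isys L k S) => (z.1 + m, z.2)) [seq lift_top k c | c <- F] n z.
Proof.
rewrite /dprod /wprod big_map -big_split/=; apply: eq_bigr => c _.
by rewrite mulrC -(actD (sysP _)) -mulrzDr intz.
Qed.

End dual_products.

(** Induction on the number of cube parameters: [elim_one] removes the last one at the cost of a
    Gowers norm of the remaining product, and [gow_iter] applies the induction hypothesis inside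
    that norm. *)
Lemma dual_elim (D r k : nat) : exists2 p, (0 < p)%N &
  forall (R : realType) (G : zmodType) (L : mean R) (S : sys R G) (e : G)
    (F : seq ({poly int} * bfun S)) (b : int -> S -> R) (g : isys L k S -> R),
  (size F <= r)%N -> all (fun c => (size (c.1 : {poly int}) <= D)%N) F ->
  ub S b -> u1 (isys L k S) g ->
  ev L (fun n => ev (isys L k S) (fun z => g z * (b n (iproj z) * dprod e F n z)))
    ^+ (2 ^ p) <= gow L S p b.
Proof.
elim: k r => [|k IH] r.
  exists 1%N => // R G L S e F b g _ _ hb ug.
  apply: le_trans (vdc_gow0 L ug hb); rewrite le_eqVlt; apply/orP; left; apply/eqP.
  congr (_ ^+ _); apply: eq_ev => n; apply: eq_ev => z.
  by rewrite /dprod big1 ?mulr1.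
have [s hs] := @elimin_ex int D r.
(* Each of the [s.+1] differencings in the Gowers norm doubles the product. *)
have [p p0 hp] := IH (r * 2 ^ s.+1)%N.
exists (s.+1 + p)%N => // R G L S e F b g Fr FD hb ug.
pose b' n (z : isys L k S) := b n (iproj z) * dprod e F n z.
have hb' : ub (isys L k S) b'.
  by move=> n; exact: u1M (iproj_u1 L k (hb n)) (dprod_u1 L e k F n).
have hb2 : ub (ext L (isys L k S)) (fun n z => b' n z.2).
  move=> n; have [d1 b1] := hb' n; split=> [|z]; last exact: b1.
  by split=> [|i]; [exists 1 => z; exact: b1|exact: d1].
have hel : elimin s [seq c.1 | c <- [seq lift_top L e k c | c <- F]].
  rewrite -map_comp; apply: hs; first by rewrite size_map.
  move=> v; elim: F FD {Fr b' hb' hb2} => // c F IHF /= /andP[cD FD].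
  by rewrite inE => /predU1P[->//|]; exact: IHF.
have := elim_one L (ext_shift_act L (isys L k S)) hel hb2 (fun _ _ _ => erefl) ug.
have fac f : ev (ext L (isys L k S)) (fun z => f z.2) = ev (isys L k S) f.
  exact: (ev_cst L (ev (isys L k S) f)).
rewrite (@gow_factor _ L _ _ (isys L k S) (ext L (isys L k S)) snd s.+1 b' fac).
have -> : (fun n => ev (ext L (isys L k S)) (fun z => g z * (b' n z.2 *
    wprod (fun m (z : int * isys L k S) => (z.1 + m, z.2))
      [seq lift_top L e k c | c <- F] n z))) =
  (fun n => ev (isys L k.+1 S) (fun z => g z * (b n (iproj z) * dprod e F n z))).
  by apply/funext => n; apply: eq_ev => z; rewrite dprodS /b' -!mulrA.
set X := ev L _ => h1.
have h2 : gow L (isys L k S) s.+1 b' ^+ (2 ^ p) <= gow L S (s.+1 + p) b.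
  apply: (@gow_iter R L S (isys L k S) S (isys L k S) (@iproj R G L S k) _
    (fun F => dprod e F) (@shF R G S)
    (fun t F => (size F * 2 ^ t <= r * 2 ^ s.+1)%N /\
       all (fun c => (size (c.1 : {poly int}) <= D)%N) F)) => //.
  - by move=> f; exact: iproj_u1.
  - by move=> A n; exact: dprod_u1.
  - by move=> A m n z; exact: dprod_shF.
  - move=> t A m [hA AD]; split.
      by rewrite size_cat size_map addnn -mul2n -mulnA mulnCA -expnS.
    rewrite all_cat AD all_map/=; apply: sub_all AD => c /=.
    by rewrite size_pshift.
  - move=> c A hc [hA AD]; rewrite muln1 in hA.
    have := hp R G L S e A c (fun=> 1) hA AD hc (u1_cst1 _).
    congr (_ ^+ _ <= _); apply: eq_ev => n; apply: eq_ev => z.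
    by rewrite mul1r.
  - by rewrite leq_mul2r Fr orbT.
rewrite expnD exprM; apply: le_trans h2.
rewrite lerXn2r ?nnegrE ?gow_ge0//.
by rewrite expnS exprM exprn_ge0 ?sqr_ge0.
Qed.

Definition is_dual (R : realType) (G : zmodType) (L : mean R) (S : sys R G) (e : G)
    (k : nat) (f D : S -> R) :=
  u1 S D /\ forall g, dom S g -> ev S (fun y => g y * D y) = dualf L e k g f.

(* A block stands for the factor [bdual] evaluated at the time [bpol n] along [bdir].
   [msys] carries one family of cube parameters per block, and [mprod B Q] is the
   product, over the blocks and over the times in the corresponding member of [Q],
   of the integrands of the dual functions. *)
Record block (R : realType) (G : zmodType) (L : mean R) (S : sys R G) := Block {
  bdir : G; border : nat; bpol : {poly int}; bbase : bfun S; bdual : S -> R;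
  bdualP : is_dual L bdir border (sval bbase) bdual }.

Section blocks.
Context {R : realType} {G : zmodType} {L : mean R} {S : sys R G}.
Implicit Types (B : seq (block L S)) (Q : seq (seq {poly int})).

Fixpoint msys B : sys R G :=
  if B is c :: B' then isys L (border c) (msys B') else S.

Fixpoint mproj B : msys B -> S :=
  match B with
  | [::] => id
  | c :: B' => fun z : msys (c :: B') =>
      @mproj B' (@iproj _ _ L (msys B') (border c) z)
  end.

Lemma mproj_u1 B (f : S -> R) : u1 S f -> u1 (msys B) (fun z => f (@mproj B z)).
Proof. by elim: B => [//|c B IH] uf /=; exact: (iproj_u1 L (border c) (IH uf)). Qed.

Lemma mproj_act B a (z : msys B) : mproj (act (msys B) a z) = act S a (mproj z).
Proof. by elim: B z => [//|c B IH] z /=; rewrite -IH -iproj_act. Qed.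

Definition mbase B (f : bfun S) : bfun (msys B) :=
  exist _ _ (mproj_u1 B (svalP f)).

Fixpoint mprod B Q (n : int) : msys B -> R :=
  match B with
  | [::] => fun=> 1
  | c :: B' => fun z : msys (c :: B') =>
      @dprod _ _ L (msys B') (bdir c) (border c)
        [seq (q, mbase B' (bbase c)) | q <- head [::] Q] n z *
      @mprod B' (behead Q) n (@iproj _ _ L (msys B') (border c) z)
  end.

Lemma mprod_u1 B Q n : u1 (msys B) (@mprod B Q n).
Proof.
elim: B Q => [|c B IH] Q /=; first exact: u1_cst1.
apply: (@u1M _ _ (isys L (border c) (msys B))); first exact: dprod_u1.
exact: (iproj_u1 L (border c) (IH _)).
Qed.

Definition shQ m Q := [seq qs ++ [seq pshift m q | q <- qs] | qs <- Q].

Lemma mprod_shQ B m Q n (z : msys B) :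
  mprod (shQ m Q) n z = mprod Q n z * mprod Q (n + m) z.
Proof.
elim: B Q z => [|c B IH] Q z /=; first by rewrite mulr1.
have -> : behead (shQ m Q) = shQ m (behead Q) by case: Q.
rewrite IH; set x := mprod _ n _; set y := mprod _ (n + m) _.
have -> : [seq (q, mbase B (bbase c)) | q <- head [::] (shQ m Q)] =
    shF m [seq (q, mbase B (bbase c)) | q <- head [::] Q].
  by case: Q {x y} => [//|q Q] /=; rewrite /shF map_cat -!map_comp.
by rewrite dprod_shF; ring.
Qed.

Lemma dualf_act (S' : sys R G) e k a (g f : S' -> R) : dom S' g -> dom S' f ->
  dualf L e k (fun y => g (act S' a y)) (fun y => f (act S' a y)) = dualf L e k g f.
Proof.
elim: k g f => [|k IH] g f dg df /=; first exact: (ev_act (sysP S')).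
apply: eq_ev => h; rewrite -[RHS]IH.
- by congr dualf; apply/funext => y; rewrite actC.
- by apply: domM => //; exact: (dom_act (sysP S')).
- by apply: domM => //; exact: (dom_act (sysP S')).
Qed.

(** The dual pairing multiplies [P] only by functions pulled back from [S], so it can be computed in
    any extension where [W] represents [P]. This is what allows the dual functions to be expanded
    one inside the other. *)
Lemma dualf_factor B (P : S -> R) (W : msys B -> R) e k (g f : S -> R) :
  (forall g, dom S g ->
    ev S (fun y => g y * P y) = ev (msys B) (fun z => g (mproj z) * W z)) ->
  dom S g -> dom S f ->
  dualf L e k (fun y => g y * P y) f =
  dualf L e k (fun z => g (mproj z) * W z) (fun z : msys B => f (mproj z)).
Proof.
move=> hPW; elim: k g f => [|k IH] g f dg df /=; first exact: hPW.
apply: eq_ev => h.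
have dfh := dom_act (sysP S) (e *~ h) df.
have := IH (fun y => g y * f (act S (e *~ h) y)) (fun y => f y * f (act S (e *~ h) y))
  (domM dg dfh) (domM df dfh).
move=> E; apply: (etrans _ (etrans E _)); congr dualf; apply/funext => y.
- by ring.
- by rewrite mproj_act; ring.
- by rewrite mproj_act.
Qed.

Definition Q0 B := [seq [:: bpol c] | c <- B].

Lemma dual_flatten B n (g : S -> R) : dom S g ->
  ev S (fun y => g y * \prod_(c <- B) bdual c (act S (bdir c *~ (bpol c).[n]) y)) =
  ev (msys B) (fun z => g (mproj z) * mprod (Q0 B) n z).
Proof.
elim: B g => [|c B IH] g dg /=.
  by apply: eq_ev => y; rewrite big_nil.
set P := fun y => \prod_(c <- B) bdual c (act S (bdir c *~ (bpol c).[n]) y).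
set q := bdir c *~ (bpol c).[n].
have [[dD D1] hD] := bdualP c.
have uP : u1 S P by apply: u1_prod => c'; apply: u1a; case: (bdualP c').
have dgP : dom S (fun y => g y * P y) by apply: domM => //; exact: u1_dom.
have uf := svalP (bbase c).
rewrite (eq_ev (g := fun y => (g y * P y) * bdual c (act S q y))); last first.
  by move=> y; rewrite big_cons /P; ring.
(* Translating back by [q] puts the dual function at its base point, where its defining property
   applies; the pairing is translated forward again afterwards. *)
rewrite -(ev_act (sysP S) (- q)); last first.
  by apply: domM => //; exact: (dom_act (sysP S)).
rewrite (eq_ev (g := fun y => (g (act S (- q) y) * P (act S (- q) y)) * bdual c y)).
  2: by move=> y; rewrite -(actD (sysP S) q) subrr (act0 (sysP S)).
rewrite (hD (fun y => g (act S (- q) y) * P (act S (- q) y))); last first.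
  exact: (dom_act (sysP S) (- q) dgP).
rewrite -(dualf_act _ _ q); [|exact: (dom_act (sysP S) (- q) dgP)|exact: u1_dom uf].
rewrite (_ : (fun y => _) = (fun y => g y * P y)); last first.
  by apply/funext => y; rewrite -(actD (sysP S)) addNr (act0 (sysP S)).
rewrite (@dualf_factor B P (mprod (Q0 B) n))//; last first.
  exact: (dom_act (sysP S) _ (u1_dom uf)).
rewrite dualf_dcube; apply: eq_ev => z.
rewrite /dprod big_seq1/= -mulrA; congr (_ * _); rewrite mulrC; congr (_ * _).
rewrite -dcube_act; congr dcube; apply/funext => y.
by rewrite mproj_act.
Qed.

End blocks.

Lemma multi_elim (D K kmax r : nat) : exists2 p, (0 < p)%N &
  forall (R : realType) (G : zmodType) (L : mean R) (S : sys R G) (B : seq (block L S))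
    (Q : seq (seq {poly int})) (b : int -> S -> R) (g : msys B -> R),
  (size B <= K)%N -> all (fun c => border c <= kmax)%N B ->
  all (fun qs => (size qs <= r)%N && all (fun q : {poly int} => (size q <= D)%N) qs) Q ->
  ub S b -> u1 (msys B) g ->
  ev L (fun n => ev (msys B) (fun z => g z * (b n (mproj z) * mprod Q n z)))
    ^+ (2 ^ p) <= gow L S p b.
Proof.
elim: K r => [|K IH] r.
  exists 1%N => // R G L S [|//] Q b g _ _ _ hb ug.
  apply: le_trans (vdc_gow0 L ug hb); rewrite le_eqVlt; apply/orP; left; apply/eqP.
  by congr (_ ^+ _); apply: eq_ev => n; apply: eq_ev => z; rewrite /= mulr1.
(* The exponent of [dual_elim] depends on the order of the block; one exponent has to serve all
   orders up to [kmax], and [gow_pad] raises the smaller ones. *)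
have [| |p0 hp0] := @uniform_bound kmax (fun k p => (0 < p)%N /\
  forall (R : realType) (G : zmodType) (L : mean R) (S : sys R G) (e : G)
    (F : seq ({poly int} * bfun S)) (b : int -> S -> R) (g : isys L k S -> R),
  (size F <= r)%N -> all (fun c => (size (c.1 : {poly int}) <= D)%N) F ->
  ub S b -> u1 (isys L k S) g ->
  ev L (fun n => ev (isys L k S) (fun z => g z * (b n (iproj z) * dprod e F n z)))
    ^+ (2 ^ p) <= gow L S p b).
- move=> k p q pq [pp h]; split; first exact: leq_trans pq.
  by move=> R G L S e F b g h1 h2 h3 h4; apply: (gow_pad h3 pq pp); exact: h.
- by move=> k _; have [p pp h] := dual_elim D r k; exists p.
have pp0 : (0 < p0)%N by case: (hp0 0%N).
have [p1 pp1 hp1] := IH (r * 2 ^ p0)%N.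
exists (p0 + p1)%N; first by rewrite addn_gt0 pp0.
move=> R G L S [|c B] Q b g sB kB QD hb ug.
  apply: (@gow_pad _ _ _ _ _ _ 1 _ hb) => //; first by rewrite addn_gt0 pp0.
  apply: le_trans (vdc_gow0 L ug hb); rewrite le_eqVlt; apply/orP; left; apply/eqP.
  by congr (_ ^+ _); apply: eq_ev => n; apply: eq_ev => z; rewrite /= mulr1.
move: kB => /= /andP[kc kB].
pose b' n (y : msys B) := b n (mproj y) * mprod (behead Q) n y.
have hb' : ub (msys B) b'.
  by move=> n; apply: u1M; [exact: mproj_u1 (hb n)|exact: mprod_u1].
have [_ /(_ R G L (msys B) (bdir c) [seq (q, mbase B (bbase c)) | q <- head [::] Q]
  b' g)] := hp0 _ kc.
have : (size (head [::] Q) <= r)%N && all (fun q : {poly int} => (size q <= D)%N) (head [::] Q).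
  by case: Q QD {b' hb'} => //= q Q /andP[].
move=> /andP[q1 q2] /(_ _ _ hb' ug); rewrite size_map all_map => /(_ q1 q2).
have -> : (fun n => ev (msys (c :: B)) (fun z => g z * (b n (mproj z) * mprod Q n z))) =
  (fun n => ev (isys L (border c) (msys B)) (fun z => g z * (b' n (iproj z) *
     dprod (bdir c) [seq (q, mbase B (bbase c)) | q <- head [::] Q] n z))).
  apply/funext => n; apply: eq_ev => z; congr (_ * _) => /=.
  by rewrite /b' [dprod _ _ _ _ * _]mulrC mulrA.
set X := ev L _ => h1.
have h2 : gow L (msys B) p0 b' ^+ (2 ^ p1) <= gow L S (p0 + p1) b.
  apply: (@gow_iter R L S (msys B) S (msys B) (@mproj R G L S B) _
    (fun Q => @mprod R G L S B Q) shQ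
    (fun t Q => all (fun qs => (size qs * 2 ^ t <= r * 2 ^ p0)%N &&
       all (fun q : {poly int} => (size q <= D)%N) qs) Q)) => //.
  - by move=> f; exact: mproj_u1.
  - by move=> A n; exact: mprod_u1.
  - by move=> A m n z; exact: mprod_shQ.
  - move=> t A m; rewrite all_map; apply: sub_all => qs /= /andP[hA AD]; apply/andP; split.
      by rewrite size_cat size_map addnn -mul2n -mulnA mulnCA -expnS.
    rewrite all_cat AD all_map/=; apply: sub_all AD => q /=.
    by rewrite size_pshift.
  - move=> a A hc AD.
    have AD' : all (fun qs => (size qs <= r * 2 ^ p0)%N &&
        all (fun q : {poly int} => (size q <= D)%N) qs) A.
      by apply: sub_all AD => qs; rewrite muln1.
    have := hp1 R G L S B A a (fun=> 1) sB kB AD' hc (u1_cst1 _).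
    congr (_ ^+ _ <= _); apply: eq_ev => n; apply: eq_ev => z.
    by rewrite mul1r.
  - case: Q QD {q1 q2 b' hb' X h1} => //= _ Q /andP[_]; apply: sub_all => qs /andP[h ->].
    by rewrite leq_mul2r h orbT.
rewrite expnD exprM; apply: le_trans h2.
rewrite lerXn2r ?nnegrE ?gow_ge0//.
by rewrite -[p0]prednK// expnS exprM exprn_ge0 ?sqr_ge0.
Qed.

(** * Control by the seminorm of the highest degree iterate *)

Section reduction.
Context {G : idomainType} (e : G).
Hypothesis he : forall z : int, e *~ z = 0 -> z = 0.
Implicit Types (u v : {poly G}) (F : seq {poly G}).

Definition along u := (1 < size u)%N /\ exists2 z : int, z != 0 & lead_coef u = e *~ z.

Definition reach0 u F :=
  [/\ size u = 2%N, {in F, forall v, (size v <= 2)%N}, along u &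
      {in F, forall v, along (u - v)}].

(* [u] is the iterate of the function to be controlled; its differences with the
   other iterates keep their leading coefficients on the line [e]. *)
Fixpoint reach (s : nat) u F : Prop :=
  reach0 u F \/
  if s is r.+1 then exists v0, exists bad : seq int, forall m, m \notin bad ->
    reach r (pshift m u - v0) ([seq v - v0 | v <- nonc F] ++
      u - v0 :: [seq pshift m v - v0 | v <- nonc F])
  else False.

Lemma reach_mono s t u F : (s <= t)%N -> reach s u F -> reach t u F.
Proof.
elim: s t u F => [|s IH] [|t] u F //; first by move=> _ [] // ?; left.
move=> st [?|[v0 [bad hv0]]]; first by left.
by right; exists v0, bad => m mb; exact/IH/hv0.
Qed.

Lemma along_pshift m u : along u -> along (pshift m u).
Proof. by rewrite /along size_pshift lead_pshift. Qed.

Lemma diff_along m u k : size u = k.+3 -> along u -> m != 0 ->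
  size (pshift m u - u) = k.+2 /\ exists2 z : int, z != 0 &
    lead_coef (pshift m u - u) = e *~ (z * m).
Proof.
move=> su [_ [z z0 lu]] m0.
have hc := coef_pshift_sub m su.
have hk : (pshift m u - u)`_k.+1 = e *~ (z * k.+2%:Z * m).
  by rewrite hc// eqxx lu pmulrn !mulrzA.
have nz : e *~ (z * k.+2%:Z * m) != 0.
  by apply/eqP => /he/eqP; rewrite !mulf_eq0 (negbTE z0) (negbTE m0).
have sz : size (pshift m u - u) = k.+2.
  apply/eqP; rewrite eqn_leq; apply/andP; split.
    by apply/leq_sizeP => j kj; rewrite hc ?(ltnW kj)// gtn_eqF.
  by rewrite ltnNge; apply/negP => /leq_sizeP/(_ k.+1 (leqnn _))/eqP; rewrite hk (negbTE nz).
split=> //; exists (z * k.+2%:Z); first by rewrite mulf_neq0.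
by rewrite lead_coefE sz.
Qed.

(** The difference [pshift m u - u] has size one less than [u], with leading coefficient a fixed
    multiple of [m] along [e]. It can cancel the leading term of [u - v] only if the sizes agree,
    and then for a single [m]. *)
Lemma along_shift u v : along u -> along (u - v) -> (2 < size u)%N ->
  exists m0 : int, forall m, m != 0 -> m != m0 -> along (pshift m u - v).
Proof.
move=> au [suv [z z0 luv]] su.
have [k suk] : exists k, size u = k.+3 by exists (size u - 3)%N; lia.
have [_ [z1 z10 _]] := au.
have E m : pshift m u - v = (pshift m u - u) + (u - v) by ring.
have [zd zd0 hd] : exists2 zd : int, zd != 0 & forall m, m != 0 ->
    size (pshift m u - u) = k.+2 /\ lead_coef (pshift m u - u) = e *~ (zd * m).
  have [_ [zu zu0 lu]] := au.
  exists (zu * k.+2%:Z); first by rewrite mulf_neq0.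
  move=> m m0; have [sd _] := diff_along suk au m0; split=> //.
  rewrite lead_coefE sd/= (coef_pshift_sub m suk)// eqxx lu.
  by rewrite pmulrn !mulrzA.
have [slt|sgt|seq] := ltngtP (size (u - v)) k.+2.
- exists 0 => m m0 _; have [sd ld] := hd m m0; rewrite E; split.
    by rewrite size_polyDl sd.
  by exists (zd * m); rewrite ?mulf_neq0// lead_coefDl ?sd.
- exists 0 => m m0 _; have [sd ld] := hd m m0; rewrite E addrC; split.
    by rewrite size_polyDl ?sd// (leq_trans _ sgt).
  by exists z => //; rewrite lead_coefDl ?sd.
(* The coefficient [zd * m + z] vanishes for at most this [m]; if [zd] does not divide [z], it never
   vanishes. *)
exists (- (z %/ zd)%Z) => m m0 mm; have [sd ld] := hd m m0.
have c1 : (pshift m u - v)`_k.+1 = e *~ (zd * m + z).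
  by rewrite E coefD mulrzDr -ld -luv !lead_coefE sd seq.
have nz : zd * m + z != 0.
  apply: contra mm => /eqP h; have -> : z = - m * zd by move: h; lia.
  by rewrite mulzK// opprK.
have s2 : size (pshift m u - v) = k.+2.
  apply/eqP; rewrite eqn_leq; apply/andP; split.
    by rewrite E (leq_trans (size_polyD _ _))// sd seq maxnn.
  rewrite ltnNge; apply/negP => /leq_sizeP/(_ k.+1 (leqnn _)); rewrite c1 => /he h.
  by rewrite h eqxx in nz.
split; first by rewrite s2.
by exists (zd * m + z) => //; rewrite lead_coefE s2.
Qed.

Lemma along_shift_all u F : along u -> {in F, forall v, along (u - v)} ->
  (2 < size u)%N -> exists bad : seq int, forall m, m \notin bad ->
    [/\ m != 0, along (pshift m u - u), along (pshift m u) &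
        {in F, forall v, along (pshift m u - v)}].
Proof.
move=> au; elim: F => [|v F IH] hF su.
  exists [:: 0] => m; rewrite inE => m0; split=> //; last exact: along_pshift.
  have [k suk] : exists k, size u = k.+3 by exists (size u - 3)%N; lia.
  have [sd [z z0 ld]] := diff_along suk au m0; split; first by rewrite sd.
  by exists (z * m); rewrite ?mulf_neq0.
have [v' vF|bad hb] := IH _ su; first by apply: hF; rewrite inE vF orbT.
have [m0 hm0] := along_shift au (hF v (mem_head _ _)) su.
exists (m0 :: bad) => m; rewrite inE negb_or => /andP[mm0 /hb[mn0 h1 h2 h3]].
split=> // v'; rewrite inE => /predU1P[->|/h3//]; exact: hm0.
Qed.

End reduction.

Section reduction_length.
Context {G : idomainType}.
Implicit Types (u v : {poly G}).

(** The induction of [elimin_ex], with the further demand that the new controlled polynomial keep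
    maximal size and that its differences stay along [e]. It stops at linear families. *)
Lemma reach_ex (D r : nat) : exists s,
  forall (e : G) (u : {poly G}) (F : seq {poly G}), (forall z : int, e *~ z = 0 -> z = 0) ->
  (size F <= r)%N -> (size u <= D)%N ->
  {in F, forall v, (size v <= size u)%N} -> along e u ->
  {in F, forall v, along e (u - v)} -> reach e s u F.
Proof.
suff H : forall (w : nat -> nat) r, exists s, forall (e : G) (u : {poly G}) (F : seq {poly G}),
    (forall z : int, e *~ z = 0 -> z = 0) -> (size F <= r)%N ->
    (size u <= D)%N -> {in F, forall v, (size v <= size u)%N} -> along e u ->
    {in F, forall v, along e (u - v)} ->
    (forall i, (1 < i <= D)%N -> (wt (u :: F) i <= w i)%N) -> reach e s u F.
  have [s hs] := H (fun=> r.+1) r; exists s => e u F he Fr uD Fu au aF; apply: hs => // i _.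
  exact: leq_trans (wt_le_size _ _) _.
apply: (@lex_ind D) => w IH {}r; set r' := (r + r.+1)%N.
have [| |S hS] := @uniform_bound D (fun i s => (0 < w i)%N -> forall (e : G) (u : {poly G}) (F : seq {poly G}),
    (forall z : int, e *~ z = 0 -> z = 0) -> (size F <= r')%N ->
    (size u <= D)%N -> {in F, forall v, (size v <= size u)%N} -> along e u ->
    {in F, forall v, along e (u - v)} ->
    (forall j, (1 < j <= D)%N -> (wt (u :: F) j <= wt_below w i r'.+1 j)%N) ->
    reach e s u F).
- by move=> i s t st h we e u F h1 h2 h3 h4 h5 h6 h7; apply: reach_mono st _; exact: h.
- move=> i iD; have [wi0|wi] := posnP (w i); first by exists 0%N.
  have [| |s hs] := IH (wt_below w i r'.+1) i iD _ _ r'.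
  + by rewrite /wt_below ltnn eqxx prednK.
  + by move=> j /andP[ij _]; rewrite /wt_below ij.
  by exists s => _; exact: hs.
exists S.+1 => e u F he Fr uD Fu au aF Fw.
have [u1 _] := au.
have [su2|su] : size u = 2%N \/ (2 < size u)%N by lia.
  by left; split=> // v vF; rewrite -su2; exact: Fu.
right.
set N := nonc F.
have NF v : v \in N -> v \in F by rewrite nonc_P => /andP[].
have N1 v : v \in N -> (1 < size v)%N by rewrite nonc_P => /andP[].
have LD v : v \in u :: N -> (size v <= size u)%N.
  by rewrite inE => /predU1P[->//|/NF/Fu].
have L1 v : v \in u :: N -> (1 < size v)%N by rewrite inE => /predU1P[->//|/N1].
(* In each of the three cases subtracting [v0] leaves [u] of maximal size: [v0] is smaller, or its
   leading coefficient differs, or all members share size and leading coefficient, and then all of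
   them drop while [pshift m u - u] drops by exactly one degree. *)
have [v0 [v0L v0min v0P]] : exists v0, [/\ v0 \in u :: N,
    {in u :: N, forall v, (size v0 <= size v)%N} &
    [\/ (size v0 < size u)%N, size v0 = size u /\ lead_coef v0 != lead_coef u |
      v0 = u /\ {in N, forall v, size v = size u /\ lead_coef v = lead_coef u}]].
  have [v0 v0L v0min] := @min_size _ (u :: N) isT.
  have := LD _ v0L; rewrite leq_eqVlt => /predU1P[sv0|lt]; last first.
    by exists v0; split=> //; apply: Or31.
  have allsz v : v \in u :: N -> size v = size u.
    by move=> vL; apply/eqP; rewrite eqn_leq LD//= -sv0 v0min.
  have [/hasP[v vN lv]|/hasPn h] := boolP (has (fun v => lead_coef v != lead_coef u) N).
    have vL : v \in u :: N by rewrite inE vN orbT.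
    exists v; split; first exact: vL.
      by move=> x xL; rewrite (allsz v vL) (allsz x xL).
    by apply: Or32; split=> //; exact: allsz.
  exists u; split; first exact: mem_head.
    by move=> x xL; rewrite (allsz x xL).
  apply: Or33; split=> // v vN; split; first by rewrite allsz// inE vN orbT.
  by apply/eqP; rewrite -[_ == _]negbK h.
have [bad hbad] := along_shift_all he au aF su.
exists v0, bad => m /hbad[m0 adu apu aFm].
set u' := pshift m u - v0; set F' := _ ++ _.
have sv0u : (size v0 <= size u)%N by exact: LD.
have F'P x : x \in F' -> exists2 w, x = w - v0 & [/\ along e (pshift m u - w),
    (size w <= size u)%N & exists2 v, v \in u :: N & size w = size v /\ lead_coef w = lead_coef v].
  rewrite mem_cat inE => /or3P[/mapP[v vN ->]|/eqP->|/mapP[v vN ->]].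
  - exists v => //; split; [exact/aFm/NF|exact/Fu/NF|].
    by exists v => //; rewrite inE vN orbT.
  - by exists u => //; split=> //; exists u; rewrite ?mem_head.
  - exists (pshift m v) => //; split; last 1 first.
    + by exists v; rewrite ?inE ?vN ?orbT// size_pshift lead_pshift.
    + by rewrite -pshiftB; exact/along_pshift/aF/NF.
    + by rewrite size_pshift; exact/Fu/NF.
have sub_size (x : {poly G}) : (size x <= size u)%N -> (size (x - v0)%R <= size u)%N.
  by move=> h; rewrite (leq_trans (size_polyD _ _))// size_polyN geq_max h.
have su'F x : x \in F' -> (size x <= size u')%N.
  move=> /F'P[w1 -> [aw wu [v vL [swv lwv]]]]; case: v0P => [lt|[sz ld]|[v0u hN]].
  - by rewrite /u' [size (pshift _ _ - _)]size_polyDl ?size_polyN size_pshift// sub_size.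
  - suff -> : size u' = size u by exact: sub_size.
    apply/eqP; rewrite eqn_leq sub_size ?size_pshift//= leqNgt; apply/negP => h.
    have : u'`_(size u).-1 = 0 by rewrite nth_default// -ltnS prednK// (ltn_trans _ su).
    rewrite coefB -{1}(size_pshift m) -{1}sz -!lead_coefE lead_pshift => /eqP.
    by rewrite subr_eq0 eq_sym (negbTE ld).
  have [k suk] : exists k, size u = k.+3 by exists (size u - 3)%N; lia.
  rewrite /u' v0u; have [-> _] := diff_along he suk au m0.
  have [swu lwu] : size w1 = size u /\ lead_coef w1 = lead_coef u.
    rewrite swv lwv; move: vL; rewrite inE => /predU1P[->//|/hN//].
  apply/leq_sizeP => j kj; rewrite coefB.
  have [jk|kj'] : j = k.+2 \/ (k.+2 < j)%N by lia.
    by rewrite jk; move: lwu; rewrite !lead_coefE swu suk => ->; rewrite subrr.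
  by rewrite !nth_default ?subrr// ?swu suk.
have [h1 h2] : (wt (u' :: F') (size v0) < wt (u :: N) (size v0))%N /\
  (forall i, (size v0 < i)%N -> (wt (u' :: F') i <= wt (u :: N) i)%N).
  apply: wt_drop => //; first by apply: ltnW; exact: L1.
  move=> x; rewrite inE => /predU1P[->|/F'P[w1 -> [_ _ hw]]]; last by exists w1.
  exists (pshift m u) => //; exists u; rewrite ?mem_head//.
  by rewrite size_pshift lead_pshift.
have wtn i : (1 < i)%N -> wt (u :: N) i = wt (u :: F) i.
  move=> i1; rewrite /wt /N /nonc /=.
  have -> : [seq v : {poly G} <- [seq v : {poly G} <- F | (1 < size v)%N] | size v == i] =
      [seq v : {poly G} <- F | size v == i].
    by rewrite -filter_predI; apply: eq_filter => v /=; case: eqP => // ->; rewrite i1.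
  by [].
have sN : (size N <= r)%N.
  by apply: leq_trans Fr; rewrite size_filter; exact: count_size.
have sF' : (size F' <= r')%N by rewrite size_cat /= !size_map leq_add.
have v01 := L1 _ v0L; have v0D : (size v0 <= D)%N by exact: leq_trans uD.
have wv0 : (0 < w (size v0))%N.
  rewrite (leq_trans _ (Fw (size v0) _)) ?v01//  -wtn//; exact: leq_ltn_trans h1.
apply: (hS (size v0) v0D wv0) => //.
- by apply: leq_trans uD; rewrite sub_size// size_pshift.
- rewrite /u'; have := v0L.
  by rewrite inE => /predU1P[->|/NF/aFm].
- by move=> x /F'P[w1 -> [aw _ _]]; rewrite /u' opprB addrA subrK.
- move=> i /andP[i1 iD]; rewrite /wt_below; case: ltnP => [vi|iv].
    by apply: (leq_trans (h2 _ vi)); rewrite wtn// Fw// i1.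
  case: eqP => [->|_].
    rewrite -ltnS prednK//; apply: leq_trans h1 _.
    by rewrite wtn// Fw// v01.
  by rewrite (leq_trans (wt_le_size _ _))//=.
Qed.

End reduction_length.

(** * Dilations, box seminorms and linear iterates *)

Section dilated_mean.
Context {R : realType} (L : mean R) (a : nat).

Let ddom (x : int -> R) := exists B, forall n, `|x n| <= B.
Let avg (x : int -> R) (m : int) := a.+1%:R^-1 * \sum_(r < a.+1) x (a.+1%:Z * m + r%:Z).
Let dev (x : int -> R) := ev L (avg x).

Let davg x : ddom x -> dom L (avg x).
Proof.
move=> [B xB]; apply/domZ/dom_sum => r; exact: (@mdom1 _ _ _ B).
Qed.

Fact dil_cst c : ddom (fun=> c). Proof. by exists `|c|. Qed.

Fact dil_D x y : ddom x -> ddom y -> ddom (fun n => x n + y n).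
Proof.
move=> [B xB] [C yC]; exists (B + C) => n.
by apply: (le_trans (ler_normD _ _)); exact: lerD.
Qed.

Fact dil_M x y : ddom x -> ddom y -> ddom (fun n => x n * y n).
Proof. by move=> [B xB] [C yC]; exists (B * C) => n; rewrite normrM ler_pM. Qed.

Fact dil_evD x y : ddom x -> ddom y -> dev (fun n => x n + y n) = dev x + dev y.
Proof.
move=> dx dy; rewrite /dev -evD; try exact: davg.
by apply: eq_ev => m; rewrite /avg big_split mulrDr.
Qed.

Fact dil_evZ c x : ddom x -> dev (fun n => c * x n) = c * dev x.
Proof.
move=> dx; rewrite /dev -evZ; last exact: davg.
by apply: eq_ev => m; rewrite /avg -mulr_sumr mulrCA.
Qed.

Fact dil_ev1 : dev (fun=> 1) = 1.
Proof.
rewrite -[RHS](ev_cst L 1); apply: eq_ev => m.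
by rewrite /avg sumr_const card_ord mulVf// pnatr_eq0.
Qed.

Fact dil_ge0 x : ddom x -> (forall n, 0 <= x n) -> 0 <= dev x.
Proof.
move=> dx x0; apply: ev_ge0 => [|m]; first exact: davg.
by rewrite mulr_ge0 ?invr_ge0// sumr_ge0.
Qed.

Definition dil : fnl R int := Fnl (fun _ h => h) dil_cst dil_D dil_M
  dil_evD dil_evZ dil_ev1 dil_ge0.

Let dil_shift1 x : ddom x -> dev (fun n => x (n + 1)) = dev x.
Proof.
move=> dx; have [B xB] := dx.
have dx1 : ddom (fun n => x (n + 1)) by exists B.
apply/eqP; rewrite -subr_eq0 -evB; [|exact: davg|exact: davg].
(* Shifting by one trades the first term of a block for the first term of the next, so the block
   averages change by a difference that the mean annihilates. *)
pose y (m : int) := a.+1%:R^-1 * x (a.+1%:Z * m).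
have dy : dom L y by apply: domZ; exact: (@mdom1 _ _ _ B).
rewrite (eq_ev (g := fun m => y (m + 1) - y m)) => [|m].
  by rewrite evB ?mshift ?subrr//; exact: mdom_shift.
rewrite /avg /y -!mulrBr; congr (_ * _).
pose z (r : nat) := x (a.+1%:Z * m + r%:Z).
rewrite (eq_bigr (fun r : 'I_a.+1 => z r.+1)); last first.
  by move=> r _; rewrite /z; congr x; lia.
rewrite [X in _ - X](eq_bigr (fun r : 'I_a.+1 => z r))//.
rewrite big_ord_recr big_ord_recl/=.
have -> : z a.+1 = x (a.+1%:Z * (m + 1)) by rewrite /z; congr x; lia.
have -> : z 0%N = x (a.+1%:Z * m) by rewrite /z; congr x; lia.
rewrite [\sum_(i < a) z i.+1](eq_bigr (fun i : 'I_a => z (bump 0 i)))//.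
by set s := \sum_(i < a) _; ring.
Qed.

Definition dilated_mean : mean R :=
  @Mean R dil (fun _ h => h) (shift_of_shift1 dil_shift1).

(* The multiples of [a.+1] are one residue class among [a.+1]. *)
Lemma dilated_mean_le x : (exists B, forall n, `|x n| <= B) -> (forall n, 0 <= x n) ->
  ev L (fun m => x (a.+1%:Z * m)) <= a.+1%:R * ev dilated_mean x.
Proof.
move=> dx x0; have [B xB] := dx; rewrite [ev dilated_mean x]/(dev x) /dev -evZ; last exact: davg.
apply: ev_le => [||m]; [exact: (@mdom1 _ _ _ B)|exact/domZ/davg|].
rewrite /avg mulrA mulfV ?pnatr_eq0// mul1r big_ord_recl addr0 lerDl.
by rewrite sumr_ge0.
Qed.

End dilated_mean.

Section box.
Context {R : realType} {G : zmodType} (L : mean R) (S : sys R G) (e : G).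

(** By [hku_mean] the seminorm may be computed with the dilated mean, in which the multiples of [a]
    are one residue class. The other classes are dropped by positivity, which is why the inner order
    is at least 1. *)
Lemma hku_dilate k (a : int) (f : S -> R) : a != 0 -> u1 S f ->
  ev L (fun m => hku L e k.+1 (fun y => f y * f (act S (e *~ (a * m)) y))) <=
  `|a|%N%:R * hku L e k.+2 f.
Proof.
move=> a0 uf.
pose c m := hku L e k.+1 (fun y => f y * f (act S (e *~ m) y)).
(* Evenness reduces a negative [a] to its absolute value. *)
have ceven m : c (- m) = c m.
  rewrite /c -(hku_act L e k.+1 (e *~ m)); last exact: u1_step.
  congr hku; apply/funext => y.
  by rewrite -(actD (sysP S)) mulrNz addNr (act0 (sysP S)) mulrC.
have cnorm m : `|c m| <= 1 by apply: hku_norm; exact: u1_step.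
have c0 m : 0 <= c m by apply: hku_ge0; exact: u1_step.
have [n an] : exists n : nat, `|a|%N = n.+1 by exists `|a|%N.-1; rewrite prednK// absz_gt0.
rewrite an (eq_ev (g := fun m => c (n.+1%:Z * m))) => [|m]; last first.
  rewrite -[LHS]/(c (a * m)).
  have [->|->] : a = n.+1 \/ a = - n.+1%:Z by lia.
    by [].
  by rewrite mulNr ceven.
have -> : hku L e k.+2 f = ev (dilated_mean L n) c.
  exact: (hku_mean L e k.+1 L (dilated_mean L n) uf).
by apply: dilated_mean_le => //; exists 1.
Qed.

(** One order is lost because dilation requires nonnegative terms: the comparison starts from the
    square of the integral, bounded by [hku 1], and not from [hku 0], which may be negative. *)
Lemma box_le_hku (s : seq int) : all (fun a => a != 0) s -> exists2 C, 0 <= C &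
  forall f : S -> R, u1 S f -> box L e s f ^+ 2 <= C * hku L e (size s).+1 f.
Proof.
elim: s => [|a s IH]; first by exists 1 => // f uf; rewrite mul1r; exact: (hku_sqr L e 0 uf).
move=> /= /andP[a0 /IH[C C0 hC]]; exists (C * `|a|%N%:R); first by rewrite mulr_ge0.
move=> f uf; apply: (le_trans (ev_sqr_le (box_dom L e a s uf))).
apply: (@le_trans _ _ (ev L (fun m => C * hku L e (size s).+1
    (fun y => f y * f (act S (e *~ (a * m)) y))))).
  apply: ev_le => [||m]; [exact/domX/box_dom| |exact/hC/u1_step].
  by apply: domZ; apply: (@mdom1 _ _ _ 1) => m; apply: hku_norm; exact: u1_step.
rewrite evZ; last by apply: (@mdom1 _ _ _ 1) => m; apply: hku_norm; exact: u1_step.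
by rewrite -mulrA ler_wpM2l// hku_dilate.
Qed.

Lemma box_eq0 (s : seq int) f : all (fun a => a != 0) s -> u1 S f ->
  hku L e (size s).+1 f = 0 -> box L e s f = 0.
Proof.
move=> /box_le_hku[C C0 hC] uf h; apply/eqP; rewrite -sqrf_eq0 eq_le sqr_ge0 andbT.
by apply: (le_trans (hC _ uf)); rewrite h mulr0.
Qed.

Lemma gow_linear t a (f g : S -> R) : u1 S f -> u1 S g ->
  gow L S t (fun n y => g y * f (act S (e *~ (a * n)) y)) ^+ 2 <=
  box L e (nseq t.+1 a) f.
Proof.
have hseq (h k : S -> R) : u1 S h -> u1 S k ->
    ub S (fun n y => k y * h (act S (e *~ (a * n)) y)).
  by move=> uh uk n; apply: u1M => //; exact: u1a.
elim: t f g => [|t IH] f g uf ug.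
  rewrite /= real_normK ?num_real//.
  have := vdc_seq L ug (hseq f (fun=> 1) uf (u1_cst1 S)).
  under [X in X ^+ 2 <= _ -> _]eq_ev => n.
    rewrite (eq_ev (g := fun y => g y * f (act S (e *~ (a * n)) y))).
      over.
    by move=> y; rewrite mul1r.
  move=> /le_trans; apply; rewrite le_eqVlt; apply/orP; left; apply/eqP.
  apply: eq_ev => m; rewrite -[RHS](ev_cst L); apply: eq_ev => n.
  have d : dom S (fun y => f y * f (act S (e *~ (a * m)) y)).
    exact: u1_dom (u1_step e _ uf).
  rewrite -(ev_act (sysP S) (e *~ (a * n)) d); apply: eq_ev => y.
  by rewrite !mul1r -(actD (sysP S)) -mulrzDr mulrDr addrC [(_ + a * n)%R]addrC.
rewrite [gow _ _ t.+1 _]/= [box _ _ _ _]/=.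
have hb := hseq f g uf ug.
apply: (@gow_even_le R L _ _ 1 isT (gow_dom L t hb) (box_dom L e a (nseq t.+1 a) uf)) => m.
have := IH _ _ (u1_step e (a * m) uf) (u1M ug ug); congr (_ ^+ 2 <= _).
congr gow; apply/funext => n; apply/funext => y.
rewrite -!(actD (sysP S)) -!mulrzDr mulrDr [a * m + _]addrC; ring.
Qed.

Definition bmul (f g : bfun S) : bfun S := exist _ _ (u1M (svalP f) (svalP g)).
Definition bact a (f : bfun S) : bfun S := exist _ _ (u1a a (svalP f)).

(** The differences of [a] with the slopes that become stationary one after the other in
    [linear_box]. *)
Fixpoint slopes (base a : int) (cs : seq int) : seq int :=
  if cs is c :: cs' then a - base :: slopes c a cs' else [:: a - base].

Lemma slopes_neq0 base a cs : a != base -> all (fun c => a != c) cs ->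
  all (fun c => c != 0) (slopes base a cs).
Proof.
elim: cs base => [|c cs IH] base ab /=; first by rewrite subr_eq0 ab.
by move=> /andP[ac acs]; rewrite subr_eq0 ab IH.
Qed.

Lemma size_slopes base a cs : size (slopes base a cs) = (size cs).+1.
Proof. by elim: cs base => //= c cs IH base; rewrite IH. Qed.

Definition lprod (base : int) (F : seq (int * bfun S)) (n : int) (y : S) :=
  \prod_(c <- F) sval c.2 (act S (e *~ ((c.1 - base) * n)) y).

Lemma lprod_u1 base F n : u1 S (lprod base F n).
Proof. by apply: u1_prod => c; apply: u1a; exact: (svalP c.2). Qed.

(** After each van der Corput step, a translation makes the first factor of [lprod] independent of
    [n]. That factor joins the weight, its slope becomes the new [base], and the step itself
    supplies one side of the box. *)
Lemma linear_box F base a (f : bfun S) (g : S -> R) : u1 S g ->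
  ev L (fun n => ev S (fun y => g y *
    (sval f (act S (e *~ ((a - base) * n)) y) * lprod base F n y)))
    ^+ (2 ^ (size F).+1) <= box L e (slopes base a [seq c.1 | c <- F]) (sval f).
Proof.
move sF : (size F) => k; elim: k F sF base f g => [|k IH] [|c F]// sF base f g ug.
  have := gow_linear 0 (a - base) (svalP f) ug; rewrite /= real_normK ?num_real//.
  congr (_ ^+ 2 <= _); apply: eq_ev => n; apply: eq_ev => y.
  by rewrite /lprod big_nil mulr1.
move: sF => /= [sF].
set b := fun n y => sval f (act S (e *~ ((a - base) * n)) y) * lprod base (c :: F) n y.
have hb : ub S b by move=> n; apply: u1M; [apply: u1a; exact: (svalP f)|exact: lprod_u1].
rewrite expnS exprM; have vc := vdc_seq L ug hb.
apply: (le_trans (lerXn2r _ _ _ vc)); rewrite ?nnegrE ?sqr_ge0//.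
  exact: le_trans (sqr_ge0 _) vc.
apply: (gow_even_le _ (seq_corr_dom L hb) (box_dom L e _ _ (svalP f))) => // m.
pose F' := [seq (d.1, bmul d.2 (bact (e *~ ((d.1 - base) * m)) d.2)) | d <- F].
pose f' := bmul f (bact (e *~ ((a - base) * m)) f).
pose g' := bmul c.2 (bact (e *~ ((c.1 - base) * m)) c.2).
have := IH F' _ c.1 f' (sval g') (svalP g').
have -> : [seq d.1 | d <- F'] = [seq d.1 | d <- F] by rewrite -map_comp.
rewrite size_map => /(_ sF); congr (_ ^+ _ <= _).
apply: eq_ev => n; rewrite -[RHS](ev_act (sysP S) (e *~ (- (c.1 - base) * n))); last first.
  exact: u1_dom (ub_step m hb n).
have E (x : int) y : act S (e *~ ((x - base) * n)) (act S (e *~ (- (c.1 - base) * n)) y) =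
    act S (e *~ ((x - c.1) * n)) y.
  by rewrite -(actD (sysP S)) -mulrzDr; congr (act S (e *~ _)); ring.
have E' (x : int) y : act S (e *~ ((x - base) * (n + m))) (act S (e *~ (- (c.1 - base) * n)) y) =
    act S (e *~ ((x - base) * m)) (act S (e *~ ((x - c.1) * n)) y).
  by rewrite -!(actD (sysP S)) -!mulrzDr; congr (act S (e *~ _)); ring.
apply: eq_ev => y; rewrite /b /lprod !big_cons !E !E' subrr mul0r mulr0z (act0 (sysP S)).
rewrite [\prod_(_ <- F') _]big_map/=.
under [\prod_(_ <- F) _ in RHS]eq_bigr => d _ do rewrite E.
under [X in _ = _ * (_ * (_ * X))]eq_bigr => d _ do rewrite E'.
rewrite big_split/=; ring.
Qed.

End box.

Lemma even_pow_le0 (R : realType) (x : R) p : x ^+ (2 ^ p.+1) <= 0 -> x = 0.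
Proof.
rewrite expnSr exprM => h; apply/eqP.
have : x ^+ (2 ^ p) ^+ 2 == 0 by rewrite eq_le h sqr_ge0.
by rewrite !expf_eq0 expn_gt0 => /andP[_ /andP[]].
Qed.

(** * Vanishing of polynomial averages and of their Gowers norms *)

Section polynomial_control.
Context {R : realType} {G : idomainType} (L : mean R) (S : sys R G) (e : G).
Hypothesis he : forall z : int, e *~ z = 0 -> z = 0.
Implicit Types (u : {poly G}) (f g : S -> R) (F : seq ({poly G} * bfun S)).

Local Notation wpr := (wprod (act S)).

Lemma reach0_zero u F f g : reach0 e u [seq c.1 | c <- F] -> u1 S f -> u1 S g ->
  hku L e (size F).+2 f = 0 ->
  ev L (fun n => ev S (fun y => g y * (f (act S u.[n%:~R] y) * wpr F n y))) = 0.
Proof.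
move=> [su sF [_ [z z0 lu]] aF] uf ug h0.
have lin (v : {poly G}) (n : int) : (size v <= 2)%N -> v.[n%:~R] = v`_0 + v`_1 *~ n.
  move=> sv; rewrite (horner_coef_wide _ sv) !big_ord_recl big_ord0 /= addr0.
  by rewrite expr0 mulr1 expr1 mulrzr.
have u1z : u`_1 = e *~ z by rewrite -lu lead_coefE su.
(* The linear coefficients of [u] and [u - c.1] lie along [e], hence so do those of all members;
   constant coefficients are moved into the functions. The slopes differ from [z] because the
   differences are not constant. *)
have [F2 [sF2 F2z hF2]] : exists F2 : seq (int * bfun S), [/\ size F2 = size F,
    all (fun c => z != c) [seq c.1 | c <- F2] &
    forall n y, wpr F n y = lprod e 0 F2 n y].
  elim: F sF aF {h0} => [|c F IH] sF aF.
    by exists [::]; split=> // n y; rewrite /wprod /lprod !big_nil.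
  have [v vF|v vF|F2 [s2 z2 h2]] := IH.
  - by apply: sF; rewrite inE vF orbT.
  - by apply: aF; rewrite inE vF orbT.
  have sc : (size c.1 <= 2)%N by apply: sF; rewrite mem_head.
  have [suc [z' z'0 lc]] := aF c.1 (mem_head _ _).
  have suc2 : size (u - c.1) = 2%N.
    apply/eqP; rewrite eqn_leq suc andbT (leq_trans (size_polyD _ _))// size_polyN.
    by rewrite su geq_max sc.
  have c1 : c.1`_1 = e *~ (z - z').
    by rewrite mulrzBr -u1z -lc lead_coefE suc2 coefB subKr.
  exists ((z - z', bact c.1`_0 c.2) :: F2); split=> /=; first by rewrite s2.
    by rewrite z2 andbT -subr_eq0 subKr.
  move=> n y; rewrite /wprod /lprod !big_cons -/(lprod _ _ _ _ _) -h2; congr (_ * _) => /=.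
  by rewrite lin// subr0 c1 -mulrzA (actD (sysP S)).
have h := linear_box L e F2 0 z (exist _ _ (u1a u`_0 uf)) ug.
have b0 : box L e (slopes 0 z [seq c.1 | c <- F2]) (fun y => f (act S u`_0 y)) = 0.
  apply: box_eq0; [by apply: slopes_neq0|exact: u1a|].
  by rewrite size_slopes size_map sF2 hku_act.
move: h; rewrite /= b0; set X := ev L _ => hX.
have -> : ev L (fun n => ev S (fun y => g y * (f (act S u.[n%:~R] y) * wpr F n y))) = X.
  apply: eq_ev => n; apply: eq_ev => y; rewrite hF2 lin ?su// u1z -mulrzA subr0.
  by rewrite (actD (sysP S)).
exact: even_pow_le0 hX.
Qed.

(** Each step at most doubles the number of functions, the controlled one included, which accounts
    for [2 ^ s]. The exceptional shifts are finite in number and have mean zero. *)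
Lemma reach_zero s k u F f g : reach e s u [seq c.1 | c <- F] -> u1 S f -> u1 S g ->
  ((size F).+1 * 2 ^ s <= k)%N -> hku L e k.+1 f = 0 ->
  ev L (fun n => ev S (fun y => g y * (f (act S u.[n%:~R] y) * wpr F n y))) = 0.
Proof.
move=> + uf + + h0; elim: s u F g => [|s IH] u F g [r0|] // => [ug Fk|ug Fk|].
- by apply: reach0_zero => //; apply: hku_eq0_le h0 => //; rewrite muln1 in Fk.
- apply: reach0_zero => //; apply: hku_eq0_le h0 => //; rewrite ltnS; apply: leq_trans Fk.
  by rewrite leq_pmulr// expn_gt0.
move=> [v0 [bad hbad]] ug Fk.
pose b n y := f (act S u.[n%:~R] y).
have ub' (h : S -> R) (v : {poly G}) : u1 S h -> ub S (fun n y => h (act S v.[n%:~R] y)).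
  by move=> uh n; exact: u1a.
have [g' ug' hg'] := absorb_const L (sysP S) F ug; rewrite (hg' b).
have hw : ub S (fun n y => b n y * wpr (noncF F) n y).
  by move=> n; apply: u1M; [exact: ub'|exact: wprod_u1 (sysP S) _ _].
apply/eqP; rewrite -sqrf_eq0 eq_le sqr_ge0 andbT.
apply: (le_trans (vdc_seq L ug' hw)).
rewrite (@ev_cofinite _ _ _ bad)//; first exact: seq_corr_dom.
move=> m mb.
pose sh := [seq (pshift m c.1 - v0, c.2) | c <- noncF F].
pose F' := [seq (c.1 - v0, c.2) | c <- noncF F] ++
  (u - v0, exist (u1 S) f uf) :: sh.
have := IH (pshift m u - v0) F' (fun=> 1).
have -> : [seq c.1 | c <- F'] = [seq v - v0 | v <- nonc [seq c.1 | c <- F]] ++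
      u - v0 :: [seq pshift m v - v0 | v <- nonc [seq c.1 | c <- F]].
  by rewrite /F' /sh -fst_noncF map_cat /= -!map_comp.
move=> /(_ (hbad m mb) (u1_cst1 S)) <-.
  apply: eq_ev => n; rewrite -[LHS](ev_act (sysP S) (- v0.[n%:~R])); last first.
    exact: u1_dom (ub_step m hw n).
  apply: eq_ev => y; rewrite /b.
  have -> : wpr F' n y = f (act S (u - v0).[n%:~R] y) *
      wpr (shiftF v0 m (noncF F)) n y.
    by rewrite /wprod /F' /shiftF !big_cat big_cons/=; ring.
  rewrite wprod_shiftF; last exact: sysP.
  rewrite -!(actD (sysP S)) !hornerD !hornerN horner_pshift intrD; ring.
apply: leq_trans Fk; rewrite /F' /sh size_cat/= !size_map expnS mulnA leq_mul2r.
have : (size (noncF F) <= size F)%N by rewrite size_filter; exact: count_size.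
move=> h; apply/orP; right; by rewrite muln2 -[_.*2]addnn addSn !addnS !ltnS leq_add.
Qed.

Definition shU m u f (uf : u1 S f) F := F ++
  (u, exist (u1 S) f uf) :: [seq (pshift m c.1, c.2) | c <- F].

Lemma wprod_shU m u f (uf : u1 S f) F n y :
  f (act S (pshift m u).[n%:~R] y) * wpr (shU m u uf F) n y =
  (f (act S u.[n%:~R] y) * wpr F n y) * (f (act S u.[(n + m)%:~R] y) * wpr F (n + m) y).
Proof.
rewrite /wprod /shU big_cat big_cons big_map/= horner_pshift -intrD.
under [X in _ * (_ * (_ * X)) = _]eq_bigr => c _ do rewrite horner_pshift -intrD.
ring.
Qed.

End polynomial_control.

(** Differencing makes [pshift m u] the controlled iterate and adds [u] to the others, so the
    hypotheses persist for all but finitely many [m]. A linear [u] is kept out, since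
    [pshift m u - u] would be constant. *)
Lemma gow_zero (G : idomainType) (D r t : nat) : exists k0,
  forall (R : realType) (L : mean R) (S : sys R G) (e : G)
   (u : {poly G}) (F : seq ({poly G} * bfun S)) (f : S -> R) k,
  (forall z : int, e *~ z = 0 -> z = 0) ->
  (size F <= r)%N -> (2 < size u)%N -> (size u <= D)%N ->
  {in [seq c.1 | c <- F], forall v : {poly G}, (size v <= size u)%N} -> along e u ->
  {in [seq c.1 | c <- F], forall v : {poly G}, along e (u - v)} ->
  u1 S f -> (k0 <= k)%N -> hku L e k f = 0 ->
  gow L S t (fun n y => f (act S u.[n%:~R] y) * wprod (act S) F n y) = 0.
Proof.
elim: t r => [|t IH] r.
  have [s hs] := reach_ex (G := G) D r.
  exists (r.+1 * 2 ^ s).+1 => R L S e u F f k he Fr _ uD Fu au aF uf kk h0.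
  have hr : reach e s u [seq c.1 | c <- F] by apply: hs; rewrite ?size_map.
  have [k' kE] : exists k', k = k'.+1 by exists k.-1; rewrite prednK// (leq_trans _ kk).
  rewrite kE in kk h0.
  have Fk : ((size F).+1 * 2 ^ s <= k')%N.
    by rewrite -ltnS; apply: leq_trans kk; rewrite ltnS leq_mul2r ltnS Fr orbT.
  have := reach_zero hr uf (u1_cst1 S) Fk h0.
  rewrite [gow _ _ 0 _]/= => <-; apply/eqP.
  rewrite (eq_ev (g := fun n => ev S (fun y => 1 *
    (f (act S u.[n%:~R] y) * wprod (act S) F n y)))).
    by rewrite (reach_zero hr uf (u1_cst1 S) Fk h0) normr0.
  by move=> n; apply: eq_ev => y; rewrite mul1r.
have [k0 hk0] := IH (r + r.+1)%N.
exists k0 => R L S e u F f k he Fr su uD Fu au aF uf kk h0 /=.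
have [bad hbad] := along_shift_all he au aF su.
have hb : ub S (fun n y => f (act S u.[n%:~R] y) * wprod (act S) F n y).
  by move=> n; apply: u1M; [exact: u1a|exact: wprod_u1 (sysP S) _ _].
apply: (@ev_cofinite _ _ _ bad); first exact: gow_dom.
move=> m /hbad[m0 adu apu aFm].
have fsh : [seq c.1 | c <- shU m u uf F] =
    [seq c.1 | c <- F] ++ u :: [seq pshift m v | v <- [seq c.1 | c <- F]].
  by rewrite /shU map_cat /= -!map_comp.
rewrite -[RHS](hk0 R L S e (pshift m u) (shU m u uf F) f k)//.
- congr gow; apply/funext => n; apply/funext => y.
  by rewrite wprod_shU.
- by rewrite /shU size_cat/= size_map leq_add.
- by rewrite size_pshift.
- by rewrite size_pshift.
- move=> v; rewrite fsh mem_cat inE size_pshift.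
  by move=> /or3P[/Fu//|/eqP->//|/mapP[w /Fu wu ->]]; rewrite size_pshift.
- move=> v; rewrite fsh mem_cat inE => /or3P[/aFm//|/eqP->//|/mapP[w /aF wu ->]].
  by rewrite -pshiftB; exact: along_pshift.
Qed.

(** * Means along a sequence of intervals *)

Section ultralimit.
Context {R : realType} (U : set_system nat) {UU : UltraFilter U}.
Implicit Types a b : nat -> R.

Definition bounded_seq a := exists B, forall j, `|a j| <= B.

Lemma ultra_cvg a : bounded_seq a -> cvg (a @ U).
Proof.
move=> [B aB].
have Uab : U (a @^-1` `[- B, B]%classic).
  by apply: filterS filterT => j _; rewrite /= in_itv/= -ler_norml; exact: aB.
have [p [_ clp]] := @segment_compact R (- B) B (a @ U) _ Uab.
apply/cvg_ex; exists p => V nV.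
have [UV|UV] := in_ultra_setVsetC (a @^-1` V) UU; first exact: UV.
by have [x [nVx Vx]] := clp _ _ (UV : (a @ U) (~` V)) nV; case: (nVx Vx).
Qed.

Definition ulim a := lim (a @ U).

Lemma ulim_cvg a : bounded_seq a -> a @ U --> ulim a.
Proof. exact: ultra_cvg. Qed.

Lemma ulimD a b : bounded_seq a -> bounded_seq b ->
  ulim (fun j => a j + b j) = ulim a + ulim b.
Proof. by move=> ba bb; apply: cvg_lim => //; apply: cvgD; exact: ulim_cvg. Qed.

Lemma ulimZ c a : bounded_seq a -> ulim (fun j => c * a j) = c * ulim a.
Proof. by move=> ba; apply: cvg_lim => //; apply: cvgM; [exact: cvg_cst|exact: ulim_cvg]. Qed.

Lemma ulim_cst c : ulim (fun=> c) = c.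
Proof. by apply: cvg_lim => //; exact: cvg_cst. Qed.

Lemma ulim_le a b : bounded_seq a -> bounded_seq b ->
  (\forall j \near U, a j <= b j) -> ulim a <= ulim b.
Proof. by move=> ba bb ab; apply: ler_lim => //; exact: ultra_cvg. Qed.

Lemma ulim_near_eq a b : bounded_seq a -> (\forall j \near U, b j = a j) ->
  ulim b = ulim a.
Proof.
move=> ba ab; apply: cvg_lim => //.
apply: cvg_trans (ulim_cvg ba); apply: near_eq_cvg.
by apply: filterS ab => j ->.
Qed.

Lemma ulim_sqr a : bounded_seq a -> ulim (fun j => a j ^+ 2) = ulim a ^+ 2.
Proof.
move=> ba; apply: cvg_lim => //; rewrite expr2.
under eq_fun do rewrite expr2.
by apply: cvgM; exact: ulim_cvg.
Qed.

End ultralimit.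

(** If [a] does not converge to [l], the indices at which it stays away from [l] generate with [\oo]
    a proper filter, and an ultrafilter above it contradicts the hypothesis. *)
Lemma cvg0_ultra (R : realType) (a : nat -> R) (l : R) :
  (forall U, UltraFilter U -> \oo `<=` U -> a @ U --> l) -> a @ \oo --> l.
Proof.
move=> h; apply/cvgrPdist_lt => e e0; apply: contrapT => na.
pose A := [set j | e <= `|l - a j|].
have PF : ProperFilter (within A \oo).
  apply: Build_ProperFilter_ex.
  move=> P [N _ hP]; apply: contrapT => nP; apply: na; exists N => // j Nj /=.
  rewrite ltNge; apply/negP => Aj; apply: nP; exists j; exact: hP.
have [U [UU sU]] := ultraFilterLemma PF.
have oU : \oo `<=` U.
  by move=> P hP; apply: sU; apply: filterS hP => j Pj _.
have /cvgrPdist_lt/(_ e e0) hU := h U UU oU.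
have UA : U A by apply: sU; rewrite /within/=; near=> j.
have [j [Aj /=]] := filter_ex (filterI UA hU).
by rewrite ltNge Aj.
Unshelve. all: by end_near.
Qed.

Section interval_mean.
Context {R : realType} (U : set_system nat) {UU : UltraFilter U}.
Context (oU : \oo `<=` U) (M N : nat -> nat) (gMN : growing_intervals M N).
Implicit Types x y : int -> R.

Definition iavg x (j : nat) : R := interval_avg (fun n : nat => x n%:Z) (M j) (N j).

Let bnd x := exists B, forall n, `|x n| <= B.

Lemma len_near (k : nat) : \forall j \near U, (k < N j - M j)%N.
Proof.
have h : \oo [set n | (k < n)%N] by exists k.+1.
exact: (oU (gMN h)).
Qed.

Lemma interval_avg_norm (a : nat -> R) B m n : 0 <= B -> (forall i, `|a i| <= B) ->
  `|interval_avg a m n| <= B.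
Proof.
move=> B0 aB; rewrite /interval_avg normrM ger0_norm ?invr_ge0//.
apply: (@le_trans _ _ ((n - m)%:R^-1 * ((n - m)%:R * B))).
  rewrite ler_wpM2l ?invr_ge0//; apply: (le_trans (ler_norm_sum _ _ _)).
  by rewrite mulr_natl -sumr_const_nat; apply: ler_sum => i _; exact: aB.
have [->|nm] := eqVneq (n - m)%N 0%N; first by rewrite invr0 mul0r.
by rewrite mulrA mulVf ?mul1r// pnatr_eq0.
Qed.

Lemma iavg_bounded x : bnd x -> bounded_seq (iavg x).
Proof.
move=> [B xB]; exists B => j; apply: interval_avg_norm => //.
exact: le_trans (xB 0).
Qed.

Let uev x := ulim U (iavg x).

Fact uev_cst c : bnd (fun=> c). Proof. by exists `|c|. Qed.

Fact uev_dD x y : bnd x -> bnd y -> bnd (fun n => x n + y n).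
Proof.
move=> [B xB] [C yC]; exists (B + C) => n.
by apply: (le_trans (ler_normD _ _)); exact: lerD.
Qed.

Fact uev_dM x y : bnd x -> bnd y -> bnd (fun n => x n * y n).
Proof. by move=> [B xB] [C yC]; exists (B * C) => n; rewrite normrM ler_pM. Qed.

Fact uev_D x y : bnd x -> bnd y -> uev (fun n => x n + y n) = uev x + uev y.
Proof.
move=> bx yb; rewrite /uev -ulimD; try exact: iavg_bounded.
by congr (ulim U _); apply/funext => j; rewrite /iavg/interval_avg big_split mulrDr.
Qed.

Fact uev_Z c x : bnd x -> uev (fun n => c * x n) = c * uev x.
Proof.
move=> bx; rewrite /uev -ulimZ; last exact: iavg_bounded.
by congr (ulim U _); apply/funext => j; rewrite /iavg/interval_avg -mulr_sumr mulrCA.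
Qed.

Fact uev_1 : uev (fun=> 1) = 1.
Proof.
rewrite -[RHS](@ulim_cst R U _ 1); apply: ulim_near_eq; first by exists 1 => j; rewrite normr1.
apply: filterS (len_near 0) => j h.
by rewrite /iavg/interval_avg sumr_const_nat mulVf// pnatr_eq0 -lt0n.
Qed.

Fact uev_ge0 x : bnd x -> (forall n, 0 <= x n) -> 0 <= uev x.
Proof.
move=> bx x0; rewrite -(@ulim_cst R U _ 0); apply: ulim_le.
- by exists 0 => j; rewrite normr0.
- exact: iavg_bounded.
by apply: nearW => j; rewrite /iavg/interval_avg mulr_ge0 ?invr_ge0// sumr_ge0.
Qed.

Definition ufnl : fnl R int := Fnl (fun _ h => h) uev_cst uev_dD uev_dM
  uev_D uev_Z uev_1 uev_ge0.

(** The sum telescopes to two boundary terms, negligible against the length. The sequence may change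
    with [j], so that weights depending on the interval are covered. *)
Lemma iavg_shift1 (a : nat -> nat -> R) B : 0 <= B -> (forall j i, `|a j i| <= B) ->
  interval_avg (fun n => a j n.+1) (M j) (N j) - interval_avg (a j) (M j) (N j) @[j --> U]
    --> (0 : R).
Proof.
move=> B0 aB; apply/cvgrPdist_le => e e0.
have [k hk] : exists k : nat, 2 * B / e <= k%:R.
  have := archi_boundP (divr_ge0 (mulr_ge0 (ler0n _ 2) B0) (ltW e0)) => /ltW h.
  by exists (Num.bound (2 * B / e)).
apply: filterS (len_near k) => j kj; rewrite sub0r normrN /interval_avg -mulrBr.
have MN : (M j <= N j)%N by apply: ltnW; rewrite -subn_gt0; exact: leq_ltn_trans kj.
rewrite -sumrB telescope_sumr// normrM ger0_norm ?invr_ge0//.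
have L0 : 0 < (N j - M j)%:R :> R by rewrite ltr0n; exact: leq_ltn_trans kj.
rewrite ler_pdivrMl//; apply: (@le_trans _ _ (2 * B)).
  apply: (le_trans (ler_normB _ _)); rewrite mulr_natl mulr2n; exact: lerD.
rewrite -ler_pdivrMr//; apply: (le_trans hk); rewrite ler_nat; exact: ltnW.
Qed.

Fact uev_shift1 x : bnd x -> uev (fun n => x (n + 1)) = uev x.
Proof.
move=> bx; have [B xB] := bx; have B0 : 0 <= B by exact: le_trans (xB 0).
have bx1 : bnd (fun n => x (n + 1)) by exists B.
apply/eqP; rewrite -subr_eq0; apply/eqP.
have h := iavg_shift1 B0 (fun j i => xB i%:Z).
rewrite -(cvg_lim (@norm_hausdorff _ _) h).
apply/esym/cvg_lim => //; apply: cvgB; last exact: (@ulim_cvg R U _ _ (iavg_bounded bx)).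
have := @ulim_cvg R U UU _ (iavg_bounded bx1); rewrite /uev.
have -> // : iavg (fun n => x (n + 1)) =
  (fun j => interval_avg (fun n => x n.+1%:Z) (M j) (N j)).
apply/funext => j; rewrite /iavg; congr interval_avg.
by apply/funext => n; congr x; lia.
Qed.

Definition umean : mean R := @Mean R ufnl (fun _ h => h) (shift_of_shift1 uev_shift1).

Lemma umeanE x : ev umean x = ulim U (iavg x).
Proof. by []. Qed.

End interval_mean.

(** * Bounded measurable functions *)

Section bounded_measurable.
Context d (X : measurableType d) (R : realType) (mu : probability X R).
Implicit Types f g : X -> R.

Definition mb f := measurable_fun setT f /\ exists B, forall x, `|f x| <= B.

Lemma mb_integrable f : mb f -> mu.-integrable setT (EFin \o f).
Proof.
move=> [mf [B fB]]; apply: measurable_bounded_integrable => //.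
  by rewrite -ge0_fin_numE// fin_num_measure.
exists B; split; first exact: num_real.
by move=> M BM x _; exact: le_trans (fB x) (ltW BM).
Qed.

Fact mb_bd f : mb f -> exists B, forall x, `|f x| <= B. Proof. by case. Qed.

Fact mb_cst c : mb (fun=> c).
Proof. by split; [exact: measurable_cst|exists `|c|]. Qed.

Fact mbD f g : mb f -> mb g -> mb (fun x => f x + g x).
Proof.
move=> [mf [B fB]] [mg [C gC]]; split; first exact: measurable_funD.
by exists (B + C) => x; apply: (le_trans (ler_normD _ _)); exact: lerD.
Qed.

Fact mbM f g : mb f -> mb g -> mb (fun x => f x * g x).
Proof.
move=> [mf [B fB]] [mg [C gC]]; split; first exact: measurable_funM.
by exists (B * C) => x; rewrite normrM ler_pM.
Qed.

Definition xev f := (\int[mu]_x f x)%R.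

Fact xevD f g : mb f -> mb g -> xev (fun x => f x + g x) = xev f + xev g.
Proof. by move=> mf mg; apply: RintegralD => //; exact: mb_integrable. Qed.

Fact xevZ c f : mb f -> xev (fun x => c * f x) = c * xev f.
Proof. by move=> mf; apply: RintegralZl => //; exact: mb_integrable. Qed.

Fact xev1 : xev (fun=> 1) = 1.
Proof. by rewrite /xev Rintegral_cst// mul1r; exact: (congr1 fine (probability_setT mu)). Qed.

Fact xev_ge0 f : mb f -> (forall x, 0 <= f x) -> 0 <= xev f.
Proof. by move=> _ f0; apply: Rintegral_ge0. Qed.

Definition xfnl : fnl R X := Fnl mb_bd mb_cst mbD mbM xevD xevZ xev1 xev_ge0.

Lemma mb_norm f : mb f -> mb (fun x => `|f x|).
Proof.
move=> [mf [B fB]]; split; first exact: measurableT_comp.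
by exists B => x; rewrite normr_id.
Qed.

Lemma mb_comp f (t : X -> X) : mb f -> measurable_fun setT t -> mb (fun x => f (t x)).
Proof. by move=> [mf [B fB]] mt; split; [exact: measurableT_comp|exists B]. Qed.

Lemma mb_indic A : measurable A -> mb (\1_A : X -> R).
Proof.
move=> mA; split; first exact: measurable_indic.
by exists 1 => x; rewrite indicE; case: (_ \in _); rewrite ?normr1 ?normr0.
Qed.

Lemma xev_indic A : measurable A -> xev (\1_A) = fine (mu A).
Proof. by move=> mA; rewrite /xev /Rintegral integral_indic// setIT. Qed.

End bounded_measurable.

Section iterates.
Context d (X : measurableType d) (R : realType) (mu : probability X R).
Implicit Types T : inv_mpt mu.

Lemma mpt_iterS T (n : int) x : mpt_iter T (n + 1) x = T (mpt_iter T n x).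
Proof.
case: n => [n|[|n]]; first by rewrite -PoszD addn1.
  by rewrite /= mpt_invK.
have -> : Negz n.+1 + 1 = Negz n by lia.
by rewrite [in RHS]/= mpt_invK.
Qed.

Lemma mpt_iterD T (a b : int) x : mpt_iter T (a + b) x = mpt_iter T a (mpt_iter T b x).
Proof.
elim/int_ind: a => [|n IH|n IH]; first by rewrite add0r.
  have -> : n.+1%:Z + b = (n%:Z + b) + 1 by lia.
  have -> : n.+1%:Z = n%:Z + 1 by lia.
  by rewrite !mpt_iterS IH.
apply: (can_inj (@mpt_funK _ _ _ _ T)); rewrite -!mpt_iterS.
have -> : - n.+1%:Z + b + 1 = - n%:Z + b by lia.
by have -> : - n.+1%:Z + 1 = - n%:Z by lia.
Qed.

Lemma mpt_iterC T (g : X -> X) : (forall x, T (g x) = g (T x)) ->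
  forall a x, mpt_iter T a (g x) = g (mpt_iter T a x).
Proof.
move=> Tg; elim/int_ind => [//|n IH|n IH] x.
  have -> : n.+1%:Z = n%:Z + 1 by lia.
  by rewrite !mpt_iterS IH Tg.
apply: (can_inj (@mpt_funK _ _ _ _ T)); rewrite Tg -!mpt_iterS.
by have -> : - n.+1%:Z + 1 = - n%:Z by lia.
Qed.

Lemma measurable_mpt_iter T a : measurable_fun setT (mpt_iter T a).
Proof.
have it (g : X -> X) n : measurable_fun setT g -> measurable_fun setT (iter n g).
  move=> mg; elim: n => [|n IH]; first exact: measurable_id.
  exact: (measurableT_comp mg IH).
by case: a => n; apply: it; [exact: measurable_mpt_fun|exact: measurable_mpt_inv].
Qed.

Lemma xev_mpt T (f : X -> R) : mb f -> xev mu (fun x => f (T x)) = xev mu f.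
Proof.
move=> mf; have mT := @measurable_mpt_fun _ _ _ _ T.
rewrite /xev /Rintegral; congr fine.
transitivity (\int[pushforward mu T]_x (f x)%:E)%E.
  rewrite integral_pushforward//.
  - by apply/measurable_EFinP; case: mf.
  - by rewrite preimage_setT; exact: (mb_integrable mu (mb_comp mf mT)).
by apply: eq_measure_integral => A mA _; rewrite /= /pushforward mpt_preserving.
Qed.

Lemma xev_mpt_iter T a (f : X -> R) : mb f ->
  xev mu (fun x => f (mpt_iter T a x)) = xev mu f.
Proof.
move=> mf; elim/int_ind: a => [//|n IH|n IH].
  have E x : mpt_iter T n.+1%:Z x = mpt_iter T n%:Z (T x).
    by rewrite (@mpt_iterC T T)// -mpt_iterS; congr mpt_iter; lia.
  rewrite (_ : (fun x => _) = (fun x => f (mpt_iter T n%:Z (T x)))).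
    by rewrite (xev_mpt T (mb_comp mf (measurable_mpt_iter T n%:Z))).
  by apply/funext => x; rewrite -E.
rewrite -IH -[LHS](xev_mpt T); last exact: mb_comp mf (measurable_mpt_iter _ _).
congr xev; apply/funext => x; rewrite (@mpt_iterC T T)// -mpt_iterS.
by have -> : - n.+1%:Z + 1 = - n%:Z by lia.
Qed.

End iterates.

Section commuting_action.
Context d (X : measurableType d) (R : realType) (mu : probability X R).
Context (l : nat) (T : 'I_l -> inv_mpt mu).
Hypothesis TC : forall (i j : 'I_l) x, T i (T j x) = T j (T i x).

(** The polynomial [w] encodes an exponent vector, its coefficient of index [i] being the exponent
    of [T i]. *)
Definition pact_seq (s : seq 'I_l) (w : {poly int}) (x : X) : X :=
  foldr (fun i => mpt_iter (T i) w`_i) x s.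

Lemma mpt_iter_comm i j a b x :
  mpt_iter (T i) a (mpt_iter (T j) b x) = mpt_iter (T j) b (mpt_iter (T i) a x).
Proof.
by apply: mpt_iterC => y; apply/esym; apply: mpt_iterC => z; rewrite TC.
Qed.

Lemma pact_seqC s w j b x :
  mpt_iter (T j) b (pact_seq s w x) = pact_seq s w (mpt_iter (T j) b x).
Proof. by elim: s => //= i s IH; rewrite -IH mpt_iter_comm. Qed.

Lemma pact_act s : is_act (xfnl mu) (pact_seq s).
Proof.
split.
- by move=> x; elim: s => //= i s ->; rewrite coef0.
- move=> a b x; elim: s => //= i s ->.
  by rewrite coefD mpt_iterD pact_seqC.
- move=> a f mf; elim: s f mf => //= i s IH f mf.
  exact: (IH (fun x => f (mpt_iter (T i) a`_i x)) (mb_comp mf (measurable_mpt_iter _ _))).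
- move=> a f mf; elim: s f mf => //= i s IH f mf.
  have := IH (fun x => f (mpt_iter (T i) a`_i x)) (mb_comp mf (measurable_mpt_iter _ _)).
  by move=> ->; exact: xev_mpt_iter.
Qed.

Definition psys : sys R {poly int} := Sys (pact_act (enum 'I_l)).

Lemma psys_line (j : 'I_l) (m : int) x :
  act psys ('X^j *~ m) x = mpt_iter (T j) m x.
Proof.
have H s : uniq s -> pact_seq s ('X^j *~ m) x = if j \in s then mpt_iter (T j) m x else x.
  elim: s => //= i s IH /andP[ins /IH ->]; rewrite inE.
  rewrite coefMrz coefXn eq_sym.
  have [ij|ij] := eqVneq (j : nat) i.
    have -> : i = j by apply/val_inj.
    rewrite eqxx [_ *~ m]intz; congr (mpt_iter _ _ _).
    by rewrite -(_ : i = j) ?(negbTE ins)//; apply/val_inj.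
  rewrite mul0rz; have -> : (j == i) = false by apply/negbTE; apply: contra_neq ij => ->.
  by [].
by rewrite /= H ?enum_uniq// mem_enum.
Qed.

End commuting_action.

(** * Riesz representation of functionals dominated by the L1 norm *)

Lemma pos_null d (X : measurableType d) (R : realType) (mu : probability X R)
    (h : X -> R) A : measurable A -> measurable_fun setT h ->
  mu.-integrable A (EFin \o h) ->
  (forall x, A x -> 0 < h x) -> (\int[mu]_(x in A) h x <= 0)%R -> mu A = 0%E.
Proof.
move=> mA mh hint h0 ihR.
have ih : (\int[mu]_(x in A) (h x)%:E <= 0)%E.
  by rewrite -[leLHS]fineK ?integrable_fin_num// lee_fin.
have : (\int[mu]_(x in A) `|(EFin \o h) x| = 0)%E.
  apply/eqP; rewrite eq_le integral_ge0// andbT.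
  apply: le_trans ih; rewrite le_eqVlt; apply/orP; left; apply/eqP.
  by apply: eq_integral => x /set_mem Ax; rewrite /= ger0_norm// ltW// h0.
move/(ae_eq_integral_abs mu mA); case.
  by apply/measurable_EFinP; exact: measurable_funTS.
move=> N [mN N0 AN]; apply/eqP; rewrite eq_le measure_ge0 andbT -N0.
apply: le_measure; rewrite ?inE// => x Ax; apply: AN => /(_ Ax) /= [] hx.
by have := h0 x Ax; rewrite hx ltxx.
Qed.

Section riesz.
Context d (X : measurableType d) (R : realType) (mu : probability X R).
Variable phi : (X -> R) -> R.
Hypothesis phiD : forall f g, mb f -> mb g -> phi (fun x => f x + g x) = phi f + phi g.
Hypothesis phiZ : forall c f, mb f -> phi (fun x => c * f x) = c * phi f.
Hypothesis phi_le : forall f, mb f -> `|phi f| <= xev mu (fun x => `|f x|).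

Local Notation xf := (xfnl mu).

Let phi0 : phi (fun=> 0) = 0.
Proof.
apply/eqP; rewrite -normr_le0; apply: (le_trans (phi_le (@mb_cst _ X R 0))).
by rewrite (_ : xev _ _ = 0)//; under eq_fun do rewrite normr0; exact: (ev_cst xf 0).
Qed.

Let phiB f g : mb f -> mb g -> phi (fun x => f x - g x) = phi f - phi g.
Proof.
move=> mf mg; rewrite -[- phi g]mulN1r -phiZ// -phiD//; last exact: (domZ (S := xf) (-1) mg).
by congr phi; apply/funext => x; rewrite mulN1r.
Qed.

Let phi_sum n (F : nat -> X -> R) : (forall i, mb (F i)) ->
  phi (fun x => \sum_(i < n) F i x) = \sum_(i < n) phi (F i).
Proof.
move=> mF; elim: n => [|n IH].
  by rewrite big_ord0 -[RHS]phi0; congr phi; apply/funext => x; rewrite big_ord0.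
rewrite big_ord_recr/= -IH -phiD//; last first.
  exact: (dom_sum (S := xf) (index_enum 'I_n) (fun i => mF (val i))).
by congr phi; apply/funext => x; rewrite big_ord_recr.
Qed.

Let nu (A : set X) : \bar R := (phi (\1_A : X -> R))%:E.

Let nu0 : nu set0 = 0%E.
Proof.
rewrite /nu; congr EFin; rewrite -phi0; congr phi; apply/funext => x.
by rewrite indicE in_set0.
Qed.

Let nu_fin A : measurable A -> nu A \is a fin_num. Proof. by []. Qed.

(** Domination by the L1 norm transfers this from [mu]: the error is at most the measure of the
    tail. *)
Let nu_sigma_additive : semi_sigma_additive nu.
Proof.
move=> F mF tF mUF.
have mFi i : mb (\1_(F i) : X -> R) by exact: mb_indic.
have E n : (\sum_(0 <= i < n) nu (F i))%E = (phi (fun x => \sum_(i < n) (\1_(F i) x)))%:E.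
  by rewrite (phi_sum n mFi) big_mkord sumEFin.
have mS n : mb (fun x => \sum_(i < n) (\1_(F i) x : R)).
  exact: (dom_sum (S := xf) (index_enum 'I_n) (fun i => mFi (val i))).
have mU : mb (\1_(\bigcup_n F n) : X -> R) by exact: mb_indic.
rewrite (_ : (fun n => _) = EFin \o (fun n => phi (fun x => \sum_(i < n) (\1_(F i) x)))); last first.
  by apply/funext => n; rewrite E.
apply: cvg_EFin; first exact: nearW.
have hs : \sum_(i < n) fine (mu (F i)) @[n --> \oo] --> fine (mu (\bigcup_n F n)).
  have h := @measure_semi_sigma_additive _ _ _ mu F mF tF mUF.
  suff h2 : (EFin \o (fun n => \sum_(i < n) fine (mu (F i)))) @ \oo -->
      (fine (mu (\bigcup_n F n)))%:E by exact: (fine_cvg h2).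
  rewrite fineK ?fin_num_measure//; apply: cvg_trans h.
  apply: near_eq_cvg; apply: nearW => n /=; rewrite big_mkord -sumEFin.
  by apply: eq_bigr => i _; rewrite fineK// fin_num_measure.
have hmu : fine (mu (\bigcup_n F n)) - \sum_(i < n) fine (mu (F i)) @[n --> \oo] -->
    fine (mu (\bigcup_n F n)) - fine (mu (\bigcup_n F n)).
  by apply: cvgB hs; exact: cvg_cst.
rewrite [X in _ --> X]subrr in hmu.
apply/cvgrPdist_le => e e0; move/cvgrPdist_le : hmu => /(_ e e0).
apply: filterS => n /=; rewrite sub0r normrN => h.
have mB := domB (S := xf) mU (mS n).
rewrite -[leLHS]/(`|phi (\1_(\bigcup_n F n)) - phi (fun x => \sum_(i < n) (\1_(F i) x))|).
rewrite -phiB//.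
apply: (le_trans (phi_le mB)); apply: le_trans h; apply: le_trans (ler_norm _).
have pos x : 0 <= \1_(\bigcup_n F n) x - \sum_(i < n) (\1_(F i) x) :> R.
  rewrite subr_ge0 [leRHS]indicE.
  have [[k Fkx]|nF] := pselect (exists k : 'I_n, F k x).
    rewrite mem_set; last by exists k.
    rewrite (bigD1 k)//= indicE mem_set// big1 ?addr0// => i ik.
    rewrite indicE memNset// => Fix; move/eqP: ik; apply; apply/val_inj.
    by apply: (tF _ _ I I); exists x.
  rewrite big1 ?ler0n// => i _; rewrite indicE memNset// => Fix.
  by apply: nF; exists i.
rewrite (_ : (fun x => _) = fun x => \1_(\bigcup_n F n) x - \sum_(i < n) (\1_(F i) x)).
  rewrite [xev mu _](evB (S := xf) mU (mS n)) le_eqVlt; apply/orP; left; apply/eqP.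
  congr (_ - _); first exact: xev_indic.
  rewrite [ev xf _](ev_sum (S := xf) (index_enum 'I_n) (fun i => mFi (val i))).
  by apply: eq_bigr => i _; exact: xev_indic.
by apply/funext => x; rewrite ger0_norm.
Qed.

HB.instance Definition _ := isCharge.Build _ _ _ nu nu0 nu_fin nu_sigma_additive.

Let nu_mu : nu `<< mu.
Proof.
apply/null_content_dominatesP => A mA muA.
rewrite -[LHS]/((phi \1_A)%:E); congr EFin; apply/eqP; rewrite -normr_le0.
apply: (le_trans (phi_le (mb_indic R mA))).
rewrite (_ : (fun x => _) = \1_A); first by rewrite xev_indic// [mu A]muA.
by apply/funext => x; rewrite ger0_norm.
Qed.

Let rn : X -> \bar R := Radon_Nikodym nu mu.

Let rn_int : mu.-integrable setT rn. Proof. exact: Radon_Nikodym_integrable. Qed.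

Let rnE A : measurable A -> (\int[mu]_(x in A) rn x = (phi \1_A)%:E)%E.
Proof. by move=> mA; rewrite -Radon_Nikodym_integral. Qed.

Let f x := fine (rn x).

Let rn_f : rn = EFin \o f.
Proof. by apply/funext => x /=; rewrite fineK// Radon_Nikodym_fin_num. Qed.

Let f_int : mu.-integrable setT (EFin \o f). Proof. by rewrite -rn_f. Qed.

Let mf : measurable_fun setT f.
Proof. by apply/measurable_EFinP; exact: measurable_int f_int. Qed.

Let f_intA A : measurable A -> mu.-integrable A (EFin \o f).
Proof. by move=> mA; exact: integrableS f_int. Qed.

Let phi_le_mu A : measurable A -> `|phi \1_A| <= fine (mu A).
Proof.
move=> mA; apply: (le_trans (phi_le (mb_indic R mA))).
rewrite (_ : (fun x => _) = \1_A); first by rewrite xev_indic.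
by apply/funext => x; rewrite ger0_norm.
Qed.

Let cst_intA A (c : R) : measurable A -> mu.-integrable A (EFin \o (fun=> c)).
Proof.
by move=> mA; apply: integrableS (mb_integrable mu (@mb_cst _ X R c)).
Qed.

Let RfE A : measurable A -> (\int[mu]_(x in A) f x = phi \1_A)%R.
Proof. by move=> mA; rewrite /Rintegral -[X in fine X]/(\int[mu]_(x in A) (EFin \o f) x)%E -rn_f rnE. Qed.

Let f_le1 : mu [set x | 1 < f x] = 0%E.
Proof.
have mA : measurable [set x | 1 < f x].
  by rewrite -[X in measurable X]setTI; apply: measurable_fun_ltr.
apply: (pos_null (mu := mu) (h := fun x => f x - 1)) => //.
- exact: measurable_funB.
- by rewrite (_ : EFin \o _ = (EFin \o f) \- (EFin \o (fun=> 1%R)))%E//; apply: integrableB;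
    [|exact: f_intA|exact: cst_intA].
- by move=> x /=; rewrite subr_gt0.
rewrite RintegralB//; [|exact: f_intA|exact: cst_intA].
rewrite Rintegral_cst// mul1r RfE// subr_le0.
exact: le_trans (ler_norm _) (phi_le_mu mA).
Qed.

Let f_geN1 : mu [set x | f x < -1] = 0%E.
Proof.
have mA : measurable [set x | f x < -1].
  by rewrite -[X in measurable X]setTI; apply: measurable_fun_ltr.
apply: (pos_null (mu := mu) (h := fun x => -1 - f x)) => //.
- exact: measurable_funB.
- by rewrite (_ : EFin \o _ = (EFin \o (fun=> (-1)%R)) \- (EFin \o f))%E//; apply: integrableB;
    [|exact: cst_intA|exact: f_intA].
- by move=> x /=; rewrite subr_gt0.
rewrite RintegralB//; [|exact: cst_intA|exact: f_intA].
rewrite Rintegral_cst// mulN1r RfE// subr_le0.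
by have := phi_le_mu mA; rewrite ler_norml => /andP[].
Qed.

(* The density may exceed 1 on a null set. *)
Let F x := if `|f x| <= 1 then f x else 0.

Let F_ae : ae_eq mu setT (EFin \o F) (EFin \o f).
Proof.
exists ([set x | 1 < f x] `|` [set x | f x < -1]); split.
- apply: measurableU; rewrite -[X in measurable X]setTI;
    by apply: measurable_fun_ltr.
- apply/eqP; rewrite eq_le measure_ge0 andbT.
  apply: (le_trans (measureU2 _ _ _)).
  + by rewrite -[X in measurable X]setTI; apply: measurable_fun_ltr.
  + by rewrite -[X in measurable X]setTI; apply: measurable_fun_ltr.
  + by rewrite [X in (X + _)%E]f_le1 [X in (_ + X)%E]f_geN1 adde0.
move=> x /= h; apply: contrapT => /not_orP[/negP h1 /negP h2]; apply: h => _.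
by rewrite /F ler_norml !leNgt h1 h2.
Qed.

Let F_mb : mb F.
Proof.
split; last by exists 1 => x; rewrite /F; case: ifP => //; rewrite normr0.
apply: measurable_fun_ifT => //; apply: measurable_fun_ler => //.
exact: measurableT_comp.
Qed.

Let F_indic A : measurable A -> xev mu (fun x => F x * \1_A x) = phi \1_A.
Proof.
move=> mA; rewrite -RfE// Rintegral_mkcond; congr fine.
apply: ae_eq_integral => //.
- apply/measurable_EFinP; apply: measurable_funM; first by case: F_mb.
  exact: measurable_indic.
- apply/measurable_EFinP; apply/measurable_restrict => //; exact: measurable_funTS.
have [N [mN N0 hN]] := F_ae; exists N; split=> // x /= h; apply: hN => /= h2.
apply: h => _; have := h2 I => -[->]; rewrite patchE indicE.
by case: (x \in A); rewrite ?mulr1 ?mulr0.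
Qed.

Let H g := phi g - xev mu (fun x => F x * g x).

Let HD g h : mb g -> mb h -> H (fun x => g x + h x) = H g + H h.
Proof.
move=> mg mh; rewrite /H phiD//.
have -> : xev mu (fun x => F x * (g x + h x)) =
    xev mu (fun x => F x * g x) + xev mu (fun x => F x * h x).
  by rewrite -xevD; [congr xev; apply/funext => x; ring|exact: mbM|exact: mbM].
ring.
Qed.

Let HZ c g : mb g -> H (fun x => c * g x) = c * H g.
Proof.
move=> mg; rewrite /H phiZ//.
have -> : xev mu (fun x => F x * (c * g x)) = c * xev mu (fun x => F x * g x).
  by rewrite -xevZ; [congr xev; apply/funext => x; ring|exact: mbM].
ring.
Qed.

Let H_indic A : measurable A -> H \1_A = 0.
Proof. by move=> mA; rewrite /H F_indic// subrr. Qed.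

Let H_le g B : mb g -> (forall x, `|g x| <= B) -> `|H g| <= 2 * B.
Proof.
move=> mg gB; have gB' := ev_norm_le (S := xf) (mb_norm mg).
rewrite mulr_natl mulr2n; apply: (le_trans (ler_normB _ _)); apply: lerD.
  apply: (le_trans (phi_le mg)); apply: (le_trans (ler_norm _)).
  by apply: gB' => x; rewrite normr_id.
apply: (ev_norm_le (S := xf) (mbM F_mb mg)) => x; rewrite normrM.
apply: le_trans (gB x); rewrite ler_piMl// /F; case: ifP => //; rewrite normr0//.
Qed.

(** Counting the positive integers below [y] approximates [y] within 1. With [y] a large multiple of
    [g], this gives a uniform approximation of [g] by indicators. *)
Let steps (n : nat) (y : R) : 0 <= y ->
  if n%:R <= y then \sum_(k < n) (k.+1%:R <= y)%R%:R = n%:R :> R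
  else y - 1 < \sum_(k < n) (k.+1%:R <= y)%R%:R :> R /\
       \sum_(k < n) (k.+1%:R <= y)%R%:R <= y.
Proof.
move=> y0; elim: n => [|n IH]; first by rewrite big_ord0 y0.
rewrite big_ord_recr/=; case: (leP n.+1%:R y) => [ny|yn].
  have : n%:R <= y by apply: le_trans ny; rewrite ler_nat.
  by move: IH => /[swap] -> ->; rewrite -natrD addn1.
rewrite addr0; move: IH; case: (leP n%:R y) => [ny ->|//].
by split=> //; rewrite ltrBlDr -natr1 in yn *.
Qed.

Lemma riesz : exists2 F, u1 xf F & forall g, mb g -> phi g = xev mu (fun x => F x * g x).
Proof.
exists F; first by split=> // x; rewrite /F; case: ifP => //; rewrite normr0.
have H1 g : mb g -> (forall x, 0 <= g x <= 1) -> H g = 0.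
  move=> mg g01; apply/eqP; rewrite -normr_eq0 eq_le normr_ge0 andbT.
  apply/ler_addgt0Pr => e e0; rewrite add0r.
  have [n hn] : exists n : nat, 2 / e < n.+1%:R.
    have := archi_boundP (divr_ge0 (ler0n R 2) (ltW e0)) => h.
    by exists (Num.bound (2 / e)); apply: (lt_trans h); rewrite ltr_nat.
  pose A (k : nat) := [set x | k.+1%:R <= n.+1%:R * g x].
  have mA k : measurable (A k).
    rewrite /A -[X in measurable X]setTI; apply: measurable_fun_ler => //.
    by apply: measurable_funM => //; case: mg.
  pose s x : R := n.+1%:R^-1 * \sum_(k < n.+1) \1_(A k) x.
  have mAk k : mb (\1_(A k) : X -> R) by exact: mb_indic.
  have ms0 m : mb (fun x => \sum_(k < m) (\1_(A k) x : R)).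
    exact: (dom_sum (S := xf) (index_enum 'I_m) (fun i => mAk (val i))).
  have ms : mb s by exact: (domZ (S := xf) _ (ms0 n.+1)).
  have Hs : H s = 0.
    rewrite HZ//; have -> : H (fun x => \sum_(k < n.+1) \1_(A k) x) = 0; last by rewrite mulr0.
    elim: n.+1 => [|m IH].
      rewrite (_ : (fun x => _) = \1_(set0 : set X)); first exact: H_indic.
      by apply/funext => x; rewrite big_ord0 indicE in_set0.
    rewrite (_ : (fun x => _) = fun x => \sum_(k < m) \1_(A k) x + \1_(A m) x).
      by rewrite HD// IH H_indic// addr0.
    by apply/funext => x; rewrite big_ord_recr.
  have -> : H g = H (fun x => g x - s x).
    rewrite (_ : (fun x => g x - s x) = fun x => g x + -1 * s x); last first.
      by apply/funext => x; rewrite mulN1r.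
    have ms' : mb (fun x => -1 * s x) by exact: (domZ (S := xf) (-1) ms).
    by rewrite (HD mg ms') HZ// Hs mulr0 addr0.
  apply: (@le_trans _ _ (2 * n.+1%:R^-1)).
    apply: H_le => [|x]; first exact: (domB (S := xf) mg ms).
    have /andP[g0 g1] := g01 x.
    have := steps n.+1 (mulr_ge0 (ler0n R n.+1) g0).
    have -> : \sum_(k < n.+1) (k.+1%:R <= n.+1%:R * g x)%R%:R = n.+1%:R * s x.
      rewrite /s mulrA mulfV ?pnatr_eq0// mul1r; apply: eq_bigr => k _.
      by rewrite indicE mem_setE.
    have n0 : 0 < n.+1%:R :> R by rewrite ltr0n.
    have key : `|n.+1%:R * g x - n.+1%:R * s x| <= 1 -> `|g x - s x| <= n.+1%:R^-1.
      by rewrite -mulrBr normrM (gtr0_norm n0) -ler_pdivlMl// mulr1.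
    case: ifP => [ng hs|_ [h1 h2]]; apply: key.
      rewrite hs; have : n.+1%:R * g x <= n.+1%:R by rewrite ler_piMr.
      by move=> h; rewrite (_ : _ - _ = 0) ?normr0//; apply/eqP; rewrite subr_eq0 eq_le h ng.
    by rewrite ger0_norm ?subr_ge0// lerBlDl -lerBlDr ltW.
  by rewrite ler_pdivrMr ?ltr0n// mulrC -ler_pdivrMr// ltW.
move=> g mg; apply/eqP; rewrite -subr_eq0 -/(H g); apply/eqP.
have [_ [B gB]] := mg.
pose C := `|B| + 1; have C0 : 0 < C by rewrite ltr_wpDl.
have gC x : `|g x| <= C by apply: (le_trans (gB x)); rewrite ler_wpDr// ler_norm.
have mg' : mb (fun x => (2 * C)^-1 * (g x + C)).
  by apply: (domZ (S := xf)); apply: mbD => //; exact: mb_cst.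
rewrite (_ : g = fun x => (2 * C) * ((2 * C)^-1 * (g x + C)) + - C * \1_setT x); last first.
  by apply/funext => x; rewrite indicE in_setT mulr1 mulrA mulfV ?mul1r ?addrK// mulf_neq0// gt_eqF.
have m1 : mb (\1_setT : X -> R) by exact: mb_indic.
rewrite (HD (domZ (S := xf) _ mg') (domZ (S := xf) _ m1)) (HZ _ mg') (HZ _ m1).
rewrite H_indic// H1 ?mulr0 ?addr0// => x.
have := gC x; rewrite ler_norml => /andP[h1 h2].
rewrite mulr_ge0 ?invr_ge0 ?mulr_ge0 ?(ltW C0)//=; last by rewrite -lerBlDr sub0r.
by rewrite ler_pdivrMl ?mulr1 ?mulr_gt0// mulr_natl mulr2n lerD2r.
Qed.

End riesz.

(** * Conditional expectations on invariant sets and the seminorms *)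

Section l2norm.
Context d (X : measurableType d) (R : realType) (mu : probability X R).

Lemma xev_EFin (f : X -> R) : mb f -> (\int[mu]_x (f x)%:E = (xev mu f)%:E)%E.
Proof.
move=> mf; rewrite /xev /Rintegral fineK//; exact/integrable_fin_num/mb_integrable.
Qed.

Lemma xev_indicE (f : X -> R) A : measurable A ->
  xev mu (fun x => f x * \1_A x) = fine (\int[mu]_(x in A) (f x)%:E)%E.
Proof.
move=> mA; rewrite -[RHS]/(Rintegral mu A f) Rintegral_mkcond; congr fine.
apply: eq_integral => x _; rewrite patchE indicE.
by case: (x \in A); rewrite ?mulr1 ?mulr0.
Qed.

Lemma Lnorm2_sqr (f : X -> R) : mb f ->
  ('N[mu]_2%:E[EFin \o f] = (Num.sqrt (xev mu (fun x => f x * f x)))%:E)%E.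
Proof.
move=> mf; have mff := mbM mf mf.
rewrite unlock /Lnorm.
rewrite (_ : (\int[mu]_x `|(EFin \o f) x| `^ 2)%E = (xev mu (fun x => f x * f x))%:E).
  by rewrite poweR_EFin -powR12_sqrt//; exact: (ev_sqr_ge0 (S := xfnl mu) mf).
rewrite -xev_EFin//; apply: eq_integral => x _ /=.
by rewrite powR_mulrn// real_normK ?num_real// expr2.
Qed.

Lemma Lnorm_ae_eq (f g : X -> R) : measurable_fun setT f -> measurable_fun setT g ->
  ae_eq mu setT (EFin \o f) (EFin \o g) ->
  ('N[mu]_2%:E[EFin \o f] = 'N[mu]_2%:E[EFin \o g])%E.
Proof.
move=> mf mg fg; rewrite unlock /Lnorm; congr (_ `^ _)%E.
have mn (h : X -> R) : measurable_fun setT h ->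
    measurable_fun setT (fun x => (`|(EFin \o h) x| `^ 2)%E).
  move=> mh; rewrite (_ : (fun x => _) = EFin \o (fun x => `|h x| `^ 2))//.
  apply/measurable_EFinP; apply: (measurableT_comp (measurable_powR 2)).
  exact: measurableT_comp.
apply: ae_eq_integral => //; [exact: mn|exact: mn|].
case: fg => N [mN N0 hN]; exists N; split=> // x /= h; apply: hN => /= h2.
by apply: h => _; have := h2 I => -[->].
Qed.

Lemma xev_sqr_eq0 (f : X -> R) : mb f -> xev mu (fun x => f x * f x) = 0 ->
  mu [set x | f x != 0] = 0%E.
Proof.
move=> mf h0; have mff := mbM mf mf.
have : (\int[mu]_x `|(EFin \o (fun x => f x * f x)%R) x| = 0)%E.
  rewrite -[RHS]/(0%:E) -h0 -xev_EFin//; apply: eq_integral => x _ /=.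
  by rewrite ger0_norm// -expr2 sqr_ge0.
move/(ae_eq_integral_abs mu measurableT); case.
  by apply/measurable_EFinP; case: mff.
move=> N [mN N0 AN]; apply/eqP; rewrite eq_le measure_ge0 andbT -N0.
apply: le_measure; rewrite ?inE//.
  rewrite (_ : [set x | f x != 0%R] = ~` [set x | f x == 0%R]); last first.
    by apply/seteqP; split=> x /= /negP.
  apply: measurableC; rewrite -[X in measurable X]setTI.
  by apply: measurable_fun_eqr => //; case: mf.
move=> x fx; apply: AN => /(_ I) /= [] /eqP; rewrite mulf_eq0 orbb.
by apply/negP.
Qed.

End l2norm.

Arguments mpt_iter : simpl never.

Section invariant_expectation.
Context d (X : measurableType d) (R : realType) (mu : probability X R) (L : mean R).
Variable T : inv_mpt mu.
Local Notation xf := (xfnl mu).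
Local Notation I := (invariant_sets T).

Lemma mpt_act : is_act xf (mpt_iter T).
Proof.
split=> [//|a b x|a f mf|a f mf]; first exact: mpt_iterD.
  exact: mb_comp mf (measurable_mpt_iter _ _).
exact: xev_mpt_iter.
Qed.

(** The conditional expectation is built as the Riesz representative of the mean correlation with
    [f], not by projection. Its squared norm is then a mean of self-correlations, which identifies
    the first seminorm with [hku 1]. *)
Lemma invariant_cond_exp (f : X -> R) : u1 xf f -> exists F, [/\ mb F,
  is_cond_exp mu I f F &
  xev mu (fun x => F x * F x) =
  ev L (fun m => xev mu (fun x => f x * f (mpt_iter T m x)))].
Proof.
move=> uf; have [mf f1] := uf.
have mfT m : mb (fun x => f (mpt_iter T m x)) := dom_act mpt_act m mf.
pose phi g := ev L (fun m => xev mu (fun x => g x * f (mpt_iter T m x))).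
have dphi g : mb g -> dom L (fun m => xev mu (fun x => g x * f (mpt_iter T m x))).
  by move=> mg; exact: (dom_corr mpt_act L mg mf).
have phiD g h : mb g -> mb h -> phi (fun x => g x + h x) = phi g + phi h.
  move=> mg mh; rewrite /phi -evD; [|exact: dphi|exact: dphi].
  apply: eq_ev => m; rewrite -xevD; [|exact: mbM|exact: mbM].
  by congr xev; apply/funext => x; rewrite mulrDl.
have phiZ c g : mb g -> phi (fun x => c * g x) = c * phi g.
  move=> mg; rewrite /phi -evZ; last exact: dphi.
  apply: eq_ev => m; rewrite -xevZ; last exact: mbM.
  by congr xev; apply/funext => x; rewrite mulrA.
have phi_le g : mb g -> `|phi g| <= xev mu (fun x => `|g x|).
  move=> mg; apply: ev_norm_le => [|m]; first exact: dphi.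
  have mgf := mbM mg (mfT m).
  apply: (le_trans (ev_abs_le (S := xf) mgf (mb_norm mgf))).
  apply: ev_le => //; [exact: mb_norm|exact: mb_norm|move=> x].
  by rewrite normrM ler_piMr.
have [F uF phiF] := riesz phiD phiZ phi_le.
have [mF F1] := uF.
have phi_inv g n : mb g -> phi (fun x => g (mpt_iter T n x)) = phi g.
  by move=> mg; exact: (corr_shift mpt_act L n mg mf).
have Finv n g : mb g ->
    xev mu (fun x => F (mpt_iter T n x) * g x) = xev mu (fun x => F x * g x).
  move=> mg; have mgT k := dom_act mpt_act k mg : mb _.
  apply: (etrans (esym (ev_act mpt_act (- n) (mbM (dom_act mpt_act n mF) mg)))).
  rewrite -phiF// -(phi_inv _ (- n) mg) phiF//; congr xev; apply/funext => x.
  by rewrite -mpt_iterD subrr.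
have FTn n : mu [set x | F (mpt_iter T n x) - F x != 0] = 0%E.
  have mFT : mb (fun x => F (mpt_iter T n x)) := dom_act mpt_act n mF.
  have mFF := domB (S := xf) mFT mF.
  apply: xev_sqr_eq0 => //.
  have -> : xev mu (fun x => (F (mpt_iter T n x) - F x) * (F (mpt_iter T n x) - F x)) =
     xev mu (fun x => F (mpt_iter T n x) * (F (mpt_iter T n x) - F x)) -
     xev mu (fun x => F x * (F (mpt_iter T n x) - F x)).
    rewrite -[RHS](evB (S := xf)); [|exact: mbM|exact: mbM].
    by congr xev; apply/funext => x; rewrite mulrBl.
  by rewrite Finv// subrr.
pose W (n : nat) := [set x | F (mpt_iter T n%:Z x) - F x != 0] `|`
  [set x | F (mpt_iter T (- n%:Z) x) - F x != 0].
(* Taking all iterates at once makes the null set [N] invariant; zeroing [F] on it gives strict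
   invariance, as [invariant_sets] demands of the preimages. *)
pose N := \bigcup_n W n.
have mFTn n : measurable [set x | F (mpt_iter T n x) - F x != 0].
  rewrite (_ : [set x | _] = ~` [set x | F (mpt_iter T n x) - F x == 0]); last first.
    by apply/seteqP; split=> x /= /negP.
  apply: measurableC; rewrite -[X in measurable X]setTI.
  apply: measurable_fun_eqr => //; apply: measurable_funB; last by case: mF.
  by case: (dom_act mpt_act n mF).
have mW n : measurable (W n) by exact: measurableU.
have mN : measurable N by exact: bigcupT_measurable.
have NP x : ~ N x -> forall n, F (mpt_iter T n x) = F x.
  move=> nN n; apply: contrapT => /eqP h; apply: nN; exists `|n|%N => //.
  case: n h => k h; [left|right]; rewrite /= subr_eq0//.
have W0 n : mu (W n) = 0%E.
  apply/eqP; rewrite eq_le measure_ge0 andbT.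
  apply: (le_trans (measureU2 _ _ _)); [exact: mFTn|exact: mFTn|].
  by rewrite [X in (X + _)%E]FTn [X in (_ + X)%E]FTn adde0.
have N0 : mu N = 0%E.
  apply: measure_negligible => //; apply: negligible_bigcup => n.
  by apply/negligibleP; [exact: mW|exact: W0].
have NT x : N (T x) <-> N x.
  split=> h; apply: contrapT => /NP hx.
    case: h => n _ [|] /=; rewrite -[T x]/(mpt_iter T 1 x) -!mpt_iterD !hx subrr eqxx//.
  have hx' n : F (mpt_iter T n x) = F x.
    have -> : n = (n - 1) + 1 by rewrite subrK.
    rewrite mpt_iterD -[mpt_iter T 1 x]/(T x) hx.
    by have := hx (-1); rewrite -[T x]/(mpt_iter T 1 x) -mpt_iterD addNr => ->.
  by case: h => n _ [|] /=; rewrite hx' subrr eqxx.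
pose F' x := F x * \1_(~` N) x.
have mF' : mb F' by apply: mbM => //; apply: mb_indic; exact: measurableC.
have F'T x : F' (T x) = F' x.
  rewrite /F' !indicE; have [Nx|nNx] := pselect (N x).
    by rewrite !memNset ?mulr0//= => h; apply: h => //; exact/NT.
  rewrite !mem_set ?mulr1//=; last by move/NT.
  exact: (NP _ nNx 1).
have F'F g : mb g -> xev mu (fun x => F' x * g x) = xev mu (fun x => F x * g x).
  move=> mg; congr fine; apply: ae_eq_integral => //.
  - by apply/measurable_EFinP; case: (mbM mF' mg).
  - by apply/measurable_EFinP; case: (mbM mF mg).
  exists N; split=> // x /= h; apply: contrapT => nNx; apply: h => _.
  by rewrite /F' indicE mem_set// mulr1.
have indT A (k : int) : T @^-1` A = A -> forall x, (\1_A (mpt_iter T k x) : R) = \1_A x.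
  move=> TA x; have AT y : A (T y) <-> A y by split=> [h|h]; [rewrite -TA|rewrite -TA in h].
  rewrite !indicE; congr (_%:R); congr nat_of_bool.
  apply/idP/idP => /set_mem h; apply/mem_set; move: h; elim/int_ind: k => // n IH.
  - have -> : n.+1%:Z = n%:Z + 1 by lia.
    by rewrite mpt_iterS => /AT.
  - move=> h; apply: IH; have -> : - n%:Z = - n.+1%:Z + 1 by lia.
    by rewrite mpt_iterS; exact/AT.
  - have -> : n.+1%:Z = n%:Z + 1 by lia.
    by rewrite mpt_iterS => h; apply/AT/IH.
  - move=> /IH; have -> : - n%:Z = - n.+1%:Z + 1 by lia.
    by rewrite mpt_iterS => /AT.
exists F'; split => //.
  split.
  - move=> B mB; split; last by apply/seteqP; split=> x /=; rewrite F'T.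
    by rewrite -[X in measurable X]setTI; case: mF' => mF' _; exact: mF'.
  - exact: mb_integrable.
  move=> A [mA TA].
  have mi := mb_indic R mA.
  have e : xev mu (fun x => F' x * \1_A x) = xev mu (fun x => f x * \1_A x).
    rewrite F'F// -phiF// -[RHS](ev_cst L); apply: eq_ev => m.
    apply: (etrans _ (ev_act mpt_act m (mbM mf mi))).
    by congr xev; apply/funext => x; rewrite indT// mulrC.
  rewrite !xev_indicE// in e.
  have fi (g : X -> R) : mb g -> (\int[mu]_(x in A) (g x)%:E)%E \is a fin_num.
    move=> mg; apply: integrable_fin_num => //.
    exact: integrableS (mb_integrable mu mg).
  by rewrite -(fineK (fi _ mF')) -(fineK (fi _ mf)) e.
rewrite F'F// -[RHS]/(phi f) phiF//.
have -> : xev mu (fun x => F x * F' x) = xev mu (fun x => F x * F x).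
  by rewrite -(F'F F mF); congr xev; apply/funext => x; exact: mulrC.
rewrite -phiF//; apply: (etrans _ (ev_cst L (xev mu (fun x => F x * f x)))).
apply: eq_ev => m.
have mFm : mb (fun x => F (mpt_iter T m x)) := dom_act mpt_act m mF.
rewrite -(Finv m _ (mfT m)).
exact: (ev_act mpt_act m (mbM mF mf)).
Qed.

(** The sets where one candidate lies below the other are invariant, so both have the same integral
    over them. *)
Lemma cond_exp_unique (f F g : X -> R) : mb F ->
  is_cond_exp mu I f F -> is_cond_exp mu I f g ->
  ae_eq mu setT (EFin \o g) (EFin \o F).
Proof.
move=> mF [F1 F2 F3] [g1 g2 g3].
have mg : measurable_fun setT g by apply/measurable_EFinP; exact: measurable_int g2.
have mF' : measurable_fun setT F by case: mF.
have inv (h : X -> R) : (forall B, measurable B -> I (h @^-1` B)) -> forall x, h (T x) = h x.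
  move=> hI x; have [_ e] := hI [set h x] (measurable_set1 _).
  have : (h @^-1` [set h x]) x by [].
  by rewrite -e.
have gT := inv g g1; have FT := inv F F1.
have IA (u v : X -> R) : measurable_fun setT u -> measurable_fun setT v ->
    (forall x, u (T x) = u x) -> (forall x, v (T x) = v x) ->
    I [set x | u x < v x].
  move=> mu' mv uT vT; split.
    by rewrite -[X in measurable X]setTI; apply: measurable_fun_ltr.
  by apply/seteqP; split=> x /=; rewrite uT vT.
have null (u v : X -> R) : mu.-integrable setT (EFin \o u) -> mu.-integrable setT (EFin \o v) ->
    I [set x | u x < v x] ->
    (\int[mu]_(x in [set x | (u x < v x)%R]) (v x)%:E =
     \int[mu]_(x in [set x | (u x < v x)%R]) (u x)%:E)%E ->
    mu [set x | u x < v x] = 0%E.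
  move=> iu iv [mA _] e; apply: (@pos_null _ _ _ mu (fun x => v x - u x)) => //.
  - apply: measurable_funB; apply/measurable_EFinP; [exact: measurable_int iv|exact: measurable_int iu].
  - rewrite (_ : EFin \o _ = (EFin \o v) \- (EFin \o u))%E//; apply: integrableB => //;
      [exact: integrableS iv|exact: integrableS iu].
  - by move=> x /=; rewrite subr_gt0.
  rewrite RintegralB//; [|exact: integrableS iv|exact: integrableS iu].
  by rewrite /Rintegral e subrr.
have A1 := IA g F mg mF' gT FT; have A2 := IA F g mF' mg FT gT.
exists ([set x | g x < F x] `|` [set x | F x < g x]); split.
- by apply: measurableU; [case: A1|case: A2].
- apply/eqP; rewrite eq_le measure_ge0 andbT.
  apply: (le_trans (measureU2 _ _ _)); [by case: A1|by case: A2|].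
  rewrite [X in (X + _)%E](null g F)//; last by rewrite F3// g3.
  by rewrite [X in (_ + X)%E](null F g) ?adde0//; rewrite F3// g3.
move=> x /= h; apply: contrapT => /not_orP[/negP h1 /negP h2]; apply: h => _.
by congr EFin; apply/eqP; rewrite eq_le leNgt h2/= leNgt h1.
Qed.

End invariant_expectation.

Section host_kra_seminorms.
Context d (X : measurableType d) (R : realType) (mu : probability X R).
Context (l : nat) (T : 'I_l -> inv_mpt mu).
Hypothesis TC : forall (i j : 'I_l) x, T i (T j x) = T j (T i x).
Local Notation S := (psys TC).
Local Notation xf := (xfnl mu).

Lemma uavg_cvg_unique (a : nat -> R) (x y : R) : uavg_cvg a x -> uavg_cvg a y -> x = y.
Proof.
move=> ax ay; have g : growing_intervals (fun=> 0%N) id.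
  move=> A hA; apply: (filterS _ hA) => n An.
  by rewrite /= subn0.
exact: (cvg_unique _ (ax _ _ g) (ay _ _ g)).
Qed.

Lemma uavg_limE (a : nat -> R) (x : R) : uavg_cvg a x -> uavg_lim a = x.
Proof.
move=> ax; apply: (@uavg_cvg_unique a) => //.
by apply: (@xgetPex _ 0 [set y | uavg_cvg a y]); exists x.
Qed.

(** Interval averages along an ultrafilter form a mean, so agreement of all means gives the same
    limit along every ultrafilter and every sequence of intervals. *)
Lemma uavg_cvg_mean (c : int -> R) (x : R) : (exists B, forall n, `|c n| <= B) ->
  (forall L : mean R, ev L c = x) -> uavg_cvg (fun n => c n%:Z) x.
Proof.
move=> bc cx M N gMN; apply: cvg0_ultra => U UU oU.
rewrite -(cx (umean oU gMN)) umeanE; apply: ulim_cvg.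
exact: iavg_bounded.
Qed.

Lemma root_pow2 (x : R) k : 0 <= x -> (x `^ ((2 ^ k)%:R^-1)) ^+ (2 ^ k) = x.
Proof.
move=> x0; rewrite -powR_mulrn ?powR_ge0// -powRrM mulVf ?powRr1//.
Qed.

(** By [hku_mean] the averages defining the next seminorm have one value under all means, so their
    uniform limit exists. The scalar [C] links bounded functions to the unit ball on which [hku] is
    estimated, and becomes its square at each step. *)
Lemma hk_hku (L : mean R) (j : 'I_l) k C (h : X -> R) : u1 xf h ->
  hk_seminorm (T j) k.+1 (fun x => C * h x) ^+ (2 ^ k.+1) =
  C ^+ (2 ^ k.+1) * hku L ('X^j : {poly int}) (S := S) k.+1 h.
Proof.
elim: k C h => [|k IH] C h uh.
  have [F [mF [F1 F2 F3] hF]] := invariant_cond_exp L (T j) uh.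
  have mCF : mb (fun x => C * F x) by exact: (domZ (S := xf)).
  have CFexp : is_cond_exp mu (invariant_sets (T j)) (fun x => C * h x) (fun x => C * F x).
    split.
    - move=> B mB.
      have mB' : measurable [set y : R | B (C * y)].
        rewrite -[X in measurable X]setTI.
        exact: (@mulrl_measurable R setT C measurableT B mB).
      exact: (F1 _ mB').
    - exact: mb_integrable.
    move=> A IA; have mA : measurable A by case: IA.
    have sc (g : X -> R) : mb g ->
        (\int[mu]_(x in A) (C * g x)%:E = C%:E * \int[mu]_(x in A) (g x)%:E)%E.
      move=> mg; under eq_integral do rewrite EFinM.
      by rewrite integralZl//; exact: integrableS (mb_integrable mu mg).
    by rewrite sc// sc ?F3//; exact: uh.1.
  have hex : is_cond_exp mu (invariant_sets (T j)) (fun x => C * h x)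
      (cond_exp mu (invariant_sets (T j)) (fun x => C * h x)).
    exact: (@xgetPex _ (cst 0) [set g | is_cond_exp mu (invariant_sets (T j))
      (fun x => C * h x) g] (ex_intro _ _ CFexp)).
  have ae := cond_exp_unique mCF CFexp hex.
  have m1 : measurable_fun setT (cond_exp mu (invariant_sets (T j)) (fun x => C * h x)).
    by case: hex => _ /measurable_int/measurable_EFinP.
  rewrite [hk_seminorm _ 1 _]/= (Lnorm_ae_eq m1 mCF.1 ae).
  rewrite Lnorm2_sqr//= sqr_sqrtr; last exact: (ev_sqr_ge0 (S := xf) mCF).
  rewrite (_ : xev mu (fun x => C * F x * (C * F x)) = C ^+ 2 * xev mu (fun x => F x * F x)).
    rewrite hF; congr (_ * _); apply: eq_ev => m; rewrite -[RHS]/(xev mu _).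
    congr xev; apply/funext => x; congr (_ * h _).
    exact: (esym (psys_line _ _ _)).
  by rewrite -xevZ; [congr xev; apply/funext => x; ring|exact: mbM].
set c := fun m : int => (C ^+ 2) ^+ (2 ^ k.+1) *
  hku L ('X^j : {poly int}) (S := S) k.+1 (fun x => h x * h (act S ('X^j *~ m) x)).
have hs := hku_dom L ('X^j : {poly int}) (S := S) k.+1 uh.
have cx : uavg_cvg (fun n : nat => hk_seminorm (T j) k.+1 ((fun x => C * h x) \*
    ((fun x => C * h x) \o mpt_iter (T j) n%:Z)) ^+ (2 ^ k.+1))
    (C ^+ (2 ^ k.+2) * hku L ('X^j : {poly int}) (S := S) k.+2 h).
  have -> : (fun n : nat => hk_seminorm (T j) k.+1 ((fun x => C * h x) \*
    ((fun x => C * h x) \o mpt_iter (T j) n%:Z)) ^+ (2 ^ k.+1)) = (fun n => c n%:Z).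
    apply/funext => n; have un := u1_step (S := S) ('X^j : {poly int}) n%:Z uh.
    apply: (etrans _ (IH (C ^+ 2) _ un)).
    apply: (congr1 (fun u => hk_seminorm (T j) k.+1 u ^+ (2 ^ k.+1))).
    by apply/funext => x; rewrite psys_line /=; ring.
  have cb m : `|c m| <= `|(C ^+ 2) ^+ (2 ^ k.+1)|.
    by rewrite normrM ler_piMr//; apply: hku_norm; exact: u1_step.
  apply: uavg_cvg_mean => [|L']; first by exists `|(C ^+ 2) ^+ (2 ^ k.+1)|.
  rewrite evZ; last first.
    by apply: (@mdom1 _ _ _ 1) => m; apply: hku_norm; exact: u1_step.
  rewrite -exprM -expnS; congr (_ * _).
  exact: (hku_mean L ('X^j : {poly int}) (S := S) k.+1 L' L uh).
rewrite [hk_seminorm _ k.+2 _]/= (uavg_limE cx) root_pow2//.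
apply: mulr_ge0; last exact: (hku_ge0 L ('X^j : {poly int}) (S := S) k.+1 uh).
by rewrite expnS exprM exprn_ge0 ?sqr_ge0.
Qed.

Lemma mpt_iter_preserving (j : 'I_l) a (A : set X) : measurable A ->
  mu (mpt_iter (T j) a @^-1` A) = mu A.
Proof.
move=> mA; have mP : measurable (mpt_iter (T j) a @^-1` A).
  by rewrite -[X in measurable X]setTI; apply: measurable_mpt_iter.
rewrite -[LHS]fineK ?fin_num_measure// -[RHS]fineK ?fin_num_measure//.
rewrite -!xev_indic//; congr EFin; rewrite -[RHS](xev_mpt_iter (T j) a) //.
exact: mb_indic.
Qed.

Lemma negligible_iter (j : 'I_l) a (f g : X -> R) : mu.-negligible [set x | f x <> g x] ->
  mu.-negligible [set x | f (mpt_iter (T j) a x) <> g (mpt_iter (T j) a x)].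
Proof.
move=> [N [mN N0 hN]]; exists (mpt_iter (T j) a @^-1` N); split.
- by rewrite -[X in measurable X]setTI; exact: measurable_mpt_iter.
- by rewrite mpt_iter_preserving.
- by move=> x; exact: hN.
Qed.

Lemma hk_ae (j : 'I_l) k (f g : X -> R) : measurable_fun setT f -> measurable_fun setT g ->
  mu.-negligible [set x | f x <> g x] -> hk_seminorm (T j) k f = hk_seminorm (T j) k g.
Proof.
elim: k f g => [//|[|k] IH] f g mf mg fg.
  rewrite /=; congr (fine (Lnorm _ _ (EFin \o _))).
  (* Functions equal almost everywhere have the same set of conditional expectations, so [xget]
     picks the same version for both. *)
  rewrite /cond_exp; congr (xget _ _); apply/seteqP.
  have e A : measurable A -> (\int[mu]_(x in A) (f x)%:E = \int[mu]_(x in A) (g x)%:E)%E.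
    move=> mA; apply: ae_eq_integral => //.
    - by apply/measurable_EFinP; exact: measurable_funTS.
    - by apply/measurable_EFinP; exact: measurable_funTS.
    by apply: negligibleS fg => x /= h fgx; apply: h => _; rewrite fgx.
  split=> u /= [u1 u2 u3]; split=> // A IA; rewrite u3//.
    by rewrite e//; case: IA.
  by rewrite e//; case: IA.
suff E : (fun n : nat => hk_seminorm (T j) k.+1 (f \* (f \o mpt_iter (T j) n%:Z)) ^+ (2 ^ k.+1))
    = (fun n : nat => hk_seminorm (T j) k.+1 (g \* (g \o mpt_iter (T j) n%:Z)) ^+ (2 ^ k.+1)).
  exact: (congr1 (fun u => uavg_lim u `^ ((2 ^ k.+2)%:R^-1)) E).
apply/funext => n; apply: (congr1 (fun u => u ^+ (2 ^ k.+1))); apply: IH.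
- by apply: measurable_funM => //; apply: measurableT_comp => //; exact: measurable_mpt_iter.
- by apply: measurable_funM => //; apply: measurableT_comp => //; exact: measurable_mpt_iter.
have fgT := negligible_iter j n%:Z fg.
apply: negligibleS (negligibleU fg fgT) => x /= h.
apply: contrapT => /not_orP[/contrapT h1 /contrapT h2].
by apply: h; rewrite h1 h2.
Qed.

Lemma Linfty_unit (f : X -> R) : f \in Lfun mu +oo%E -> exists C h,
  [/\ 0 < C, u1 xf h, measurable_fun setT f & mu.-negligible [set x | f x <> C * h x]].
Proof.
move=> fL; have mf : measurable_fun setT f by have := sub_Lfun_mfun fL; rewrite inE.
have : finite_norm mu +oo%E f by have := sub_Lfun_finLfun fL; rewrite inE.
rewrite /finite_norm unlock /Lnorm.
have muT : (0 < mu setT)%E by rewrite (probability_setT mu : mu setT = 1%E).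
rewrite muT => hfin.
have [B hB] : exists B : R, (ess_sup mu (abse \o (EFin \o f)) <= B%:E)%E.
  case: (ess_sup _ _) hfin => [r _|//|_]; first by exists r.
  by exists 0; rewrite leNye.
have /ess_supP fB := hB.
pose C := `|B| + 1; have C0 : 0 < C by rewrite ltr_wpDl.
exists C, (fun x => if `|f x| <= C then C^-1 * f x else 0); split=> //.
  split; [split|].
  - apply: measurable_fun_ifT => //; last exact: (measurable_funM (measurable_cst _) mf).
    by apply: measurable_fun_ler => //; exact: measurableT_comp.
  - exists 1 => x; case: ifP => [fC|_]; last by rewrite normr0.
    by rewrite normrM gtr0_norm ?invr_gt0// ler_pdivrMl ?mulr1.
  - move=> x; case: ifP => [fC|_]; last by rewrite normr0.
    by rewrite normrM gtr0_norm ?invr_gt0// ler_pdivrMl ?mulr1.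
apply: negligibleS fB => x /= h; apply: contra_not h => fxB.
rewrite ifT ?mulVKf ?gt_eqF//.
by move: fxB; rewrite lee_fin => /le_trans; apply; rewrite ler_wpDr// ler_norm.
Qed.

End host_kra_seminorms.

(** * Averages against varying weights *)

Section interval_averages.
Context {R : realType}.
Implicit Types a b : nat -> R.

Lemma interval_avgD a b m n : interval_avg (fun i => a i + b i) m n =
  interval_avg a m n + interval_avg b m n.
Proof. by rewrite /interval_avg big_split mulrDr. Qed.

Lemma interval_avgZ c a m n : interval_avg (fun i => c * a i) m n = c * interval_avg a m n.
Proof. by rewrite /interval_avg -mulr_sumr mulrCA. Qed.

Lemma interval_avg_ge0 a m n : (forall i, 0 <= a i) -> 0 <= interval_avg a m n.
Proof. by move=> a0; rewrite mulr_ge0 ?invr_ge0// sumr_ge0. Qed.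

Lemma interval_avg_le a b m n : (forall i, a i <= b i) ->
  interval_avg a m n <= interval_avg b m n.
Proof. by move=> ab; rewrite ler_wpM2l ?invr_ge0// ler_sum. Qed.

Lemma interval_avg_sqr a m n :
  interval_avg a m n ^+ 2 <= interval_avg (fun i => a i ^+ 2) m n.
Proof.
set c := interval_avg a m n.
have := interval_avg_ge0 m n (fun i => sqr_ge0 (a i - c)).
have -> : (fun i => (a i - c) ^+ 2) = (fun i => a i ^+ 2 + (- (2 * c) * a i + c ^+ 2)).
  by apply/funext => i; ring.
rewrite !interval_avgD interval_avgZ -/c.
(* Only an inequality, because the average over an empty interval is 0. *)
suff : interval_avg (fun=> c ^+ 2) m n <= c ^+ 2.
  by set x := interval_avg _ _ _; set y := interval_avg _ _ _ => h1 h2; nra.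
have [mn|mn] := eqVneq (n - m)%N 0%N.
  by rewrite /interval_avg mn invr0 mul0r sqr_ge0.
by rewrite /interval_avg sumr_const_nat -[_ ^+ 2 *+ _]mulr_natl mulrA mulVf ?mul1r// pnatr_eq0.
Qed.

End interval_averages.

(** * The limit functional with varying weights *)

Section theta.
Context {R : realType} (U : set_system nat) {UU : UltraFilter U}.
Context (oU : \oo `<=` U) (M N : nat -> nat) (gMN : growing_intervals M N).
Context {Y : Type} (S : fnl R Y) (g : nat -> Y -> R).
Hypothesis ug : forall j, u1 S (g j).
Local Notation L := (umean oU gMN).
Implicit Types F : int * Y -> R.

Let corr F j (n : int) := ev S (fun y => g j y * F (n, y)).
Let avg F j := interval_avg (fun n : nat => corr F j n%:Z) (M j) (N j).

Definition theta F := ulim U (avg F).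

Let corr_bd F : dom (ext L S) F -> exists2 B, 0 <= B & forall j n, `|corr F j n| <= B.
Proof.
move=> [[B FB] dF]; exists `|B| => // j n.
apply: ev_norm_le => [|y]; first by apply: domM; [case: (ug j)|exact: dF].
rewrite normrM -[leRHS]mul1r ler_pM//; first by case: (ug j).
exact: le_trans (FB _) (ler_norm _).
Qed.

Let avg_bd F : dom (ext L S) F -> bounded_seq (avg F).
Proof.
by move=> /corr_bd[B B0 hB]; exists B => j; apply: interval_avg_norm.
Qed.

Lemma thetaD F F' : dom (ext L S) F -> dom (ext L S) F' ->
  theta (fun z => F z + F' z) = theta F + theta F'.
Proof.
move=> dF dF'; rewrite /theta -ulimD; try exact: avg_bd.
congr (ulim U _); apply/funext => j; rewrite -interval_avgD; congr interval_avg.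
apply/funext => n; rewrite -evD; try by apply: domM; [case: (ug j)|case: dF => _; exact|].
- by apply: eq_ev => y; rewrite mulrDr.
- by apply: domM; [case: (ug j)|case: dF => _; exact].
- by apply: domM; [case: (ug j)|case: dF' => _; exact].
Qed.

Lemma thetaZ c F : dom (ext L S) F -> theta (fun z => c * F z) = c * theta F.
Proof.
move=> dF; rewrite /theta -ulimZ; last exact: avg_bd.
congr (ulim U _); apply/funext => j; rewrite -interval_avgZ; congr interval_avg.
apply/funext => n; rewrite -evZ; first by apply: eq_ev => y; rewrite mulrCA.
by apply: domM; [case: (ug j)|case: dF => _; exact].
Qed.

Lemma theta_norm B F : dom (ext L S) F ->
  (forall j (n : int), `|ev S (fun y => g j y * F (n, y))| <= B) -> `|theta F| <= B.
Proof.
move=> dF FB; have aB j : `|avg F j| <= B.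
  by apply: interval_avg_norm => [|n]; [exact: le_trans (FB 0%N 0)|exact: FB].
have bc c : bounded_seq (fun _ : nat => c : R) by exists `|c|.
rewrite ler_norml -[X in X <= _ <= _](@ulim_cst R U _) -[X in _ <= _ <= X](@ulim_cst R U _).
by apply/andP; split; apply: ulim_le => //; try exact: avg_bd;
  apply: nearW => j; have := aB j; rewrite ler_norml => /andP[].
Qed.

Let sh m F := fun z : int * Y => F (z.1 + m, z.2).

Lemma theta_shift m F : dom (ext L S) F -> theta (sh m F) = theta F.
Proof.
apply: (@int_shift _ _ (dom (ext L S)) sh theta).
- by move=> x; apply/funext => -[n y]; rewrite /sh/= addr0.
- by move=> a b x; apply/funext => -[n y]; rewrite /sh/=; congr x; congr pair; ring.
- by move=> a x; exact: (dom_act (ext_shift_act L S)).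
move=> x dx; have [B B0 hB] := corr_bd dx.
have dx1 : dom (ext L S) (sh 1 x) by exact: (dom_act (ext_shift_act L S)).
apply/eqP; rewrite -subr_eq0; apply/eqP.
have h := iavg_shift1 (UU := UU) oU gMN B0 (fun j (i : nat) => hB j i%:Z).
rewrite -(cvg_lim (@norm_hausdorff _ _) h).
apply/esym/cvg_lim => //; apply: cvgB; last exact: (@ulim_cvg R U _ _ (avg_bd dx)).
have E : avg (sh 1 x) =
    (fun j => interval_avg (fun n => corr x j n.+1%:Z) (M j) (N j)).
  apply/funext => j; congr interval_avg; apply/funext => n; rewrite /corr/sh/=.
  by apply: eq_ev => y; rewrite -PoszD addn1.
rewrite -E; exact: (@ulim_cvg R U UU _ (avg_bd dx1)).
Qed.

Lemma theta_sqr F : dom (ext L S) F -> theta F ^+ 2 <= ev (ext L S) (fun z => F z * F z).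
Proof.
move=> dF; have [B B0 hB] := corr_bd dF.
have dFF := domM dF dF.
have [B1 FB1] := dom_bd dFF.
rewrite /theta -ulim_sqr; last exact: avg_bd.
apply: ulim_le.
- exists (B ^+ 2) => j; rewrite normrX lerXn2r ?nnegrE//.
  exact: interval_avg_norm.
- apply: iavg_bounded; exists B1 => n; apply: ev_norm_le => //.
  exact: dFF.2.
apply: nearW => j; apply: (le_trans (interval_avg_sqr _ _ _)).
apply: interval_avg_le => n.
have [dg g1] := ug j; have dn := dF.2 n%:Z.
apply: (le_trans (ev_CS dg dn)); apply: ler_piMl; first exact: ev_sqr_ge0.
rewrite -[leRHS](ev_cst S); apply: ev_le; [exact: domM|exact: dom_cst|move=> y].
by rewrite -expr2 -real_normK ?num_real// exprn_ile1.
Qed.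

(** Shift invariance and domination by the L2 norm are all that [vdc] asks of a functional, so the
    weights [g j] disappear after one step although they vary with the interval. *)
Lemma theta_vdc (b : int -> Y -> R) : ub S b ->
  theta (fun z => b z.1 z.2) ^+ 2 <=
  ev L (fun m => ev L (fun n => ev S (fun y => b n y * b (n + m) y))).
Proof.
move=> hb; apply: (vdc (ext_shift_act L S) L (X := theta) (f := fun z => b z.1 z.2)).
- exact: ub_ext.
- move=> F m dF; have dFm := dom_act (ext_shift_act L S) m dF.
  rewrite thetaZ; last exact: domD.
  rewrite (thetaD dF dFm) (theta_shift m dF); lra.
- by move=> F; exact: theta_sqr.
Qed.

End theta.

(** * Products of polynomial iterates *)

(** The exponent vector of the [i]th iterate, as a polynomial in time with coefficients in the
    acting group. *)
Definition dirp (i : nat) (p : {poly int}) : {poly {poly int}} :=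
  'X^i *: map_poly intr p.

Lemma Xn_mulrz_eq0 (i : nat) (z : int) : ('X^i : {poly int}) *~ z = 0 -> z = 0.
Proof.
move=> /(congr1 (fun u : {poly int} => u`_i)).
by rewrite coefMrz coefXn eqxx coef0 intz.
Qed.

Lemma polyint_intr_inj : injective (intr : int -> {poly int}).
Proof.
move=> a b /(congr1 (fun u : {poly int} => u`_0)).
by rewrite !coefMrz coef1 /= !intz.
Qed.

Lemma size_dirp i (p : {poly int}) : size (dirp i p) = size p.
Proof.
rewrite /dirp size_scale ?monic_neq0 ?monicXn//.
by rewrite size_map_inj_poly ?mulr0z//; exact: polyint_intr_inj.
Qed.

Lemma lead_dirp i (p : {poly int}) : lead_coef (dirp i p) = 'X^i *~ lead_coef p.
Proof.
rewrite /dirp lead_coefZ lead_coef_map_inj ?mulr0z//; last exact: polyint_intr_inj.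
by rewrite mulrzr.
Qed.

Lemma horner_dirp i (p : {poly int}) (n : int) : (dirp i p).[n%:~R] = 'X^i *~ p.[n].
Proof. by rewrite /dirp hornerZ horner_map/= mulrzr. Qed.

Lemma along_dirp i (p : {poly int}) : (1 < size p)%N -> along ('X^i) (dirp i p).
Proof.
move=> sp; split; first by rewrite size_dirp.
by exists (lead_coef p); [rewrite lead_coef_eq0 -size_poly_gt0 ltnW|exact: lead_dirp].
Qed.

Lemma along_dirpB i (p : {poly int}) j (q : {poly int}) : (1 < size p)%N -> (size q < size p)%N ->
  along ('X^i) (dirp i p - dirp j q).
Proof.
move=> sp qp; have [a1 [z z0 a2]] := along_dirp i sp.
have h : (size (- dirp j q) < size (dirp i p))%N by rewrite size_polyN !size_dirp.
by split; [rewrite size_polyDl|exists z => //; rewrite lead_coefDl].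
Qed.

Section iterate_products.
Context {R : realType} {S : sys R {poly int}} {l : nat}.
Context (p : 'I_l -> {poly int}).
Implicit Types (h : 'I_l -> S -> R).

Definition piter h (n : int) (y : S) (i : 'I_l) := h i (act S ('X^i *~ (p i).[n]) y).

Definition pprod h (z : int * S) := \prod_(i < l) piter h z.1 z.2 i.

Lemma piter_u1 h n i : u1 S (h i) -> u1 S (fun y => piter h n y i).
Proof. by move=> uh; exact: u1a. Qed.

Lemma pprod_u1 h n : (forall i, u1 S (h i)) -> u1 S (fun y => pprod h (n, y)).
Proof. by move=> uh; apply: u1_prod => i; exact: piter_u1. Qed.

Lemma pfilter_u1 h n (P : pred 'I_l) : (forall i, u1 S (h i)) ->
  u1 S (fun y => \prod_(i | P i) piter h n y i).
Proof.
move=> uh; apply: (eq_u1 (f := fun y => \prod_(i <- [seq i <- enum 'I_l | P i]) piter h n y i)).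
  by move=> y; rewrite big_filter big_enum_cond.
by apply: u1_prod => i; exact: piter_u1.
Qed.

End iterate_products.

Section blocks_of_duals.
Context {R : realType} (L : mean R) {S : sys R {poly int}} {l : nat}.
Context (p : 'I_l -> {poly int}) (h f : 'I_l -> S -> R) (ord : nat -> nat) (c : nat).
Hypothesis uf : forall i, u1 S (f i).
Hypothesis hd : forall i : 'I_l, (c < size (p i))%N ->
  is_dual L 'X^i (ord (size (p i))) (f i) (h i).

Lemma dual_blocks (kmax D : nat) (s : seq 'I_l) :
  (forall i, ord (size (p i)) <= kmax)%N -> (forall i, size (p i) <= D)%N ->
  exists B : seq (block L S), [/\ (size B <= size s)%N,
    all (fun b => border b <= kmax)%N B,
    all (fun b => (size (bpol b) <= D)%N) B &
    forall n y, \prod_(b <- B) bdual b (act S (bdir b *~ (bpol b).[n]) y) =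
      \prod_(i <- s | (c < size (p i))%N) piter p h n y i].
Proof.
move=> hk hD; elim: s => [|i s [B [B1 B2 B3 B4]]].
  by exists [::]; split=> // n y; rewrite !big_nil.
have [ci|ci] := boolP (c < size (p i))%N; last first.
  exists B; split=> // [|n y]; first exact: leqW.
  by rewrite big_cons (negbTE ci) B4.
exists (@Block R _ L S 'X^i (ord (size (p i))) (p i) (exist _ _ (uf i)) (h i) (hd ci) :: B).
split=> //=; [by rewrite hk|by rewrite hD|].
by move=> n y; rewrite !big_cons ci B4.
Qed.

End blocks_of_duals.

(** Once the higher degrees are left out, injectivity of the sizes makes [i0] the only iterate of
    top degree, so its differences with the others inherit its leading coefficient. *)
Lemma lower_gow_zero (l D t c : nat) : exists k,
  forall (R : realType) (L : mean R) (S : sys R {poly int}) (p : 'I_l -> {poly int})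
    (h : 'I_l -> S -> R) (i0 : 'I_l),
  (1 < c <= D)%N -> injective (fun i => size (p i)) -> size (p i0) = c ->
  (forall i, u1 S (h i)) -> hku L 'X^i0 k (h i0) = 0 ->
  gow L S t (fun n y => \prod_(i | (size (p i) <= c)%N) piter p h n y i) = 0.
Proof.
have [k0 hk0] := gow_zero {poly int} D l t.
exists (maxn k0 t.+2) => R L S p h i0 /andP[c1 cD] pinj pc uh h0.
have low n y : \prod_(i | (size (p i) <= c)%N) piter p h n y i =
    piter p h n y i0 * \prod_(i | (size (p i) < c)%N) piter p h n y i.
  rewrite (bigD1 i0) ?pc//=; congr (_ * _); apply: eq_bigl => i.
  rewrite [in RHS]ltn_neqAle andbC -pc; congr (~~ _ && _).
  by apply/eqP/eqP => [->//|/pinj].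
have [c2|c2] := ltnP 2 c.
  pose F := [seq (dirp i (p i), exist _ _ (uh i) : bfun S) | i : 'I_l <-
    [seq i <- enum 'I_l | (size (p i) < c)%N]].
  have inF v : v \in [seq x.1 | x <- F] -> exists2 i : 'I_l, v = dirp i (p i) & (size (p i) < c)%N.
    rewrite -map_comp => /mapP[i]; rewrite mem_filter => /andP[ic _] ->.
    by exists i.
  have := hk0 R L S 'X^i0 (dirp i0 (p i0)) F (h i0) (maxn k0 t.+2) (@Xn_mulrz_eq0 i0).
  rewrite size_dirp pc => <- //.
  - congr (gow L S t _); apply/funext => n; apply/funext => y.
    rewrite low horner_dirp /piter; congr (_ * _).
    rewrite /wprod big_map big_filter big_enum_cond/=.
    by apply: eq_bigr => i _; rewrite horner_dirp.
  - by rewrite size_map size_filter (leq_trans (count_size _ _))// size_enum_ord.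
  - by move=> v /inF[i -> ic]; rewrite size_dirp ltnW.
  - by apply: along_dirp; rewrite pc.
  - by move=> v /inF[i -> ic]; apply: along_dirpB; rewrite pc.
  - exact: leq_maxl.
(* In the linear case the other iterates are constant in [n] and form a weight, so [gow_linear]
   applies. *)
have {}c2 : c = 2%N by apply/eqP; rewrite eqn_leq c2.
pose a := (p i0)`_1; pose b0 := (p i0)`_0.
have a0 : a != 0 by rewrite /a -[1%N]/(2.-1)%N -c2 -pc lead_coef_eq0 -size_poly_gt0 pc c2.
pose h' y := h i0 (act S ('X^i0 *~ b0) y).
have uh' : u1 S h' by exact: u1a.
pose g' y := \prod_(i | (size (p i) < c)%N) piter p h 0 y i.
have ug' : u1 S g' by exact: pfilter_u1.
have E : (fun n y => \prod_(i | (size (p i) <= c)%N) piter p h n y i) =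
    (fun n y => g' y * h' (act S ('X^i0 *~ (a * n)) y)).
  apply/funext => n; apply/funext => y; rewrite low mulrC; congr (_ * _).
    apply: eq_bigr => i; rewrite c2 ltnS /piter => /size1_polyC ->.
    by rewrite !hornerC.
  rewrite /piter /h' -(actD (sysP S)) -mulrzDr; congr (h i0 (act S (_ *~ _) y)).
  by rewrite horner_coef pc c2 !big_ord_recl big_ord0/= expr0 mulr1 addr0 expr1.
rewrite E; apply/eqP; rewrite -sqrf_eq0 eq_le sqr_ge0 andbT.
apply: (le_trans (gow_linear L 'X^i0 t a uh' ug')).
rewrite box_eq0//; first by apply/allP => x /nseqP[->].
rewrite size_nseq hku_act//; apply: hku_eq0_le h0 => //; exact: leq_maxr.
Qed.

Section highest_degree_control.
Context {R : realType} (U : set_system nat) {UU : UltraFilter U}.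
Context (oU : \oo `<=` U) (M N : nat -> nat) (gMN : growing_intervals M N).
Local Notation L := (umean oU gMN).

Lemma theta_flatten (S : sys R {poly int}) (B : seq (block L S)) (g : nat -> S -> R)
    (b : int -> S -> R) : (forall j, u1 S (g j)) -> ub S b ->
  theta U M N S g (fun z => b z.1 z.2 *
    \prod_(c <- B) bdual c (act S (bdir c *~ (bpol c).[z.1]) z.2)) =
  theta U M N (msys B) (fun j z => g j (mproj z))
    (fun z => b z.1 (mproj z.2) * mprod (Q0 B) z.1 z.2).
Proof.
move=> ug hb; congr (ulim U _); apply/funext => j; congr interval_avg.
apply/funext => n /=.
rewrite (eq_ev (g := fun y => g j y * b n%:Z y *
    \prod_(c <- B) bdual c (act S (bdir c *~ (bpol c).[n%:Z]) y))); last first.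
  by move=> y; rewrite mulrA.
rewrite dual_flatten; last by apply: domM; [case: (ug j)|case: (hb n%:Z)].
by apply: eq_ev => z; rewrite -mulrA.
Qed.

Lemma theta_msys_vdc (S : sys R {poly int}) (B : seq (block L S)) (g : nat -> msys B -> R)
    (b : int -> S -> R) : (forall j, u1 (msys B) (g j)) -> ub S b ->
  theta U M N (msys B) g (fun z => b z.1 (mproj z.2) * mprod (Q0 B) z.1 z.2) ^+ 2 <=
  ev L (fun m => ev L (fun n => ev (msys B) (fun z =>
    1 * (b n (mproj z) * b (n + m) (mproj z) * mprod (shQ m (Q0 B)) n z)))).
Proof.
move=> ug hb.
have hb' : ub (msys B) (fun n z => b n (mproj z) * mprod (Q0 B) n z).
  by move=> n; apply: u1M; [exact: mproj_u1 (hb n)|exact: mprod_u1].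
apply: (le_trans (theta_vdc oU gMN ug hb')).
rewrite le_eqVlt; apply/orP; left; apply/eqP.
apply: eq_ev => m; apply: eq_ev => n; apply: eq_ev => z.
by rewrite mprod_shQ; ring.
Qed.

End highest_degree_control.

Lemma theta_control (l D c : nat) (ord : nat -> nat) : exists k,
  forall (R : realType) (U : set_system nat) (UU : UltraFilter U)
    (oU : \oo `<=` U) (M N : nat -> nat) (gMN : growing_intervals M N)
    (S : sys R {poly int}) (p : 'I_l -> {poly int}) (h f : 'I_l -> S -> R)
    (g : nat -> S -> R) (i0 : 'I_l),
  (1 < c <= D)%N -> injective (fun i => size (p i)) -> (forall i, (size (p i) <= D)%N) ->
  size (p i0) = c -> (forall i, u1 S (h i)) -> (forall i, u1 S (f i)) ->
  (forall j, u1 S (g j)) ->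
  (forall i : 'I_l, (c < size (p i))%N ->
     is_dual (umean oU gMN) 'X^i (ord (size (p i))) (f i) (h i)) ->
  hku (umean oU gMN) 'X^i0 k (h i0) = 0 ->
  theta U M N S g (pprod p h) = 0.
Proof.
pose kmax := (\max_(s < D.+1) ord s)%N.
(* The initial van der Corput step doubles the single time of each block, hence [2]; its parameter
   [m] also adds one order to the Gowers norm, hence [t.+1] below. *)
have [t t0 ht] := multi_elim D l kmax 2.
have [k hk] := lower_gow_zero l D t.+1 c.
exists k => R U UU oU M N gMN S p h f g i0 cD pinj pD pc uh uf ug hd h0.
have ordk i : (ord (size (p i)) <= kmax)%N.
  have si : (size (p i) < D.+1)%N by rewrite ltnS.
  exact: (leq_bigmax (F := fun s : 'I_D.+1 => ord s) (Ordinal si)).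
have [B [B1 B2 B3 B4]] := dual_blocks uf hd (enum 'I_l) ordk pD.
pose b n y := \prod_(i | (size (p i) <= c)%N) piter p h n y i.
have hb : ub S b by move=> n; exact: pfilter_u1.
have E : pprod p h = (fun z => b z.1 z.2 *
    \prod_(c <- B) bdual c (act S (bdir c *~ (bpol c).[z.1]) z.2)).
  apply/funext => z; rewrite B4 /pprod (bigID (fun i => (size (p i) <= c)%N))/=.
  congr (_ * _); rewrite big_enum_cond/=; apply: eq_bigl => i.
  by rewrite -ltnNge.
rewrite E (theta_flatten B ug hb).
set th := theta _ _ _ _ _ _.
have ug' j : u1 (msys B) (fun z => g j (mproj z)) by exact: mproj_u1.
have h1 : th ^+ 2 <= _ := theta_msys_vdc ug' hb.
apply: (@even_pow_le0 _ _ t); rewrite expnS exprM.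
rewrite -(hk R _ S p h i0 cD pinj pc uh h0) -/b.
set A := ev _ _ in h1.
apply: (@le_trans _ _ (A ^+ (2 ^ t))).
  by rewrite lerXn2r ?nnegrE ?sqr_ge0// (le_trans _ h1)// sqr_ge0.
have hQ m : all (fun qs => (size qs <= 2)%N && all (fun q : {poly int} => (size q <= D)%N) qs)
    (shQ m (Q0 B)).
  rewrite /shQ /Q0 -map_comp all_map; apply: sub_all B3 => q /= qD.
  by rewrite size_pshift qD.
have hub m := ub_step m hb.
apply: gow_even_le => // [||m].
- apply: (@mdom1 _ _ _ 1) => m; apply: ev_norm_le => [|n].
    apply: (@mdom1 _ _ _ 1) => n; apply: u1_ev; apply: u1M; first exact: u1_cst1.
    by apply: u1M; [exact: (mproj_u1 B (hub m n))|exact: mprod_u1].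
  apply: u1_ev; apply: u1M; first exact: u1_cst1.
  by apply: u1M; [exact: (mproj_u1 B (hub m n))|exact: mprod_u1].
- exact: gow_dom.
apply: (ht R {poly int} _ S B (shQ m (Q0 B)) (fun n y => b n y * b (n + m) y) (fun=> 1)) => //.
- by rewrite (leq_trans B1)// size_enum_ord.
- exact: u1_cst1.
Qed.

(** * Replacing the highest degree functions by dual functions *)

Section dual_functions.
Context {R : realType} {G : zmodType} (L : mean R) (S : sys R G) (e : G).

Lemma iproj_ev k (f : S -> R) : ev (isys L k S) (fun z => f (iproj z)) = ev S f.
Proof.
elim: k => [//|k IH].
exact: (etrans (ev_cst L (ev (isys L k S) (fun z => f (iproj z)))) IH).
Qed.

Lemma dualfD k (g g' f : S -> R) : dom S g -> dom S g' -> u1 S f ->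
  dualf L e k (fun y => g y + g' y) f = dualf L e k g f + dualf L e k g' f.
Proof.
move=> dg dg' uf; have dc := u1_dom (dcube_u1 L e k uf).
rewrite !dualf_dcube -evD; try exact: (domM (iproj_dom L k _) dc).
by apply: eq_ev => z; rewrite mulrDl.
Qed.

Lemma dualfZ k c (g f : S -> R) : dom S g -> u1 S f ->
  dualf L e k (fun y => c * g y) f = c * dualf L e k g f.
Proof.
move=> dg uf; have dc := u1_dom (dcube_u1 L e k uf).
rewrite !dualf_dcube -evZ; last exact: (domM (iproj_dom L k dg) dc).
by apply: eq_ev => z; rewrite mulrA.
Qed.

Lemma dualf_le k (g f : S -> R) : dom S g -> dom S (fun y => `|g y|) -> u1 S f ->
  `|dualf L e k g f| <= ev S (fun y => `|g y|).
Proof.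
move=> dg dng uf; have [dc c1] := dcube_u1 L e k uf.
have dgi := iproj_dom L k dg; have dni := iproj_dom L k dng.
have gc (z : isys L k S) : `|g (iproj z) * dcube e f z| <= `|g (iproj z)|.
  by rewrite normrM ler_piMr//; exact: c1.
have dgc := domM dgi dc.
rewrite dualf_dcube -(iproj_ev k) ler_norml -evN//.
apply/andP; split; apply: ev_le => //; first exact: domN.
  by move=> z; have := gc z; rewrite ler_norml => /andP[].
by move=> z; have := gc z; rewrite ler_norml => /andP[].
Qed.

End dual_functions.

Section replacement.
Context d (X : measurableType d) (R : realType) (mu : probability X R).
Context (l : nat) (T : 'I_l -> inv_mpt mu).
Hypothesis TC : forall (i j : 'I_l) x, T i (T j x) = T j (T i x).
Context (U : set_system nat) {UU : UltraFilter U}.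
Context (oU : \oo `<=` U) (M N : nat -> nat) (gMN : growing_intervals M N).
Context (p : 'I_l -> {poly int}) (g : nat -> X -> R).
Local Notation S := (psys TC).
Local Notation xf := (xfnl mu).
Local Notation L := (umean oU gMN).
Hypothesis ug : forall j, u1 xf (g j).
Implicit Types (h : 'I_l -> X -> R) (i : 'I_l) (G : X -> R).

Definition upd h i G : 'I_l -> X -> R := fun j => if j == i then G else h j.

Lemma upd_u1 h i G : (forall j, u1 xf (h j)) -> u1 xf G -> forall j, u1 xf (upd h i G j).
Proof. by move=> uh uG j; rewrite /upd; case: ifP. Qed.

Lemma upd_id h i : upd h i (h i) = h.
Proof. by apply/funext => j; rewrite /upd; case: eqP => [->|]. Qed.

Local Notation Th h := (theta U M N S g (pprod (S := S) p h)).

Let rest h i (z : int * X) := \prod_(j | j != i) piter (S := S) p h z.1 z.2 j.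

Let pprod_upd h i G (z : int * X) : pprod (S := S) p (upd h i G) z =
  G (act S ('X^i *~ (p i).[z.1]) z.2) * rest h i z.
Proof.
rewrite /pprod (bigD1 i)//= {1}/piter /upd eqxx; congr (_ * _).
by apply: eq_bigr => j ji; rewrite /piter (negbTE ji).
Qed.

Let rest_u1 h i n : (forall j, u1 xf (h j)) -> u1 xf (fun x => rest h i (n, x)).
Proof. by move=> uh; exact: (pfilter_u1 (S := S)). Qed.

Let upd_dom h i G : (forall j, u1 xf (h j)) -> mb G ->
  dom (ext L S) (pprod (S := S) p (upd h i G)).
Proof.
move=> uh mG; have [_ [B GB]] := mG; split=> [|n].
  exists B => -[n x]; rewrite pprod_upd normrM -[leRHS]mulr1 ler_pM//.
  by case: (rest_u1 i n uh).
apply: (eq_dom (f := fun x => G (act S ('X^i *~ (p i).[n]) x) * rest h i (n, x))).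
  by move=> x; rewrite pprod_upd.
apply: domM; first exact: (dom_act (sysP S) _ mG).
exact: u1_dom (rest_u1 i n uh).
Qed.

(** The weights and the other functions are at most 1 in absolute value and the action preserves
    [mu], so the functional is dominated by the L1 norm of the function in slot [i]. *)
Lemma slot_riesz h i : (forall j, u1 xf (h j)) ->
  exists2 F, u1 xf F & forall G, mb G -> Th (upd h i G) = xev mu (fun x => F x * G x).
Proof.
move=> uh; apply: riesz.
- move=> G G' mG mG'; rewrite -(thetaD ug (upd_dom i uh mG) (upd_dom i uh mG')).
  by congr theta; apply/funext => z; rewrite !pprod_upd mulrDl.
- move=> c G mG; rewrite -(thetaZ ug c (upd_dom i uh mG)).
  by congr theta; apply/funext => z; rewrite !pprod_upd mulrA.
move=> G mG; apply: (theta_norm ug (upd_dom i uh mG)) => j n.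
pose a := 'X^i *~ (p i).[n] : {poly int}.
have [dg g1] := ug j; have [dr r1] := rest_u1 i n uh.
have mGa : dom S (fun x => G (act S a x)) by exact: (dom_act (sysP S) _ mG).
have -> : xev mu (fun x => `|G x|) = ev S (fun y => `|G (act S a y)|).
  exact: (esym (ev_act (sysP S) a (mb_norm mG))).
rewrite ler_norml.
have d1 : dom S (fun y => g j y * pprod (S := S) p (upd h i G) (n, y)).
  by apply: domM => //; exact: (upd_dom i uh mG).2.
have d2 : dom S (fun y => `|G (act S a y)|) by exact: (dom_act (sysP S) _ (mb_norm mG)).
rewrite -evN//; apply/andP; split; apply: ev_le => //; try exact: domN.
all: move=> y; have : `|g j y * pprod (S := S) p (upd h i G) (n, y)| <= `|G (act S a y)|.
1,3: rewrite pprod_upd mulrCA normrM ler_piMr// normrM mulr_ile1//.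
all: by rewrite ler_norml => /andP[].
Qed.

Lemma replace_by_dual h i k : (forall j, u1 xf (h j)) -> Th h <> 0 ->
  (forall h', (forall j, u1 xf (h' j)) -> (forall j, j != i -> h' j = h j) ->
    hku L 'X^i k (h' i) (S := S) = 0 -> Th h' = 0) ->
  exists F D, [/\ u1 xf F, is_dual (S := S) L 'X^i k F D & Th (upd h i D) <> 0].
Proof.
move=> uh h0 ctl; have [F uF hF] := slot_riesz i uh.
have dF := u1_dom uF.
have FF0 : xev mu (fun x => F x * F x) != 0.
  apply: contra_not_neq h0 => F0; rewrite -(upd_id h i) hF; last by case: (uh i).
  apply/eqP; rewrite -sqrf_eq0 eq_le sqr_ge0 andbT.
  have := ev_CS dF (u1_dom (uh i)).
  by rewrite [ev xf (fun y => F y * F y)]F0 mul0r.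
have kF : hku L 'X^i k F (S := S) <> 0.
  move=> k0; move/eqP: FF0; apply; rewrite -hF//; apply: ctl.
  - exact: upd_u1.
  - by move=> j ji; rewrite /upd (negbTE ji).
  - by rewrite /upd eqxx.
have [D uD hD] : exists2 D, u1 xf D &
    forall G, mb G -> dualf L 'X^i k G F (S := S) = xev mu (fun x => D x * G x).
  apply: riesz => [G G' mG mG'|c G mG|G mG].
  - exact: (dualfD L ('X^i) (S := S)).
  - exact: (dualfZ L ('X^i) (S := S)).
  - exact: (dualf_le L ('X^i) (S := S) k mG (mb_norm mG)).
exists F, D; split=> //.
  split=> // G mG; rewrite (hD G mG).
  exact: (eq_ev (S := xf) (fun x => mulrC _ _)).
rewrite hF; last by case: uD.
move=> FD; apply: kF; rewrite -dualf_diag (hD _ dF) -[RHS]FD.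
exact: (eq_ev (S := xf) (fun x => mulrC _ _)).
Qed.

End replacement.

(* [Th] stands for the limit along an ultrafilter of the weighted averages, as a
   function of the family [h]. *)
Definition for_all_averages (l D : nat) (P : forall (d : measure_display) (X : measurableType d)
    (R : realType) (mu : probability X R) (T : 'I_l -> inv_mpt mu)
    (TC : forall (i j : 'I_l) x, T i (T j x) = T j (T i x))
    (L : mean R) (p : 'I_l -> {poly int}) (h : 'I_l -> X -> R)
    (Th : ('I_l -> X -> R) -> R), Prop) : Prop :=
  forall (d : measure_display) (X : measurableType d)
    (R : realType) (mu : probability X R) (T : 'I_l -> inv_mpt mu)
    (TC : forall (i j : 'I_l) x, T i (T j x) = T j (T i x))
    (U : set_system nat) (UU : UltraFilter U)
    (oU : \oo `<=` U) (M N : nat -> nat) (gMN : growing_intervals M N)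
    (p : 'I_l -> {poly int}) (g : nat -> X -> R) (h : 'I_l -> X -> R),
  injective (fun i => size (p i)) -> (forall i, (size (p i) <= D)%N) ->
  (forall j, u1 (xfnl mu) (g j)) -> (forall i, u1 (xfnl mu) (h i)) ->
  P d X R mu T TC (umean oU gMN) p h
    (fun h => theta U M N (psys TC) g (pprod (S := psys TC) p h)).

(** The orders are built from the top downward: the one needed at size [c.+1] comes from
    [theta_control] and depends on those already fixed above. Induction is on the number of sizes
    between [c] and [D]. *)
Lemma dualize_above (l D c : nat) : (0 < c)%N -> exists ord : nat -> nat,
  for_all_averages (l := l) D (fun d X R mu T TC L p h Th => Th h <> 0 ->
    exists h' f', [/\ forall i, u1 (xfnl mu) (h' i), forall i, u1 (xfnl mu) (f' i),
      forall i, (c < size (p i))%N ->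
        is_dual (S := psys TC) L 'X^i (ord (size (p i))) (f' i) (h' i),
      forall i, (size (p i) <= c)%N -> h' i = h i & Th h' <> 0]).
Proof.
have [n] : exists n, (D <= c + n)%N by exists D; exact: leq_addl.
elim: n c => [|n IH] c Dc c0.
  exists id => d X R mu T TC U UU oU M N gMN p g h pinj pD ug uh h0.
  exists h, h; split=> // i ci; exfalso.
  by move: (leq_trans (pD i) Dc); rewrite addn0 leqNgt ci.
have [ord hord] := IH c.+1 (leq_trans Dc (eq_leq (esym (addSnnS c n)))) (ltn0Sn c).
have [k hk] := theta_control l D c.+1 ord.
exists (fun s => if s == c.+1 then k else ord s).
move=> d X R mu T TC U UU oU M N gMN p g h pinj pD ug uh h0.
have [h1 [f1 [uh1 uf1 d1 e1 h10]]] :=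
  hord d X R mu T TC U UU oU M N gMN p g h pinj pD ug uh h0.
have above i : (c < size (p i))%N -> size (p i) != c.+1 -> (c.+1 < size (p i))%N.
  by move=> ci ne; rewrite ltn_neqAle eq_sym ne.
have [i /eqP pi|none] := pickP (fun i => size (p i) == c.+1); last first.
  exists h1, f1; split=> // i ci; last by apply: e1; exact: leqW.
  by rewrite none; apply: d1; apply: above => //; rewrite none.
have cD : (1 < c.+1 <= D)%N by rewrite ltnS c0 -pi pD.
have [|F [G [uF dG G0]]] := @replace_by_dual _ X R mu l T TC U UU oU M N gMN p g ug h1 i k uh1 h10.
  move=> h' uh' e' hk0.
  apply: (hk R U UU oU M N gMN (psys TC) p h' f1 g i) => // j cj.
  rewrite e'; first exact: d1.
  by apply: contraTneq cj => ->; rewrite pi ltnn.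
exists (upd h1 i G), (upd f1 i F); split=> //.
- by apply: upd_u1 => //; case: dG.
- exact: upd_u1.
- move=> j cj; rewrite /upd; have [->|ji] := eqVneq j i; first by rewrite pi eqxx.
  have pj : size (p j) != c.+1 by apply: contra ji => /eqP pj; apply/eqP/pinj; rewrite pj.
  by rewrite (negbTE pj); apply: d1; exact: above.
move=> j cj; rewrite /upd; have [ji|ji] := eqVneq j i.
  by move: cj; rewrite ji pi ltnn.
by apply: e1; exact: leqW.
Qed.

(** Dualizing above the size of [p i] leaves [h i] unchanged, so its vanishing seminorm still
    controls the modified average. *)
Lemma poly_control (l D : nat) : exists k,
  for_all_averages (l := l) D (fun d X R mu T TC L p h Th =>
    forall i, (1 < size (p i))%N -> hku L 'X^i k (h i) (S := psys TC) = 0 -> Th h = 0).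
Proof.
have [c s t st hs|c cD|k hk] := @uniform_bound D (fun c k => (1 < c)%N ->
    for_all_averages (l := l) D (fun d X R mu T TC L p h Th => forall i,
      size (p i) = c -> hku L 'X^i k (h i) (S := psys TC) = 0 -> Th h = 0)).
- move=> c1 d X R mu T TC U UU oU M N gMN p g h pinj pD ug uh i pi h0.
  apply: (hs c1 d X R mu T TC U UU oU M N gMN p g h pinj pD ug uh i pi).
  by apply: hku_eq0_le h0.
- have [c1|c1] := leqP c 1; first by exists 0%N.
  have [ord hord] := dualize_above l D (ltnW c1).
  have [k hk] := theta_control l D c ord.
  exists k => _ d X R mu T TC U UU oU M N gMN p g h pinj pD ug uh i pi h0.
  apply: contrapT => /(hord d X R mu T TC U UU oU M N gMN p g h pinj pD ug uh).
  move=> [h' [f' [uh' uf' d' e' h'0]]]; apply: h'0.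
  apply: (hk R U UU oU M N gMN (psys TC) p h' f' g i) => //; first by rewrite c1.
  by rewrite e' ?pi.
exists k => d X R mu T TC U UU oU M N gMN p g h pinj pD ug uh i pi h0.
exact: (hk _ (pD i) pi d X R mu T TC U UU oU M N gMN p g h pinj pD ug uh i).
Qed.

(** * From weak limits to convergence in L2 *)

Section convergence.
Context d (X : measurableType d) (R : realType) (mu : probability X R).
Context (l : nat) (T : 'I_l -> inv_mpt mu).
Hypothesis TC : forall (i j : 'I_l) x, T i (T j x) = T j (T i x).
Context (p : 'I_l -> {poly int}) (h : 'I_l -> X -> R) (M N : nat -> nat).
Hypothesis uh : forall i, u1 (xfnl mu) (h i).
Local Notation S := (psys TC).

Definition pavg (j : nat) (x : X) :=
  interval_avg (fun n => pprod (S := S) p h (n%:Z, x)) (M j) (N j).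

Lemma pavg_u1 j : u1 (xfnl mu) (pavg j).
Proof.
have up n : u1 (xfnl mu) (fun x => pprod (S := S) p h (n%:Z, x)).
  exact: (pprod_u1 (S := S)).
split=> [|x]; last by apply: interval_avg_norm => // i; case: (up i).
apply: (domZ (S := xfnl mu)); apply: (dom_sum (S := xfnl mu)) => n.
exact: u1_dom (up n).
Qed.

(* The squared norm of an average is the same average weighted by itself, so weak
   convergence against varying weights suffices. *)
Lemma pavg_sqr_cvg0 :
  (forall U (UU : UltraFilter U), \oo `<=` U ->
    forall g, (forall j, u1 (xfnl mu) (g j)) -> theta U M N S g (pprod (S := S) p h) = 0) ->
  xev mu (fun x => pavg j x * pavg j x) @[j --> \oo] --> (0 : R).
Proof.
move=> h0; apply: cvg0_ultra => U UU oU.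
rewrite -(h0 U UU oU pavg pavg_u1) /theta.
have E : (fun j => xev mu (fun x => pavg j x * pavg j x)) = (fun j => interval_avg
    (fun n => ev S (fun y => pavg j y * pprod (S := S) p h (n%:Z, y))) (M j) (N j)).
  apply/funext => j; rewrite /interval_avg.
  have dj n : dom (xfnl mu) (fun y => pavg j y * pprod (S := S) p h (n%:Z, y)).
    by apply: domM; [exact: u1_dom (pavg_u1 j)|exact: u1_dom (pprod_u1 (S := S) p n%:Z uh)].
  rewrite -(ev_sum (index_iota (M j) (N j)) dj) -evZ; last exact: dom_sum.
  apply: (eq_ev (S := xfnl mu)) => y.
  by rewrite -mulr_sumr mulrCA.
rewrite E; apply: ulim_cvg; exists 1 => j; apply: interval_avg_norm => // n.
by apply: u1_ev; apply: (u1M (S := xfnl mu)); [exact: pavg_u1|exact: (pprod_u1 (S := S))].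
Qed.

End convergence.

Theorem theorem1p2 (d l : nat) :
  exists k : nat,
    forall (R : realType) (disp : measure_display) (X : measurableType disp)
      (mu : probability X R) (T : 'I_l -> inv_mpt mu) (f : 'I_l -> X -> R)
      (p : 'I_l -> {poly int}),
    (forall (i j : 'I_l) (x : X), T i (T j x) = T j (T i x)) ->
    (forall i : 'I_l, f i \in Lfun mu +oo%E) ->
    injective (fun i : 'I_l => size (p i)) ->
    (\max_(i < l) (size (p i)).-1)%N = d ->
    forall (i : 'I_l) (Z : set (set X)),
      (1 < size (p i))%N ->
      is_hk_factor (T i) k Z ->
      orth mu (f i) Z ->
      uavg_cvg_L2 mu
        (fun (n : nat) (x : X) =>
           \prod_(j < l) f j (mpt_iter (T j) (p j).[n%:Z] x))
        (fun=> 0).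
Proof.
have [k hk] := poly_control l d.+1; exists k.
move=> R disp X mu T f p TC fL pinj pd i Z pi [_ _ Zf] /(Zf _ (fL i)) fi0 M N gMN.
have pD j : (size (p j) <= d.+1)%N.
  apply: leq_trans (leqSpred _) _; rewrite ltnS -pd.
  exact: (leq_bigmax (F := fun j => (size (p j)).-1)).
have /choice[Ch hCh] : forall j, exists Ch : R * (X -> R), [/\ 0 < Ch.1,
    u1 (xfnl mu) Ch.2, measurable_fun setT (f j) &
    mu.-negligible [set x | f j x <> Ch.1 * Ch.2 x]].
  by move=> j; have [C [h H]] := Linfty_unit (fL j); exists (C, h).
pose C j := (Ch j).1; pose h j := (Ch j).2.
have uh j : u1 (xfnl mu) (h j) by case: (hCh j).
have mf j : measurable_fun setT (f j) by case: (hCh j).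
have mCh j : measurable_fun setT (fun x => C j * h j x).
  by apply: measurable_funM => //; case: (uh j) => -[].
have fCh j : mu.-negligible [set x | f j x <> C j * h j x] by case: (hCh j).
have hki L : hku L 'X^i k (h i) (S := psys TC) = 0.
  (* Orthogonality to the factor of index [k] gives a vanishing seminorm of order [k.+1], hence of
     order [k]. *)
  apply: (hku_eq0_le (S := psys TC) (uh i) (leqnSn k)).
  move: fi0; rewrite (hk_ae _ _ _ (mf i) (mCh i) (fCh i)) => h0.
  have := hk_hku TC L i k (C i) (uh i); rewrite h0 expr0n expn_eq0/=.
  move=> /esym/eqP; rewrite mulf_eq0 expf_eq0 gt_eqF ?andbF//=; last by case: (hCh i).
  by move=> /eqP.
have cv := @pavg_sqr_cvg0 _ X R mu l T TC p h M N uh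
  (fun U UU oU g ug => hk _ X R mu T TC U UU oU M N gMN p g h pinj pD ug uh i pi (hki _)).
set W := \prod_(j < l) C j; pose avg := pavg TC p h M N.
have uavg j : u1 (xfnl mu) (avg j) by exact: pavg_u1.
have mavg j : mb (fun x => W * avg j x) by apply: (domZ (S := xfnl mu)); case: (uavg j).
have E j : ('N[mu]_2%:E[EFin \o (fun x => interval_avg
    (fun n => \prod_(j < l) f j (mpt_iter (T j) (p j).[n%:Z] x)) (M j) (N j) - 0)%R] =
    (Num.sqrt (W ^+ 2 * xev mu (fun x => avg j x * avg j x))%R)%:E)%E.
  rewrite -xevZ; last by apply: mbM; case: (uavg j).
  rewrite (_ : (fun x => W ^+ 2 * (avg j x * avg j x)) =
    (fun x => (W * avg j x) * (W * avg j x))); last by apply/funext => x; ring.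
  rewrite -Lnorm2_sqr//; apply: Lnorm_ae_eq.
  - apply: measurable_funB; last exact: measurable_cst.
    apply: measurable_funM; first exact: measurable_cst.
    apply: measurable_sum => n; apply: measurable_prod => i' _.
    by apply: measurableT_comp => //; exact: measurable_mpt_iter.
  - by case: (mavg j).
  (* Each [f i'] is a multiple of a function in the unit ball off a null set only; all times and all
     functions together exclude a countable union of null sets, indexed by naturals through
     [insub]. *)
  pose bad n m : set X := if insub m is Some i' then
    [set x | f i' (mpt_iter (T i') (p i').[n%:Z] x) <>
      C i' * h i' (mpt_iter (T i') (p i').[n%:Z] x)] else set0.
  have nbad : mu.-negligible (\bigcup_n \bigcup_m bad n m).
    apply: negligible_bigcup => n; apply: negligible_bigcup => m.
    rewrite /bad; case: insubP => [i' _ _|_]; last exact: negligible_set0.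
    exact: (negligible_iter T i' (p i').[n%:Z] (fCh i')).
  apply: negligibleS nbad => x /= nE; apply: contrapT => nb; apply: nE => _ /=.
  congr EFin; rewrite subr0 /avg /pavg -interval_avgZ; congr interval_avg.
  apply/funext => n; rewrite /W /pprod -big_split/=; apply: eq_bigr => i' _.
  apply: contrapT => ne; apply: nb; exists n => //; exists i' => //.
  by rewrite /bad valK /=; move: ne; rewrite /piter psys_line.
apply: cvg_EFin; first by apply: nearW => j; rewrite E.
rewrite (_ : _ \o _ = fun j => Num.sqrt (W ^+ 2 * xev mu (fun x => avg j x * avg j x))).
  2: by apply/funext => j; rewrite /= E.
have h0 : W ^+ 2 * xev mu (fun x => avg j x * avg j x) @[j --> \oo] --> W ^+ 2 * 0.
  exact: cvgM (cvg_cst _) cv.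
have := cvg_comp _ _ h0 (@sqrt_continuous R (W ^+ 2 * 0)).
by rewrite mulr0 sqrtr0.
Qed.
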